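(* Let $A$ be a Young function with complementary function $\hat A$. Let $\alpha>\gamma>0$, $\gamma<1$, and define the measure $d\mu=\frac{dx\,dt}{|t|^n}$ on $\mathbb{R}^n\times\mathbb{R}^n$ and the kernel $$K(z,x,t):=\frac{G_\alpha(z-x)-G_\alpha(z-x+t)}{|t|^\gamma}.$$ Then there exists $C>0$ such that $$\int_{\mathbb{R}^n}\iint_{\mathbb{R}^n\times\mathbb{R}^n}|K(z,x,t)\,v(x,t)\,w(z)|\,d\mu\,dz\leq C\|v\|_{L^A(d\mu)}\|w\|_{L^{\hat A}(\mathbb{R}^n)}$$ holds for any $v\in L^A(d\mu)$ and $w\in L^{\hat A}(\mathbb{R}^n)$.
   Context: A Young function is a function $A:[0,\infty)\to[0,\infty)$ that is convex, increasing, with $A(0)=0$, $\lim_{t\to0^+}A(t)/t=0$ and $\lim_{t\to\infty}A(t)/t=\infty$ (extended evenly to $\mathbb{R}$). Its complementary function is $\hat A(t)=\sup\{tw-A(w):w>0\}$. For a measure $\nu$ on a space $X$, $L^A(\nu)=\{v:X\to\mathbb{R}\text{ measurable}:\int_XA(|v|)\,d\nu<\infty\}$ with Luxemburg norm $\|v\|_{L^A(\nu)}=\inf\{\lambda>0:\int_XA(|v|/\lambda)\,d\nu\le1\}$; $L^A(\mathbb{R}^n)$ refers to Lebesgue measure, and $L^A(d\mu)$ to functions of $(x,t)\in\mathbb{R}^n\times\mathbb{R}^n$ with the measure $\mu$. The Bessel kernel is $G_\alpha=\mathcal{F}^{-1}\big((1+|\xi|^2)^{-\alpha/2}\big)$,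 where $\mathcal{F}f(\xi)=\int_{\mathbb{R}^n}e^{-ix\cdot\xi}f(x)\,dx$; $G_\alpha\in L^1(\mathbb{R}^n)$ for $\alpha>0$. *)

(* Defs.v *)
From HB Require Import structures.
From mathcomp Require Import all_boot all_order all_algebra.
From mathcomp Require Import all_classical all_reals all_analysis.
From mathcomp Require Import measurable_realfun complex.
Set Implicit Arguments.
Unset Strict Implicit.
Unset Printing Implicit Defensive.
Import Order.TTheory GRing.Theory Num.Theory.
Import numFieldNormedType.Exports.

Local Open Scope classical_set_scope.
Local Open Scope ring_scope.

(* The Borel sigma-algebra of R^n, generated by the coordinate projections
   (same construction as the library's for n.-tuple). *)
Definition measure_rV_display : measure_display -> measure_display.
Proof. exact. Qed.

Section measurable_rV.
Context {R : realType} {n : nat}.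

Let coors : 'I_n -> 'rV[R]_n -> R := fun i x => x ord0 i.

Let rV_set0 : g_sigma_preimage coors set0.
Proof. exact: sigma_algebra0. Qed.

Let rV_setC A : g_sigma_preimage coors A -> g_sigma_preimage coors (~` A).
Proof. exact: sigma_algebraC. Qed.

Let rV_bigcup (F : _^nat) : (forall i, g_sigma_preimage coors (F i)) ->
  g_sigma_preimage coors (\bigcup_i (F i)).
Proof. exact: sigma_algebra_bigcup. Qed.

HB.instance Definition _ :=
  @isMeasurable.Build (measure_rV_display default_measure_display)
    'rV[R]_n (g_sigma_preimage coors) rV_set0 rV_setC rV_bigcup.

End measurable_rV.

Lemma measurable_coord (R : realType) n (i : 'I_n) :
  measurable_fun [set: 'rV[R]_n] (fun x : 'rV[R]_n => x ord0 i).
Proof.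
move=> _ Y mY; rewrite setTI; apply: sub_sigma_algebra => /=.
rewrite -bigcup_seq/=; exists i => /=; first by rewrite mem_index_enum.
by exists Y => //; rewrite setTI.
Qed.

Lemma measurable_fun_coordP d (T : measurableType d) (R : realType) n
    (f : T -> 'rV[R]_n) :
  (forall i, measurable_fun [set: T] (fun x => f x ord0 i)) ->
  measurable_fun [set: T] f.
Proof.
move=> mf _ B mB; rewrite setTI.
suff: <<s \big[setU/set0]_(i < n) preimage_set_system [set: 'rV[R]_n]
    (fun x : 'rV[R]_n => x ord0 i) measurable >> `<=`
    [set B | measurable (f @^-1` B)] by exact.
apply: smallest_sub.
  split => /=.
  - by rewrite preimage_set0.
  - by move=> C mC; rewrite setTD -preimage_setC; exact: measurableC.
  - by move=> F mF; rewrite preimage_bigcup; exact: bigcupT_measurable.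
move=> C; rewrite -bigcup_seq => -[i _ [D mD <-]] /=.
rewrite setTI -comp_preimage.
by rewrite -[X in measurable X]setTI; exact: mf.
Qed.

(* Identifies R * R^n with R^(n+1). *)
Definition rV_cons (R : realType) n (p : R * 'rV[R]_n) : 'rV[R]_n.+1 :=
  \row_i (if unlift ord0 i is Some j then p.2 ord0 j else p.1).

Lemma rV_cons0 (R : realType) n (p : R * 'rV[R]_n) :
  rV_cons p ord0 ord0 = p.1.
Proof. by rewrite mxE unlift_none. Qed.

Lemma rV_consS (R : realType) n (p : R * 'rV[R]_n) (i : 'I_n) :
  rV_cons p ord0 (lift ord0 i) = p.2 ord0 i.
Proof. by rewrite mxE liftK. Qed.

Lemma measurable_rV_cons (R : realType) n :
  measurable_fun [set: R * 'rV[R]_n] (@rV_cons R n).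
Proof.
apply: measurable_fun_coordP => i; case: (unliftP ord0 i) => [j|] ->.
  apply: (eq_measurable_fun (fun p : R * 'rV[R]_n => p.2 ord0 j)).
    by move=> x _; rewrite rV_consS.
  exact: (measurableT_comp (measurable_coord j) measurable_snd).
apply: (eq_measurable_fun fst); last exact: measurable_fst.
by move=> x _; rewrite rV_cons0.
Qed.

Section lebesgue_rV_step.
Local Open Scope ereal_scope.
Context (R : realType) (n : nat).
Variable m : {sigma_finite_measure set 'rV[R]_n -> \bar R}.

Definition lebesgue_rV_step : set 'rV[R]_n.+1 -> \bar R :=
  pushforward (@lebesgue_measure R \x m) (@rV_cons R n).

Let step0 : lebesgue_rV_step set0 = 0.
Proof. by rewrite /lebesgue_rV_step /pushforward preimage_set0 measure0. Qed.

Let step_ge0 A : 0 <= lebesgue_rV_step A.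
Proof. exact: (measure_ge0 (@lebesgue_measure R \x m)). Qed.

Let step_sigma_additive : semi_sigma_additive lebesgue_rV_step.
Proof.
move=> F mF tF mUF; rewrite /lebesgue_rV_step /pushforward preimage_bigcup.
apply: measure_semi_sigma_additive.
- move=> k; rewrite -[X in measurable X]setTI.
  exact: (@measurable_rV_cons R n).
- apply/trivIsetP => /= i j _ _ ij; rewrite -preimage_setI.
  by move/trivIsetP : tF => /(_ _ _ _ _ ij) ->//; rewrite preimage_set0.
- rewrite -preimage_bigcup -[X in measurable X]setTI.
  exact: (@measurable_rV_cons R n).
Qed.

HB.instance Definition _ := isMeasure.Build _ _ _
  lebesgue_rV_step step0 step_ge0 step_sigma_additive.

Let step_sigma_finite : sigma_finite setT lebesgue_rV_step.
Proof.
have /sigma_finiteP[F [FT ndF Ffin]] := sigma_finiteT (@lebesgue_measure R).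
have /sigma_finiteP[G [GT ndG Gfin]] := sigma_finiteT m.
pose uncons (x : 'rV[R]_n.+1) : R * 'rV[R]_n :=
  (x ord0 ord0, \row_i x ord0 (lift ord0 i)).
have consK : cancel (@rV_cons R n) uncons.
  move=> [a y]; rewrite /uncons rV_cons0/=; congr pair.
  by apply/rowP => i; rewrite mxE rV_consS.
have muncons : measurable_fun setT uncons.
  apply: measurable_fun_pair; first exact: measurable_coord.
  apply: measurable_fun_coordP => i.
  apply: (eq_measurable_fun (fun x : 'rV[R]_n.+1 => x ord0 (lift ord0 i))).
    by move=> x _; rewrite mxE.
  exact: measurable_coord.
exists (fun k => uncons @^-1` (F k `*` G k)).
  apply/esym; rewrite -subTset => x _.
  have [i _ Fi] : (\bigcup_k F k) (uncons x).1 by rewrite -FT.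
  have [j _ Gj] : (\bigcup_k G k) (uncons x).2 by rewrite -GT.
  exists (maxn i j) => //; split.
    by move: Fi; exact/subsetPset/ndF/leq_maxl.
  by move: Gj; exact/subsetPset/ndG/leq_maxr.
move=> k; have [mF Foo] := Ffin k; have [mG Goo] := Gfin k; split.
  by rewrite -[X in measurable X]setTI; apply: muncons => //; exact: measurableX.
rewrite /lebesgue_rV_step /pushforward -comp_preimage.
rewrite (_ : uncons \o _ = id) ?preimage_id; last exact/funext.
by rewrite product_measure1E// lte_mul_pinfty// ge0_fin_numE.
Qed.

HB.instance Definition _ := Measure_isSigmaFinite.Build _ _ _
  lebesgue_rV_step step_sigma_finite.

End lebesgue_rV_step.

(* Lebesgue measure on R^n as an n-fold product measure. *)
Fixpoint lebesgue_rV (R : realType) (n : nat) :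
    {sigma_finite_measure set 'rV[R]_n -> \bar R} :=
  match n with
  | 0 => @dirac _ 'rV[R]_0 0 R
  | n'.+1 => lebesgue_rV_step (lebesgue_rV R n')
  end.

Lemma measurable_box (R : realType) n (B : 'I_n -> set R) :
  (forall i, measurable (B i)) ->
  measurable [set x : 'rV[R]_n | forall i, B i (x ord0 i)].
Proof.
move=> mB; rewrite [X in measurable X](_ : _ = \big[setI/setT]_(i < n)
    ((fun x : 'rV[R]_n => x ord0 i) @^-1` B i)).
  apply: bigsetI_measurable => i _.
  by rewrite -[X in measurable X]setTI; exact: measurable_coord.
rewrite -bigcap_seq; apply/seteqP; split => x /= h i; first by move=> _; exact: h.
by apply: h; rewrite /= mem_index_enum.
Qed.

Lemma lebesgue_rV_box (R : realType) n (B : 'I_n -> set R) :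
  (forall i, measurable (B i)) ->
  lebesgue_rV R n [set x | forall i, B i (x ord0 i)] =
  (\prod_(i < n) lebesgue_measure (B i))%E.
Proof.
elim: n B => [|n IH] B mB /=.
  rewrite big_ord0 diracE mem_set//=.
  by case.
rewrite big_ord_recl -IH// /lebesgue_rV_step /pushforward.
pose C : set 'rV[R]_n := [set x | forall i, B (lift ord0 i) (x ord0 i)].
have mC : measurable C by exact: (@measurable_box R n (fun i => B (lift ord0 i))).
rewrite -[X in (_ * X)%E]/(lebesgue_rV R n C) -product_measure1E//.
congr (_ _); apply/seteqP; split => -[a y] /=.
  move=> h; split; first by have := h ord0; rewrite rV_cons0.
  by move=> i; have := h (lift ord0 i); rewrite rV_consS.
move=> [Ba By] i; case: (unliftP ord0 i) => [j|] ->.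
  by rewrite rV_consS.
by rewrite rV_cons0.
exact: mB.
Qed.

Definition dotp (R : realType) n (x y : 'rV[R]_n) : R :=
  \sum_(i < n) x ord0 i * y ord0 i.

(* The Euclidean norm; the norm `|x| of the library on 'rV[R]_n is the sup
   norm. *)
Definition enorm (R : realType) n (x : 'rV[R]_n) : R := Num.sqrt (dotp x x).

Lemma enorm_ge0 (R : realType) n (x : 'rV[R]_n) : 0 <= enorm x.
Proof. exact: sqrtr_ge0. Qed.

Lemma measurable_enorm (R : realType) n :
  measurable_fun setT (@enorm R n).
Proof.
apply: (measurableT_comp (f := @Num.sqrt R)).
  by apply: continuous_measurable_fun; exact: sqrt_continuous.
by apply: measurable_sum => i; apply: measurable_funM; exact: measurable_coord.
Qed.

Section frac_measure.
Local Open Scope ereal_scope.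
Context (R : realType) (n : nat).
Local Notation leb := (lebesgue_rV R n).

Let density (p : 'rV[R]_n * 'rV[R]_n) : \bar R := ((enorm p.2 ^+ n)^-1)%:E.

Let density_ge0 p : 0 <= density p.
Proof. by rewrite lee_fin invr_ge0 exprn_ge0// enorm_ge0. Qed.

Let measurable_density : measurable_fun setT density.
Proof.
apply/measurable_EFinP.
apply: (eq_measurable_fun (fun p => (enorm p.2 ^+ n) `^ (-1))%R).
  by move=> p _; rewrite powR_inv1// exprn_ge0// enorm_ge0.
apply: (measurableT_comp (measurable_powR _)); apply: measurable_funX.
exact: (measurableT_comp (@measurable_enorm R n) measurable_snd).
Qed.

(* d mu = dx dt / |t|^n on pairs (x, t); the value of the density at t = 0 is
   irrelevant, this set being negligible. *)
Definition frac_measure (E : set ('rV[R]_n * 'rV[R]_n)) : \bar R :=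
  \int[leb \x leb]_(p in E) ((enorm p.2 ^+ n)^-1)%:E.

Let mu0 : frac_measure set0 = 0.
Proof. by rewrite /frac_measure integral_set0. Qed.

Let mu_ge0 E : 0 <= frac_measure E.
Proof. by apply: integral_ge0 => p _; exact: density_ge0. Qed.

Let mu_sigma_additive : semi_sigma_additive frac_measure.
Proof.
move=> F mF tF mUF.
rewrite [X in _ --> X](_ : _ = \sum_(k <oo) frac_measure (F k)).
  by apply: is_cvg_nneseries => k _ _; exact: mu_ge0.
apply: ge0_integral_bigcup => //; first exact: measurable_funTS.
by move=> p _; exact: density_ge0.
Qed.

HB.instance Definition _ := isMeasure.Build _ _ _
  frac_measure mu0 mu_ge0 mu_sigma_additive.

End frac_measure.

(* Only the values on [0, +oo[ matter: the even extension to R is replaced by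
   composition with the absolute value. Increasing is read in the wide sense. *)
Record young_function (R : realType) (A : R -> R) : Prop := YoungFunction {
  young_ge0 : forall t, 0 <= t -> 0 <= A t ;
  young_convex : convex_function (`[0, +oo[%classic : set R) A ;
  young_nondecreasing : {in `[0, +oo[ &, {homo A : x y / x <= y}} ;
  young0 : A 0 = 0 ;
  young_cvg0 : A t / t @[t --> 0^'+] --> 0 ;
  young_cvgy : A t / t @[t --> +oo] --> +oo }.

(* This supremum is finite when A is a Young function. *)
Definition complementary (R : realType) (A : R -> R) (t : R) : R :=
  sup [set t * w - A w | w in [set w | 0 < w]].

Section orlicz.
Local Open Scope ereal_scope.
Context d (X : measurableType d) (R : realType).
Variables (nu : {measure set X -> \bar R}) (A : R -> R).

Definition orlicz (v : X -> R) : Prop :=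
  measurable_fun setT v /\ \int[nu]_x (A `|v x|%R)%:E < +oo.

Definition luxemburg (v : X -> R) : \bar R :=
  ereal_inf [set l%:E | l in
    [set l : R | (0 < l)%R /\ \int[nu]_x (A (`|v x| / l)%R)%:E <= 1]].

End orlicz.

(* The Fourier transform \int e^(-i x.xi) f(x) dx of a real function. *)
Definition fourier (R : realType) n (f : 'rV[R]_n -> R) (xi : 'rV[R]_n) :
    R[i]%C :=
  Complex (\int[lebesgue_rV R n]_x (cos (dotp x xi) * f x))
          (- \int[lebesgue_rV R n]_x (sin (dotp x xi) * f x)).

(* G is (a representative of the a.e.-class of) the Bessel kernel of order
   alpha, the inverse Fourier transform of (1 + |xi|^2)^(-alpha/2): since this
   symbol need not be integrable, F^-1 is the inverse of the injective operator
   F on L^1(R^n). *)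
Definition bessel_kernel (R : realType) n (alpha : R) (G : 'rV[R]_n -> R) :=
  (lebesgue_rV R n).-integrable setT (EFin \o G) /\
  forall xi, fourier G xi =
    Complex ((1 + enorm xi ^+ 2) `^ (- (alpha / 2))) 0.

Definition diff_kernel (R : realType) n (gamma : R) (G : 'rV[R]_n -> R)
    (z x t : 'rV[R]_n) : R :=
  (G (z - x) - G (z - x + t)) / enorm t `^ gamma.

(* Main.v *)
Require Import Defs.
From HB Require Import structures.
From mathcomp Require Import all_boot all_order all_algebra.
From mathcomp Require Import all_classical all_reals all_analysis.
From mathcomp Require Import measurable_realfun ring lra.
Import Order.TTheory GRing.Theory Num.Theory.
Import numFieldNormedType.Exports.
Set Implicit Arguments.
Unset Strict Implicit.
Unset Printing Implicit Defensive.
Local Open Scope classical_set_scope.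
Local Open Scope ring_scope.

(** Scale v and w by admissible constants l and k, so that A(|v|/l) and
    A^(|w|/k), with A^ the complementary function, have integral at most 1.
    Young's inequality |v||w| <= l k (A(|v|/l) + A^(|w|/k)) splits the triple
    integral in two, and Tonelli's theorem bounds the two pieces as soon as the
    kernel K has bounded marginals (lemma kernel_bounds):
    - the integral of |K(z,x,t)| in z is bounded uniformly in (x,t);
    - the integral of |K(z,x,t)| against mu is bounded uniformly in z.
    This is a Schur test (lemma schur_test); taking the infimum over l and k
    gives the norms.

    After a translation both marginals only see the L^1 modulus of continuity
    omega(t) = || G - G(. + t) ||_1: one needs omega(t) <= C |t|^gamma and the
    integrability of omega(t) |t|^(-gamma-n). Since omega is bounded, and since
    omega(t) <= C |t|^b for some b with gamma < b < min(1, alpha), both follow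
    from the integrability of |t|^(-n) e^(-c |ln |t||) for c > 0
    (radial_integral_lty).

    The modulus of continuity of G (bessel_kernel_modulus) comes from the
    subordination formula: up to the factor Gamma(alpha/2) pi^(n/2), the measure
    G dx is the mixture, with weight e^(-s) s^(alpha/2 - 1) ds, of the images of
    exp(-|u|^2) du under u |-> 2 sqrt(s) u. With s = e^y every scaling in s
    becomes a translation in y, and the Gamma function becomes the integral of
    exp(c y - e^y) over the line (gamma_exp). Translating the mixture by t moves
    the Gaussian of parameter s by t / (2 sqrt s), which costs O(|t|^b s^(-b/2))
    in L^1 (gauss_rV_mod_le_powR), and the weights s^(-b/2) can be absorbed
    because b < alpha.

    As G is only known through its Fourier transform, the subordination formula
    is an instance of the uniqueness theorem for Fourier transforms of finite
    measures (fourier_unique). The latter is proved by Gaussian smoothing: the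
    Gaussian is its own Fourier transform, so the mean of the indicator of a
    box, blurred by a Gaussian of width d^2, depends only on the transform of
    the measure, and it tends to the measure of the box as d tends to 0. The
    theorem is applied to the positive part of G dx on one side, the negative
    part plus the mixture on the other (bessel_subord). *)

(** * Boxes and affine changes of variables in R^n *)

(** Half-open boxes form a pi-system, and their indicators are continuous from
    below in each coordinate, which smooth_box_cvg exploits. *)
Definition hbox (R : realType) n (a b : 'rV[R]_n) : set 'rV[R]_n :=
  [set x | forall i, `]a ord0 i, b ord0 i]%classic (x ord0 i)].

Lemma measurable_hbox (R : realType) n (a b : 'rV[R]_n) :
  measurable (hbox a b).
Proof.
by apply: (@measurable_box R n (fun i => `]a ord0 i, b ord0 i]%classic)) => i.
Qed.

Lemma hboxI (R : realType) n (a b a' b' : 'rV[R]_n) :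
  hbox a b `&` hbox a' b' =
  hbox (\row_i Num.max (a ord0 i) (a' ord0 i))
       (\row_i Num.min (b ord0 i) (b' ord0 i)).
Proof.
apply/seteqP; split => x /=.
  move=> [h h'] i; move: (h i) (h' i); rewrite /= !in_itv /= !mxE gt_max le_min.
  by move=> /andP[ax xb] /andP[a'x xb']; rewrite ax xb a'x.
by move=> h; split=> i; move: (h i); rewrite /= !in_itv /= !mxE gt_max le_min;
  move=> /andP[/andP[ax a'x] /andP[xb xb']]; apply/andP.
Qed.

Lemma bigcup_hbox (R : realType) n :
  \bigcup_k hbox (const_mx (- k%:R)) (const_mx k%:R) = [set: 'rV[R]_n].
Proof.
rewrite -subTset => x _.
pose M := \sum_(i < n) `|x ord0 i|.
have xM i : `|x ord0 i| <= M.
  by rewrite /M (bigD1 i)//= lerDl sumr_ge0.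
exists (Num.truncn M).+1 => // i; rewrite /= in_itv/= !mxE.
have := le_lt_trans (xM i) (truncnS_gt M).
by rewrite ltr_norml => /andP[-> /ltW].
Qed.

(** The preimage of ]a, b] under one coordinate is the increasing union of the
    boxes whose other sides are ]-k, k]. *)
Lemma measurable_hboxE (R : realType) n :
  @measurable _ 'rV[R]_n =
  <<s [set hbox a b | a in [set: 'rV[R]_n] & b in [set: 'rV[R]_n]] >>.
Proof.
apply/seteqP; split; last first.
  apply: smallest_sub; first exact: sigma_algebra_measurable.
  by move=> _ [a _] [b _] <-; exact: measurable_hbox.
apply: smallest_sub; first exact: smallest_sigma_algebra.
move=> C; rewrite -bigcup_seq => -[i _ [D mD <-]] /=.
rewrite setTI.
suff: <<s @ocitv R >> `<=` [set D : set R |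
    <<s [set hbox a b | a in [set: 'rV[R]_n] & b in [set: 'rV[R]_n]] >>
      ((fun x : 'rV[R]_n => x ord0 i) @^-1` D)] by apply.
have sS := @smallest_sigma_algebra _ setT
  [set hbox a b | a in [set: 'rV[R]_n] & b in [set: 'rV[R]_n]].
apply: smallest_sub.
  split => /=.
  - by rewrite preimage_set0; exact: sigma_algebra0.
  - by move=> E mE; rewrite setTD -preimage_setC; exact: sigma_algebraC.
  - by move=> F mF; rewrite preimage_bigcup; exact: sigma_algebra_bigcup.
move=> _ [[a b] _ <-] /=.
pose F k := hbox (\row_j if j == i then a else - k%:R : R)
                 (\row_j if j == i then b else k%:R : R).
rewrite (_ : _ @^-1` _ = \bigcup_k F k).
  apply: sigma_algebra_bigcup => k; apply: sub_sigma_algebra => /=.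
  by eexists => //; eexists.
apply/seteqP; split => x /=.
  move=> xab; have : (\bigcup_k hbox (const_mx (- k%:R)) (const_mx k%:R)) x.
    by rewrite bigcup_hbox.
  move=> [k _ xk]; exists k => // j; have := xk j; rewrite /= !mxE.
  by case: eqVneq => [->|].
by move=> [k _] /(_ i); rewrite /= !mxE eqxx.
Qed.

Lemma hbox_measure_unique (R : realType) n
    (m1 m2 : {measure set 'rV[R]_n -> \bar R}) :
  (forall a b, m1 (hbox a b) = m2 (hbox a b)) ->
  (forall a b, (m1 (hbox a b) < +oo)%E) ->
  forall A, measurable A -> m1 A = m2 A.
Proof.
move=> m12 m1oo A mA.
apply: (@measure_unique _ _ _
  [set hbox a b | a in [set: 'rV[R]_n] & b in [set: 'rV[R]_n]]
  (fun k => hbox (const_mx (- k%:R)) (const_mx k%:R))) => //.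
- exact: measurable_hboxE.
- move=> _ _ [a _] [b _] <- [a' _] [b' _] <-; rewrite hboxI.
  by eexists => //; eexists.
- by move=> k; eexists => //; eexists.
- exact: bigcup_hbox.
- by move=> _ [a _] [b _] <-.
Qed.

Lemma lebesgue_rV_hbox (R : realType) n (a b : 'rV[R]_n) :
  lebesgue_rV R n (hbox a b) =
  (\prod_(i < n) (Num.max 0 (b ord0 i - a ord0 i)))%:E.
Proof.
rewrite (lebesgue_rV_box (B := fun i => `]a ord0 i, b ord0 i]%classic))//.
rewrite -prodEFin; apply: eq_bigr => i _.
rewrite lebesgue_measure_itv/= lte_fin -EFinB.
case: ltP => ab; congr EFin.
  by rewrite max_r// subr_ge0 ltW.
by rewrite max_l// subr_le0.
Qed.

Lemma lebesgue_rV_hbox_lty (R : realType) n (a b : 'rV[R]_n) :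
  (lebesgue_rV R n (hbox a b) < +oo)%E.
Proof. by rewrite lebesgue_rV_hbox ltry. Qed.

Section affine.
Context (R : realType) (n : nat).
Implicit Types (b x : 'rV[R]_n).
Local Notation leb := (lebesgue_rV R n).

Lemma measurable_affine b (e : R) :
  measurable_fun setT (fun u : 'rV[R]_n => b + e *: u).
Proof.
apply: measurable_fun_coordP => i; under eq_fun do rewrite !mxE.
by apply: measurable_funD => //; apply: measurable_funM => //;
  exact: measurable_coord.
Qed.

(** Both sides are measures in A, so it is enough to compare them on boxes,
    where the preimage is again a box. *)
Lemma lebesgue_rV_scale b (e : R) (A : set 'rV[R]_n) : 0 < e ->
  measurable A ->
  leb A = ((e ^+ n)%:E * leb ((fun u => (b + e *: u)%R) @^-1` A))%E.
Proof.
move=> e0 mA.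
have en0 : 0 <= e ^+ n by rewrite exprn_ge0// ltW.
pose pf := pushforward leb (fun u : 'rV[R]_n => b + e *: u).
have -> : ((e ^+ n)%:E * leb ((fun u => (b + e *: u)%R) @^-1` A))%E =
  mscale (NngNum en0) (pushforward leb (mfun_Sub (mem_set (measurable_affine b e)))) A by [].
apply: hbox_measure_unique => //; last first.
  exact: lebesgue_rV_hbox_lty.
move=> c d; apply: (etrans (lebesgue_rV_hbox c d)).
transitivity ((e ^+ n)%:E * leb ((fun u => b + e *: u)%R @^-1` hbox c d))%E => //.
rewrite [X in lebesgue_rV R n X](_ : _ =
    hbox (e^-1 *: (c - b)) (e^-1 *: (d - b))); last first.
  apply/seteqP; split => x /= h i; move: (h i);
    rewrite /= !in_itv/= !mxE ltr_pdivrMl// ler_pdivlMl//;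
    by rewrite ltrBlDl lerBrDl.
rewrite lebesgue_rV_hbox -EFinM; congr EFin.
rewrite (_ : e ^+ n = \prod_(i < n) e); last by rewrite prodr_const card_ord.
rewrite -big_split/=; apply: eq_bigr => i _.
by rewrite !mxE maxr_pMr ?ltW// mulr0; congr Num.max; field; rewrite gt_eqF.
Qed.

Lemma lebesgue_rVN (A : set 'rV[R]_n) : measurable A ->
  leb A = leb ((fun u : 'rV[R]_n => - u) @^-1` A).
Proof.
move=> mA.
have mN : measurable_fun setT (fun u : 'rV[R]_n => - u).
  by have := measurable_affine 0 (-1);
    under eq_fun do rewrite add0r scaleN1r.
have -> : leb ((fun u : 'rV[R]_n => - u) @^-1` A) =
  pushforward leb (mfun_Sub (mem_set mN)) A by [].
apply: hbox_measure_unique => //; last first.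
  exact: lebesgue_rV_hbox_lty.
move=> c d; apply: (etrans (lebesgue_rV_hbox c d)).
transitivity (leb ((fun u : 'rV[R]_n => - u) @^-1` hbox c d)) => //.
have -> : ((fun u : 'rV[R]_n => - u) @^-1` hbox c d) =
  [set x | forall i, `[(- d ord0 i), (- c ord0 i)[%classic (x ord0 i)].
  apply/seteqP; split => x /= h i; move: (h i); rewrite /= !in_itv/= !mxE;
  by rewrite ltrNr lerNl andbC.
rewrite (lebesgue_rV_box (B := fun i => `[(- d ord0 i), (- c ord0 i)[%classic))//.
rewrite -prodEFin; apply: eq_bigr => i _.
rewrite lebesgue_measure_itv/= lte_fin -EFinB ltrN2 opprK.
case: ltP => ab; congr EFin.
  by rewrite [RHS]addrC max_r ?subr_ge0 ?ltW.
by rewrite max_l// subr_le0.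
Qed.

Local Open Scope ereal_scope.

Lemma integral_rV_scale b (e : R) (f : 'rV[R]_n -> \bar R) : (0 < e)%R ->
  measurable_fun setT f -> (forall x, 0 <= f x) ->
  \int[leb]_x f x = (e ^+ n)%:E * \int[leb]_u f (b + e *: u)%R.
Proof.
move=> e0 mf f0.
have en0 : (0 <= e ^+ n)%R by rewrite exprn_ge0// ltW.
pose phi := mfun_Sub (mem_set (measurable_affine b e)).
rewrite (eq_measure_integral (mscale (NngNum en0) (pushforward leb phi))) /=; last first.
  by move=> A mA _; exact: lebesgue_rV_scale.
rewrite ge0_integral_mscale//; congr (_ * _).
by rewrite (ge0_integral_pushforward (measurable_affine b e)).
Qed.

Lemma integral_rV_shift b (f : 'rV[R]_n -> \bar R) :
  measurable_fun setT f -> (forall x, 0 <= f x) ->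
  \int[leb]_x f x = \int[leb]_u f (u + b)%R.
Proof.
move=> mf f0; rewrite (integral_rV_scale b ltr01 mf f0) expr1n mul1e.
by apply: eq_integral => x _; rewrite scale1r addrC.
Qed.

Lemma integral_rVN (f : 'rV[R]_n -> \bar R) :
  measurable_fun setT f -> (forall x, 0 <= f x) ->
  \int[leb]_x f x = \int[leb]_u f (- u)%R.
Proof.
move=> mf f0.
have mN : measurable_fun setT (fun u : 'rV[R]_n => - u)%R.
  by have := measurable_affine 0%R (-1)%R;
    under eq_fun do rewrite add0r scaleN1r.
rewrite (eq_measure_integral (pushforward leb (mfun_Sub (mem_set mN)))) /=; last first.
  by move=> A mA _; exact: lebesgue_rVN.
by rewrite (ge0_integral_pushforward mN).
Qed.

End affine.

(** * Integrals over the line *)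

(** Domination by a real-valued function, without the absolute value on the
    dominating side. *)
Lemma integrable_le (d : measure_display) (T : measurableType d) (R : realType)
    (mu : {measure set T -> \bar R}) (f g : T -> R) :
  measurable_fun setT f -> (forall x, `|f x| <= g x) ->
  mu.-integrable setT (EFin \o g) -> mu.-integrable setT (EFin \o f).
Proof.
move=> mf fg; apply: le_integrable => //; first exact/measurable_EFinP.
by move=> x _; rewrite /= lee_fin (le_trans (fg x))// ler_norm.
Qed.

Lemma integrable_scale (d : measure_display) (T : measurableType d)
    (R : realType) (mu : {measure set T -> \bar R}) (k : R) (f : T -> R) :
  mu.-integrable setT (EFin \o f) ->
  mu.-integrable setT (EFin \o (fun x => k * f x)).
Proof. by move=> /(@integrableZl _ _ _ _ _ measurableT k). Qed.

Lemma lebesgue_measure_shift (R : realType) (b : R) (A : set R) :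
  measurable A ->
  lebesgue_measure A = lebesgue_measure ((fun y => y + b) @^-1` A).
Proof.
move=> mA.
have mS : measurable_fun setT
    ((fun y : R => y + b) : measurableTypeR R -> measurableTypeR R).
  exact: measurable_funD.
pose phi := (fun y : R => y + b) : measurableTypeR R -> measurableTypeR R.
have -> : lebesgue_measure ((fun y => y + b) @^-1` A) =
  pushforward lebesgue_measure phi A by [].
apply: lebesgue_measure_unique => //= _ [[u v] _ <-] /=.
rewrite /pushforward /phi.
have -> : ((fun y => y + b) @^-1` `]u, v]) = `]u - b, v - b]%classic.
  by apply/seteqP; split => y /=; rewrite !in_itv/= ltrBlDr lerBrDr.
rewrite !lebesgue_measure_itv/= !lte_fin ltrD2r; case: ifP => // _.
by rewrite -!EFinD; congr EFin; ring.
Qed.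

Lemma ge0_integral_shift (R : realType) (b : R) (f : R -> \bar R) :
  measurable_fun setT f -> (forall x, 0 <= f x)%E ->
  (\int[lebesgue_measure]_x f x = \int[lebesgue_measure]_y f (y + b)%R)%E.
Proof.
move=> mf f0.
have mS : measurable_fun setT
    ((fun y : R => y + b) : measurableTypeR R -> measurableTypeR R).
  exact: measurable_funD.
pose phi := (fun y : R => y + b) : measurableTypeR R -> measurableTypeR R.
rewrite -[RHS](@ge0_integral_pushforward _ _ _ _ _ _ mS lebesgue_measure setT f)//.
rewrite (eq_measure_integral (pushforward lebesgue_measure phi)) //=.
by move=> A mA _; exact: lebesgue_measure_shift.
Qed.

(** On each half-line the integrand is, up to a factor, an exponential density. *)
Lemma integral_expRN_abs_lty (R : realType) (c : R) : 0 < c ->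
  (\int[lebesgue_measure]_y (expR (- (c * `|y|)))%:E < +oo)%E.
Proof.
move=> c0.
have ce : continuous (fun y : R => expR (- (c * `|y|))).
  move=> y; apply: continuous_comp; last exact: continuous_expR.
  apply: cvgN; apply: cvgM; first exact: cvg_cst.
  by apply: cvg_norm.
rewrite ge0_symfun_integralT//; last by move=> y; rewrite /= normrN.
apply: lte_mul_pinfty => //.
have pos y : 0 <= c^-1 * exponential_pdf c y.
  by rewrite mulr_ge0 ?invr_ge0 ?exponential_pdf_ge0 // ltW.
have mpdf := measurable_exponential_pdf c.
apply: (@le_lt_trans _ _
   (\int[lebesgue_measure]_y (c^-1 * exponential_pdf c y)%:E)%E).
  have mD : measurable [set x : R | 0 <= x] by rewrite -set_itvcy.
  rewrite integral_mkcond; apply: ge0_le_integral => //.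
  - by move=> y _; rewrite patchE; case: ifP.
  - apply/measurable_restrict => //.
    by apply/measurable_funTS; apply/measurable_EFinP; exact: continuous_measurable_fun.
  - by apply/measurable_EFinP/measurable_funM.
  - move=> y _; rewrite patchE; case: ifPn => [|_]; last by rewrite lee_fin.
    rewrite inE /= => y0; rewrite lee_fin exponential_pdfE//.
    by rewrite ger0_norm// mulKf ?gt_eqF// mulNr.
under eq_integral do rewrite EFinM.
rewrite ge0_integralZl//; last 3 first.
- by apply/measurable_EFinP; exact: mpdf.
- by move=> y _; rewrite lee_fin exponential_pdf_ge0// ltW.
- by rewrite lee_fin invr_ge0 ltW.
- by rewrite integral_exponential_pdf// mule1 ltry.
Qed.

Lemma integrable_expRN_abs (R : realType) (c : R) : 0 < c ->
  lebesgue_measure.-integrable setT (EFin \o (fun y : R => expR (- (c * `|y|)))).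
Proof.
move=> c0; apply/integrableP; split; last first.
  under eq_integral do rewrite /= ger0_norm ?expR_ge0//.
  exact: integral_expRN_abs_lty.
apply/measurable_EFinP; apply: continuous_measurable_fun => y.
apply: continuous_comp; last exact: continuous_expR.
by apply: cvgN; apply: cvgM; [exact: cvg_cst|exact: cvg_norm].
Qed.

(** The fundamental theorem of calculus on [-k, k], and dominated convergence
    as k grows. *)
Lemma integral_derive_eq0 (R : realType) (F f : R -> R) :
  continuous f -> (forall x, is_derive x (1 : R) F (f x)) ->
  lebesgue_measure.-integrable setT (EFin \o f) ->
  F x @[x --> +oo] --> 0 -> F (- x) @[x --> +oo] --> 0 ->
  (\int[lebesgue_measure]_x (f x)%:E = 0)%E.
Proof.
move=> cf dF intf Fy FNy.
pose f_ (k : nat) := (EFin \o f) \_ `[- k%:R, k%:R].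
have mf : measurable_fun setT f by exact: continuous_measurable_fun.
have [] := @dominated_convergence _ _ R lebesgue_measure setT measurableT f_
   (EFin \o f) (abse \o (EFin \o f)).
- move=> k; apply/measurable_restrict => //.
  by apply/measurable_funTS/measurable_EFinP.
- exact/measurable_EFinP.
- apply: aeW => x _; apply: cvg_near_cst.
  exists (Num.truncn `|x|).+1 => // k /= xk.
  rewrite /f_ patchE mem_set//= in_itv/= -ler_norml.
  by rewrite (le_trans (ltW (truncnS_gt _)))// ler_nat.
- exact: integrable_abse.
- apply: aeW => x k _; rewrite /f_ patchE; case: ifP => _; first by [].
  by rewrite [point](_ : _ = 0%E)// abse0 abse_ge0.
move=> _ _ h; apply/esym/(cvg_unique _ _ h) => //.
have E k : (0 < k)%N -> (\int[lebesgue_measure]_x f_ k x =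
    (F k%:R)%:E - (F (- k%:R))%:E)%E.
  move=> k0; rewrite /f_ -integral_mkcond/=.
  have cF x : {for x, continuous F}.
    by apply: differentiable_continuous; apply/derivable1_diffP; have [] := dF x.
  rewrite (@continuous_FTC2 _ _ F)//.
  - by rewrite (@lt_trans _ _ 0)// ?oppr_lt0 ltr0n.
  - exact: continuous_subspaceT.
  - split => [x _||].
    + by have [] := dF x.
    + by apply: cvg_at_right_filter; exact: cF.
    + by apply: cvg_at_left_filter; exact: cF.
  - by move=> x _; rewrite derive1E; have [] := dF x.
apply: (@cvg_trans _ ((fun k : nat => ((F k%:R - F (- k%:R))%:E)) @ \oo)).
  apply: near_eq_cvg; exists 1%N => // k /= k0; by rewrite E// EFinB.
rewrite (_ : 0%E = (0 - 0 : R)%:E); last by rewrite subr0.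
apply: cvg_EFin; first exact: nearW.
apply: cvgB.
  exact: (cvg_comp _ _ cvgr_idn Fy).
exact: (cvg_comp _ _ cvgr_idn FNy).
Qed.

(** * The Fourier transform of the Gaussian on the line *)

Section gauss_cos.
Context (R : realType).
Implicit Types (x y t : R).

Lemma is_derive_gauss_fun x :
  is_derive x (1 : R) (@gauss_fun R) (- (2 * x) * gauss_fun x).
Proof.
rewrite (_ : gauss_fun = expR \o (- (id ^+ 2)))//.
apply: is_derive_eq.
by rewrite /gauss_fun /= !fctE expr1 /GRing.scale /= mulr1 mulrC.
Qed.

Lemma is_derive_sin_affine t y x :
  is_derive x (1 : R) (fun z => sin (t + 2 * y * z)) (2 * y * cos (t + 2 * y * x)).
Proof.
rewrite (_ : (fun z => _) = sin \o (cst t + (2 * y) \*: id))//.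
apply: is_derive_eq.
by rewrite /= add0r /GRing.scale /= mulr1 mulrC.
Qed.

Lemma is_derive_cos_affine t y x :
  is_derive x (1 : R) (fun z => cos (t + 2 * y * z)) (- (2 * y * sin (t + 2 * y * x))).
Proof.
rewrite (_ : (fun z => _) = cos \o (cst t + (2 * y) \*: id))//.
apply: is_derive_eq.
by rewrite /= add0r /GRing.scale /= mulr1 mulrC mulrN.
Qed.

(** From |x| <= e^|x| and 2|x| <= 1 + x^2. *)
Lemma normr_gauss_le x : `|x| * gauss_fun x <= expR 1 * expR (- (1 * `|x|)).
Proof.
rewrite /gauss_fun mul1r -expRD.
apply: (@le_trans _ _ (expR `|x| * expR (- x ^+ 2))).
  apply: ler_wpM2r; first exact: expR_ge0.
  by rewrite (le_trans _ (expR_ge1Dx _))// lerDr.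
rewrite -expRD ler_expR -[x ^+ 2]real_normK ?num_real//.
by rewrite -subr_ge0 (_ : _ - _ = (1 - `|x|) ^+ 2) ?sqr_ge0//; ring.
Qed.

Lemma integrable_normr_gauss :
  lebesgue_measure.-integrable setT (EFin \o (fun x => `|x| * gauss_fun x)).
Proof.
apply: (@integrable_le _ (measurableTypeR R) R _ _ (fun x => expR 1 * expR (- (1 * `|x|)))).
- by apply: measurable_funM; [exact: normr_measurable|exact: measurable_gauss_fun].
- by move=> x; rewrite normrM normr_id [`|gauss_fun x|]ger0_norm ?gauss_fun_ge0// normr_gauss_le.
- apply: integrable_scale; exact: integrable_expRN_abs.
Qed.

Lemma squeeze_gauss (u : R -> R) : (forall x, `|u x| <= gauss_fun x) ->
  u x @[x --> +oo] --> 0 /\ u (- x) @[x --> +oo] --> 0.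
Proof.
move=> ug; split; apply/norm_cvg0P; apply: (@squeeze_cvgr _ _ _ _ (cst 0) gauss_fun).
- by apply: nearW => x /=; rewrite normr_ge0 ug.
- exact: cvg_cst.
- exact: cvg_gauss_fun.
- by apply: nearW => x /=; rewrite normr_ge0 (le_trans (ug _))// /gauss_fun sqrrN.
- exact: cvg_cst.
- exact: cvg_gauss_fun.
Qed.

Lemma measurable_cos_affine t y :
  measurable_fun setT (fun x : R => cos (t + 2 * y * x)).
Proof.
apply: continuous_measurable_fun => x; apply: differentiable_continuous.
by apply/derivable1_diffP; have [] := is_derive_cos_affine t y x.
Qed.

Lemma measurable_sin_affine t y :
  measurable_fun setT (fun x : R => sin (t + 2 * y * x)).
Proof.
apply: continuous_measurable_fun => x; apply: differentiable_continuous.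
by apply/derivable1_diffP; have [] := is_derive_sin_affine t y x.
Qed.

Lemma normr_cos_le1 x : `|cos x| <= 1.
Proof. by rewrite ler_norml cos_geN1 cos_le1. Qed.

Lemma normr_sin_le1 x : `|sin x| <= 1.
Proof. by rewrite ler_norml sin_geN1 sin_le1. Qed.

Lemma integrable_cos_gauss t y : lebesgue_measure.-integrable setT
  (EFin \o (fun x => cos (t + 2 * y * x) * gauss_fun x)).
Proof.
apply: (@integrable_le _ (measurableTypeR R) R _ _ (@gauss_fun R)).
- by apply: measurable_funM; [exact: measurable_cos_affine|exact: measurable_gauss_fun].
- move=> x; rewrite normrM [`|gauss_fun x|]ger0_norm ?gauss_fun_ge0//.
  by rewrite ler_piMl ?gauss_fun_ge0// normr_cos_le1.
- exact: integrableT_gauss.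
Qed.

Lemma integrable_sin_gauss t y : lebesgue_measure.-integrable setT
  (EFin \o (fun x => - (2 * x * sin (t + 2 * y * x)) * gauss_fun x)).
Proof.
apply: (@integrable_le _ (measurableTypeR R) R _ _ (fun x => 2 * (`|x| * gauss_fun x))).
- apply: measurable_funM; last exact: measurable_gauss_fun.
  apply: measurableT_comp => //; apply: measurable_funM; last exact: measurable_sin_affine.
  exact: measurable_funM.
- move=> x; rewrite normrM [`|gauss_fun x|]ger0_norm ?gauss_fun_ge0// mulrA.
  rewrite ler_wpM2r ?gauss_fun_ge0// normrN !normrM ger0_norm//.
  by rewrite ler_piMr ?mulr_ge0// normr_sin_le1.
- apply: integrable_scale; exact: integrable_normr_gauss.
Qed.

(** Integration by parts: sin(t + 2 y x) exp(-x^2) vanishes at both infinities,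
    so its derivative in x has integral 0. *)
Lemma integral_sin_gauss t y :
  \int[lebesgue_measure]_x (- (2 * x * sin (t + 2 * y * x)) * gauss_fun x) =
  - (2 * y) * \int[lebesgue_measure]_x (cos (t + 2 * y * x) * gauss_fun x).
Proof.
pose f1 x : R := - (2 * x * sin (t + 2 * y * x)) * gauss_fun x.
pose f2 x : R := (2 * y) * (cos (t + 2 * y * x) * gauss_fun x).
have i1 : lebesgue_measure.-integrable setT (EFin \o f1).
  exact: integrable_sin_gauss.
have i2 : lebesgue_measure.-integrable setT (EFin \o f2).
  apply: integrable_scale; exact: integrable_cos_gauss.
have cg x : {for x, continuous (@gauss_fun R)} by exact: continuous_gauss_fun.
have cc x : {for x, continuous (fun x => cos (t + 2 * y * x))}.
  apply: differentiable_continuous.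
  by apply/derivable1_diffP; have [] := is_derive_cos_affine t y x.
have cs x : {for x, continuous (fun x => sin (t + 2 * y * x))}.
  apply: differentiable_continuous.
  by apply/derivable1_diffP; have [] := is_derive_sin_affine t y x.
have : (\int[lebesgue_measure]_x ((f1 \+ f2) x)%:E = 0)%E.
  have [sy sNy] : (fun x => sin (t + 2 * y * x) * gauss_fun x) x @[x --> +oo] --> 0 /\
      (fun x => sin (t + 2 * y * x) * gauss_fun x) (- x) @[x --> +oo] --> 0.
    apply: squeeze_gauss => x; rewrite normrM [`|gauss_fun x|]ger0_norm ?gauss_fun_ge0//.
    by rewrite ler_piMl ?gauss_fun_ge0// normr_sin_le1.
  apply: (integral_derive_eq0 _ _ _ sy sNy).
  - move=> x; apply: cvgD; apply: cvgM; [|exact: cg|exact: cvg_cst|].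
      by apply: cvgN; apply: cvgM; [apply: cvgM; [exact: cvg_cst|exact: cvg_id]|exact: cs].
    by apply: cvgM; [exact: cc|exact: cg].
  - move=> x.
    have ds := is_derive_sin_affine t y x; have dg := is_derive_gauss_fun x.
    by apply: (is_derive_eq (is_deriveM ds dg)); rewrite /f1 /f2 /GRing.scale /=; ring.
  - rewrite (_ : _ \o _ = (EFin \o f1) \+ (EFin \o f2))%E//.
    exact: integrableD.
move=> /(congr1 fine) /=; rewrite -/(Rintegral _ _ _).
have -> := @RintegralD _ (measurableTypeR R) R lebesgue_measure setT f1 f2 measurableT i1 i2.
rewrite /f2 RintegralZl//; last exact: integrable_cos_gauss.
by move=> /eqP; rewrite addr_eq0 => /eqP; rewrite mulNr => <-.
Qed.

(** As a function of y the left-hand side Phi satisfies Phi' = - 2 y Phi, by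
    differentiation under the integral sign and integral_sin_gauss; hence
    Phi(y) exp(y^2) is constant. The phase t gives the cosine and the sine
    transforms at once, and it makes the induction on the dimension in
    integral_cos_gauss_rV immediate. *)
Lemma Rintegral_cos_gauss t y :
  \int[lebesgue_measure]_x (cos (t + 2 * y * x) * gauss_fun x) =
  cos t * Num.sqrt pi * gauss_fun y.
Proof.
pose f y x : R := cos (t + 2 * y * x) * gauss_fun x.
pose Phi y := \int[lebesgue_measure]_x f y x.
have df z x : is_derive z (1 : R) (f ^~ x) (- (2 * x * sin (t + 2 * z * x)) * gauss_fun x).
  have -> : f ^~ x = (fun z => cos (t + 2 * x * z)) * cst (gauss_fun x).
    by apply/funext => u; rewrite /f !fctE; congr (cos (_ + _) * _); ring.
  apply: (is_derive_eq (is_deriveM (is_derive_cos_affine t x z)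
    (is_derive_cst (gauss_fun x) z 1))); rewrite scaler0 add0r /GRing.scale /= mulrC.
  by congr (- (_ * sin (t + _)) * _); ring.
have d1f z x : partial1of2 f z x = - (2 * x * sin (t + 2 * z * x)) * gauss_fun x.
  by rewrite partial1of2E; have [] := df z x.
have dPhi z : is_derive z (1 : R) Phi (- (2 * z) * Phi z).
  pose G x : R := 2 * (`|x| * gauss_fun x).
  have G0 x : 0 <= G x by rewrite /G mulr_ge0// mulr_ge0// gauss_fun_ge0.
  have iG : lebesgue_measure.-integrable setT (EFin \o G).
    apply: integrable_scale; exact: integrable_normr_gauss.
  have zI : z \in `]z - 1, z + 1[ by rewrite in_itv/= ltrDl gtrBl ltr01.
  have fi x : [set` `]z - 1, z + 1[ ] x -> lebesgue_measure.-integrable setT (EFin \o f x).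
    by move=> _; exact: integrable_cos_gauss.
  have fd x w : [set` `]z - 1, z + 1[ ] x -> setT w -> derivable (f ^~ w) x 1.
    by move=> _ _; have [] := df x w.
  have fG x w : [set` `]z - 1, z + 1[ ] x -> setT w -> `|partial1of2 f x w| <= G w.
    move=> _ _; rewrite d1f normrM [`|gauss_fun _|]ger0_norm ?gauss_fun_ge0// /G mulrA.
    rewrite ler_wpM2r ?gauss_fun_ge0// normrN !normrM ger0_norm//.
    by rewrite ler_piMr ?mulr_ge0// normr_sin_le1.
  have D := @derivable_under_integral R _ (measurableTypeR R) lebesgue_measure f setT
    measurableT z (z - 1) (z + 1) zI fi fd G G0 iG fG.
  have E := @differentiation_under_integral R _ (measurableTypeR R) lebesgue_measure f setT
    measurableT z (z - 1) (z + 1) zI fi fd G G0 iG fG.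
  apply: DeriveDef; first exact: D.
  rewrite -derive1E E /Phi -integral_sin_gauss.
  by apply: eq_Rintegral => x _; rewrite d1f.
pose H := Phi * (fun z => expR (z ^+ 2)).
have dH z : is_derive z (1 : R) H 0.
  have de : is_derive z (1 : R) (fun z => expR (z ^+ 2)) (expR (z ^+ 2) * (2 * z)).
    rewrite (_ : (fun z => _) = expR \o (id ^+ 2))//.
    apply: is_derive_eq.
    by rewrite /= expr1 /GRing.scale /= mulr1.
  by apply: (is_derive_eq (is_deriveM (dPhi z) de)); rewrite /GRing.scale /=; ring.
have H0 : Phi y * expR (y ^+ 2) = Phi 0.
  by rewrite -[LHS]/(H y) (is_derive_0_is_cst y 0 dH) /H !fctE expr0n /= expR0 mulr1.
transitivity (Phi 0 * gauss_fun y).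
  by rewrite -H0 -mulrA -expRD subrr expR0 mulr1.
congr (_ * _).
rewrite /Phi /f; under eq_Rintegral do rewrite mulr0 mul0r addr0.
rewrite RintegralZl//; last exact: integrableT_gauss.
by rewrite /Rintegral integralT_gauss.
Qed.

Lemma integral_cos_gauss t y :
  (\int[lebesgue_measure]_x (cos (t + 2 * y * x) * gauss_fun x)%:E =
  (cos t * Num.sqrt pi * gauss_fun y)%R%:E)%E.
Proof.
rewrite -Rintegral_cos_gauss /Rintegral fineK//.
by apply: integrable_fin_num => //; exact: integrable_cos_gauss.
Qed.

End gauss_cos.

(** * The Gaussian on R^n *)

Section dotp.
Context (R : realType) (n : nat).
Implicit Types (x y z : 'rV[R]_n) (k : R).

Lemma dotpC x y : dotp x y = dotp y x.
Proof. by apply: eq_bigr => i _; rewrite mulrC. Qed.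

Lemma dotpDr x y z : dotp x (y + z) = dotp x y + dotp x z.
Proof. by rewrite /dotp -big_split/=; apply: eq_bigr => i _; rewrite mxE mulrDr. Qed.

Lemma dotpDl x y z : dotp (x + y) z = dotp x z + dotp y z.
Proof. by rewrite dotpC dotpDr !(dotpC z). Qed.

Lemma dotpZr k x y : dotp x (k *: y) = k * dotp x y.
Proof. by rewrite /dotp mulr_sumr; apply: eq_bigr => i _; rewrite mxE mulrCA. Qed.

Lemma dotpZl k x y : dotp (k *: x) y = k * dotp x y.
Proof. by rewrite dotpC dotpZr dotpC. Qed.

Lemma dotpNr x y : dotp x (- y) = - dotp x y.
Proof. by rewrite -scaleN1r dotpZr mulN1r. Qed.

Lemma dotpNl x y : dotp (- x) y = - dotp x y.
Proof. by rewrite dotpC dotpNr dotpC. Qed.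

Lemma dotp_ge0 x : 0 <= dotp x x.
Proof. by apply: sumr_ge0 => i _; rewrite -expr2 sqr_ge0. Qed.

Lemma enorm_sqr x : enorm x ^+ 2 = dotp x x.
Proof. by rewrite sqr_sqrtr// dotp_ge0. Qed.

Lemma measurable_dotp x : measurable_fun setT (dotp x).
Proof.
by apply: measurable_sum => i; apply: measurable_funM => //; exact: measurable_coord.
Qed.

Lemma measurable_fun_dotp d (T : measurableType d) (f g : T -> 'rV[R]_n) :
  measurable_fun setT f -> measurable_fun setT g ->
  measurable_fun setT (fun u => dotp (f u) (g u)).
Proof.
move=> mf mg; apply: measurable_sum => i; apply: measurable_funM.
  exact: (measurableT_comp (measurable_coord i) mf).
exact: (measurableT_comp (measurable_coord i) mg).
Qed.

Lemma measurable_fun_rVD d (T : measurableType d) (f g : T -> 'rV[R]_n) :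
  measurable_fun setT f -> measurable_fun setT g ->
  measurable_fun setT (fun u => f u + g u).
Proof.
move=> mf mg; apply: measurable_fun_coordP => i.
under eq_fun do rewrite mxE; apply: measurable_funD.
  exact: (measurableT_comp (measurable_coord i) mf).
exact: (measurableT_comp (measurable_coord i) mg).
Qed.

Lemma measurable_fun_rVZ d (T : measurableType d) (f : T -> R) (g : T -> 'rV[R]_n) :
  measurable_fun setT f -> measurable_fun setT g ->
  measurable_fun setT (fun u => f u *: g u).
Proof.
move=> mf mg; apply: measurable_fun_coordP => i.
under eq_fun do rewrite mxE; apply: measurable_funM => //.
exact: (measurableT_comp (measurable_coord i) mg).
Qed.

Lemma measurable_fun_rVN d (T : measurableType d) (f : T -> 'rV[R]_n) :
  measurable_fun setT f -> measurable_fun setT (fun u => - f u).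
Proof.
move=> mf; under eq_fun do rewrite -scaleN1r.
by apply: measurable_fun_rVZ.
Qed.

Lemma measurable_fun_rVB d (T : measurableType d) (f g : T -> 'rV[R]_n) :
  measurable_fun setT f -> measurable_fun setT g ->
  measurable_fun setT (fun u => f u - g u).
Proof. by move=> mf mg; apply: measurable_fun_rVD => //; exact: measurable_fun_rVN. Qed.

End dotp.

Definition gauss_rV (R : realType) n (u : 'rV[R]_n) : R := expR (- dotp u u).

Section gauss_rV.
Context (R : realType).

Lemma gauss_rV_ge0 n (u : 'rV[R]_n) : 0 <= gauss_rV u. Proof. exact: expR_ge0. Qed.

Lemma measurable_fun_gauss_rV n d (T : measurableType d) (f : T -> 'rV[R]_n) :
  measurable_fun setT f -> measurable_fun setT (fun u => gauss_rV (f u)).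
Proof.
move=> mf; apply: (measurableT_comp (f := @expR R)) => //.
apply/measurable_funN.
exact: measurable_fun_dotp.
Qed.

Lemma measurable_gauss_rV n : measurable_fun setT (@gauss_rV R n).
Proof. exact: (@measurable_fun_gauss_rV n _ _ id). Qed.

Definition rV_behead n (y : 'rV[R]_n.+1) : 'rV[R]_n := \row_i y ord0 (lift ord0 i).

Lemma dotp_rV_cons n (y : 'rV[R]_n.+1) p :
  dotp y (rV_cons p) = y ord0 ord0 * p.1 + dotp (rV_behead y) p.2.
Proof.
rewrite /dotp big_ord_recl rV_cons0; congr (_ + _).
by apply: eq_bigr => i _; rewrite rV_consS mxE.
Qed.

Lemma rV_behead_cons n (p : R * 'rV[R]_n) : rV_behead (rV_cons p) = p.2.
Proof. by apply/rowP => i; rewrite mxE rV_consS. Qed.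

Lemma gauss_rV_cons n (p : R * 'rV[R]_n) : gauss_rV (rV_cons p) = gauss_fun p.1 * gauss_rV p.2.
Proof.
by rewrite /gauss_rV dotp_rV_cons rV_behead_cons rV_cons0 opprD expRD /gauss_fun expr2.
Qed.

Lemma gauss_rVE n (y : 'rV[R]_n.+1) : gauss_rV y = gauss_fun (y ord0 ord0) * gauss_rV (rV_behead y).
Proof.
rewrite -(gauss_rV_cons (y ord0 ord0, rV_behead y)); congr gauss_rV.
apply/rowP => i; case: (unliftP ord0 i) => [j|] ->.
  by rewrite rV_consS mxE.
by rewrite rV_cons0.
Qed.

Local Open Scope ereal_scope.

Lemma ge0_integral_rV_cons n (f : 'rV[R]_n.+1 -> \bar R) :
  measurable_fun setT f -> (forall x, 0 <= f x) ->
  \int[lebesgue_rV R n.+1]_x f x =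
  \int[lebesgue_measure]_a \int[lebesgue_rV R n]_x f (rV_cons (a, x)).
Proof.
move=> mf f0.
apply: etrans.
  apply: (@ge0_integral_pushforward _ _ (measurableTypeR R * 'rV[R]_n)%type _ R _
    (@measurable_rV_cons R n)
  (lebesgue_measure \x lebesgue_rV R n)%E setT f) => //.
rewrite preimage_setT fubini_tonelli1//.
exact: (measurableT_comp mf (@measurable_rV_cons R n)).
by move=> x; exact: f0.
Qed.

(** Fubini's theorem along the identification of R * R^n with R^(n+1). *)
Lemma integral_rV_cons n (f : 'rV[R]_n.+1 -> \bar R) :
  (lebesgue_rV R n.+1).-integrable setT f ->
  \int[lebesgue_rV R n.+1]_x f x =
  \int[lebesgue_measure]_a \int[lebesgue_rV R n]_x f (rV_cons (a, x)).
Proof.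
move=> intf.
have mf := measurable_int _ intf.
have H : (lebesgue_measure \x lebesgue_rV R n).-integrable setT (f \o @rV_cons R n).
  apply/integrableP; split.
    exact: (measurableT_comp mf (@measurable_rV_cons R n)).
  move/integrableP : intf => [_].
  congr (_ < _); apply: etrans.
    apply: (@ge0_integral_pushforward _ _ (measurableTypeR R * 'rV[R]_n)%type _ R _
    (@measurable_rV_cons R n)
      (lebesgue_measure \x lebesgue_rV R n)%E setT (abse \o f)) => //.
    exact: measurableT_comp.
    by move=> y _; exact: abse_ge0.
  by rewrite preimage_setT.
rewrite [RHS](integral12_prod_meas1 H); apply: etrans.
  apply: (@integral_pushforward _ _ (measurableTypeR R * 'rV[R]_n)%type _ R _
    (@measurable_rV_cons R n)
    (lebesgue_measure \x lebesgue_rV R n)%E setT f) => //.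
  by rewrite preimage_setT.
Qed.

Lemma integral_gauss_rV n : \int[lebesgue_rV R n]_x (gauss_rV x)%:E = ((Num.sqrt pi) ^+ n)%:E.
Proof.
elim: n => [|n IH].
  rewrite /= integral_dirac//; last by apply/measurable_EFinP; exact: measurable_gauss_rV.
  by rewrite diracT mul1e /gauss_rV /dotp big_ord0 oppr0 expR0.
rewrite ge0_integral_rV_cons//; last 2 first.
- by apply/measurable_EFinP; exact: measurable_gauss_rV.
- by move=> x; rewrite lee_fin gauss_rV_ge0.
under eq_integral => a _.
  under eq_integral do rewrite gauss_rV_cons EFinM.
  rewrite /= ge0_integralZl//; last 3 first.
  - by apply/measurable_EFinP; exact: measurable_gauss_rV.
  - by move=> x _; rewrite lee_fin gauss_rV_ge0.
  - by rewrite lee_fin gauss_fun_ge0.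
  rewrite IH muleC.
  over.
rewrite ge0_integralZl//; last 2 first.
- by apply/measurable_EFinP; exact: measurable_gauss_fun.
- by move=> x _; rewrite lee_fin gauss_fun_ge0.
by rewrite integralT_gauss -EFinM exprSr.
Qed.

Lemma integrable_gauss_rV n : (lebesgue_rV R n).-integrable setT (EFin \o @gauss_rV R n).
Proof.
apply/integrableP; split; first by apply/measurable_EFinP; exact: measurable_gauss_rV.
under eq_integral do rewrite /= ger0_norm ?gauss_rV_ge0//.
by rewrite integral_gauss_rV ltry.
Qed.

Lemma integrable_cos_gauss_rV n t (y : 'rV[R]_n) : (lebesgue_rV R n).-integrable setT
  (EFin \o (fun x => cos (t + 2 * dotp y x) * gauss_rV x)%R).
Proof.
apply: (@integrable_le _ _ R _ _ (@gauss_rV R n)).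
- apply: measurable_funM; last exact: measurable_gauss_rV.
  apply: measurableT_comp => //; first exact: continuous_measurable_fun (@continuous_cos R).
  apply: measurable_funD => //; apply: measurable_funM => //.
  exact: measurable_dotp.
- move=> x; rewrite normrM [`|gauss_rV _|%R]ger0_norm ?gauss_rV_ge0//.
  by rewrite ler_piMl ?gauss_rV_ge0// normr_cos_le1.
- exact: integrable_gauss_rV.
Qed.

(** The first coordinate only shifts the phase t of the integral over the
    others. *)
Lemma integral_cos_gauss_rV n t (y : 'rV[R]_n) :
  \int[lebesgue_rV R n]_x (cos (t + 2 * dotp y x) * gauss_rV x)%:E =
  (cos t * (Num.sqrt pi) ^+ n * gauss_rV y)%:E.
Proof.
elim: n t y => [|n IH] t y.
  rewrite /= integral_dirac//.
    by rewrite diracT mul1e /gauss_rV /dotp !big_ord0 oppr0 expR0 mulr0 addr0 !mulr1.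
  exact: measurable_int (integrable_cos_gauss_rV t y).
rewrite integral_rV_cons; last exact: integrable_cos_gauss_rV.
pose y0 := y ord0 ord0; pose y' := rV_behead y.
transitivity (\int[lebesgue_measure]_a
  ((Num.sqrt pi ^+ n * gauss_rV y') * (cos (t + 2 * y0 * a) * gauss_fun a))%:E).
  apply: eq_integral => a _.
  transitivity (\int[lebesgue_rV R n]_x
    ((gauss_fun a)%:E * (cos ((t + 2 * y0 * a) + 2 * dotp y' x) * gauss_rV x)%:E)).
    apply: eq_integral => x _.
    rewrite gauss_rV_cons/= dotp_rV_cons/= -EFinM; congr EFin.
    rewrite mulrCA; congr (_ * (cos _ * _))%R.
    by rewrite mulrDr addrA mulrA.
  rewrite integralZl//; last exact: integrable_cos_gauss_rV.
  rewrite IH -EFinM; congr EFin; ring.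
under eq_integral do rewrite EFinM.
rewrite integralZl//; last exact: integrable_cos_gauss.
rewrite integral_cos_gauss -EFinM; congr EFin.
by rewrite [gauss_rV y]gauss_rVE -/y0 -/y' exprSr; ring.
Qed.

End gauss_rV.

(** * Finite measures are determined by their Fourier transform *)

Lemma muleI_EFin (R : realType) (r : R) (x y : \bar R) : r != 0 ->
  (r%:E * x = r%:E * y)%E -> x = y.
Proof.
move=> r0 /(congr1 (fun z => (r^-1)%:E * z)%E).
by rewrite !muleA -!EFinM mulVf// !mul1e.
Qed.

Section uniqueness.
Context (R : realType) (n : nat).
Local Notation leb := (lebesgue_rV R n).
Local Open Scope ereal_scope.

Section smoothing.
Variable m : {finite_measure set 'rV[R]_n -> \bar R}.

Lemma integrable_prod_gauss_rV :
  (m \x leb).-integrable setT (EFin \o (fun p => gauss_rV p.2)).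
Proof.
have mg : measurable_fun setT (EFin \o (fun p : 'rV[R]_n * 'rV[R]_n => gauss_rV p.2)).
  apply/measurable_EFinP; apply: measurable_fun_gauss_rV; exact: measurable_snd.
apply/(integrable12ltyP _ _ mg) => /=.
under eq_integral do under eq_integral do rewrite ger0_norm ?gauss_rV_ge0//.
under eq_integral do rewrite integral_gauss_rV.
rewrite integral_cst// lte_mul_pinfty// ?lee_fin ?exprn_ge0 ?sqrtr_ge0//.
by rewrite ltey_eq fin_num_measure.
Qed.

(** Writing the Gaussian as a Fourier integral turns its convolution with m
    into an integral of the Fourier transform of m. *)
Lemma smooth_transform (e : R) (c : 'rV[R]_n) :
  (Num.sqrt pi ^+ n)%:E * \int[m]_x (gauss_rV (e *: (c - x))%R)%:E =
  \int[leb]_h ((gauss_rV h)%:E *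
    \int[m]_x (cos (2 * e * dotp c h + dotp ((- 2 * e) *: h) x))%:E).
Proof.
have mgx : measurable_fun setT (fun x : 'rV[R]_n => gauss_rV (e *: (c - x))).
  apply: measurable_fun_gauss_rV; apply: measurable_fun_rVZ => //.
  by apply: measurable_fun_rVB.
rewrite -ge0_integralZl//; last 2 first.
- by apply/measurable_EFinP.
- by move=> x _; rewrite lee_fin gauss_rV_ge0.
pose F (p : 'rV[R]_n * 'rV[R]_n) : R :=
  (cos (2 * dotp (e *: (c - p.1)) p.2) * gauss_rV p.2)%R.
have mF : measurable_fun setT F.
  apply: measurable_funM; last by apply: measurable_fun_gauss_rV; exact: measurable_snd.
  apply: (measurableT_comp (f := @cos R)).
    exact: continuous_measurable_fun (@continuous_cos R).
  apply: measurable_funM => //; apply: measurable_fun_dotp; last exact: measurable_snd.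
  apply: measurable_fun_rVZ => //; apply: measurable_fun_rVB => //.
have iF : (m \x leb).-integrable setT (EFin \o F).
  apply: (@integrable_le _ _ R _ _ (fun p => gauss_rV p.2)) => //.
    move=> p; rewrite /F normrM [`|gauss_rV _|%R]ger0_norm ?gauss_rV_ge0//.
    by rewrite ler_piMl ?gauss_rV_ge0// normr_cos_le1.
  exact: integrable_prod_gauss_rV.
transitivity (\int[m]_x \int[leb]_h (EFin \o F) (x, h)).
  apply: eq_integral => x _; rewrite /F /=.
  have := integral_cos_gauss_rV 0 (e *: (c - x)).
  by rewrite cos0 mul1r EFinM => <-; apply: eq_integral => h _; rewrite add0r.
rewrite (Fubini iF); apply: eq_integral => h _.
rewrite -integralZl//; last first.
  apply: measurable_bounded_integrable => //.
  - by rewrite ltey_eq fin_num_measure.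
  - apply: (measurableT_comp (f := @cos R)).
      exact: continuous_measurable_fun (@continuous_cos R).
    apply: measurable_funD => //; exact: measurable_dotp.
  - exists 1%R; split => // M M1 x _ /=.
    by rewrite (le_trans (normr_cos_le1 _))// ltW.
apply: eq_integral => x _; rewrite /F /= -EFinM mulrC; congr (_ * cos _)%:E%R.
by rewrite !dotpZl dotpDl dotpNl (dotpC x); ring.
Qed.

(** The blur has width d^2, and the box is shifted by d in every coordinate:
    the shift dominates the blur, so that every point is approached from below. *)
Definition smooth_box (a b : 'rV[R]_n) (d : R) : \bar R :=
  \int[m]_x \int[leb]_u
    (gauss_rV u * \1_(hbox a b) (x - const_mx d + d ^+ 2 *: u))%:E.

(** The substitution c = x - d + d^2 u moves the Gaussian onto x, where
    smooth_transform applies. *)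
Lemma smooth_boxE a b (d : R) : (0 < d)%R ->
  ((d ^+ 2) ^+ n)%:E * smooth_box a b d =
  \int[leb]_c ((\1_(hbox a b) c)%:E *
    \int[m]_x (gauss_rV ((d ^+ 2)^-1 *: ((c + const_mx d) - x)))%:E).
Proof.
move=> d0; have d20 : (0 < d ^+ 2)%R by rewrite exprn_gt0.
have mB : measurable_fun setT (\1_(hbox a b) : 'rV[R]_n -> R).
  by apply: measurable_indic; exact: measurable_hbox.
pose h (p : 'rV[R]_n * 'rV[R]_n) : R :=
  (gauss_rV ((d ^+ 2)^-1 *: ((p.2 + const_mx d) - p.1)) * \1_(hbox a b) p.2)%R.
have mh : measurable_fun setT h.
  apply: measurable_funM.
    apply: measurable_fun_gauss_rV; apply: measurable_fun_rVZ => //.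
    apply: measurable_fun_rVB => //; apply: measurable_fun_rVD => //.
  exact: (measurableT_comp mB measurable_snd).
have h0 p : (0 <= h p)%R by rewrite /h mulr_ge0 ?gauss_rV_ge0//.
transitivity (\int[m]_x \int[leb]_c (EFin \o h) (x, c)).
  rewrite -ge0_integralZl//; last 3 first.
  - apply: (measurable_fun_fubini_tonelli_F (m2 := leb) (fun p : 'rV[R]_n * 'rV[R]_n =>
      (gauss_rV p.2 * \1_(hbox a b) (p.1 - const_mx d + d ^+ 2 *: p.2))%:E)).
    + apply/measurable_EFinP; apply: measurable_funM.
        by apply: measurable_fun_gauss_rV.
      apply: (measurableT_comp mB).
      apply: measurable_fun_rVD; first exact: measurable_fun_rVB.
      exact: measurable_fun_rVZ.
    + by move=> p; rewrite lee_fin mulr_ge0 ?gauss_rV_ge0.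
  - move=> x _; apply: integral_ge0 => u _; by rewrite lee_fin mulr_ge0 ?gauss_rV_ge0.
  - by rewrite lee_fin exprn_ge0// ltW.
  apply: eq_integral => x _.
  have mhx : measurable_fun setT (fun c => (h (x, c))%:E).
    by apply/measurable_EFinP; exact: (measurableT_comp mh (measurable_pair1 x)).
  have hx0 c : 0 <= (h (x, c))%:E by rewrite lee_fin.
  rewrite [RHS](integral_rV_scale (x - const_mx d)%R d20 mhx hx0).
  congr (_ * _); apply: eq_integral => u _.
  rewrite /h/=; congr (gauss_rV _ * _)%:E%R; apply/rowP => i; rewrite !mxE.
  by rewrite (_ : _ - _ = d ^+ 2 * u ord0 i)%R ?mulKf ?gt_eqF//; ring.
rewrite (fubini_tonelli (EFin \o h)); last 2 first.
- exact/measurable_EFinP.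
- by move=> p; rewrite lee_fin.
apply: eq_integral => c _; rewrite -ge0_integralZl//; last 2 first.
- apply/measurable_EFinP; apply: measurable_fun_gauss_rV; apply: measurable_fun_rVZ => //.
  by apply: measurable_fun_rVB.
- by move=> x _; rewrite lee_fin gauss_rV_ge0.
by apply: eq_integral => x _; rewrite /h /= -EFinM mulrC.
Qed.

(** In each coordinate x - d + d^2 u tends to x and is eventually smaller than
    x, so the indicator of ]a, b] converges at every x, including the endpoints,
    whatever the mass of the boundary of the box. Dominated convergence, with
    the Gaussian as a bound, concludes. *)
Lemma smooth_box_cvg a b :
  smooth_box a b (k.+1%:R^-1) @[k --> \oo] --> (Num.sqrt pi ^+ n)%:E * m (hbox a b).
Proof.
have mB : measurable_fun setT (\1_(hbox a b) : 'rV[R]_n -> R).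
  by apply: measurable_indic; exact: measurable_hbox.
pose d (k : nat) : R := k.+1%:R^-1%R.
pose f_ k (p : 'rV[R]_n * 'rV[R]_n) : \bar R :=
  (gauss_rV p.2 * \1_(hbox a b) (p.1 - const_mx (d k) + d k ^+ 2 *: p.2))%:E.
pose f (p : 'rV[R]_n * 'rV[R]_n) : \bar R := (gauss_rV p.2 * \1_(hbox a b) p.1)%:E.
have mg : measurable_fun setT (fun p : 'rV[R]_n * 'rV[R]_n => gauss_rV p.2).
  by apply: measurable_fun_gauss_rV; exact: measurable_snd.
have mf_ k : measurable_fun setT (f_ k).
  apply/measurable_EFinP; apply: measurable_funM => //.
  apply: (measurableT_comp mB).
  apply: measurable_fun_rVD; first by apply: measurable_fun_rVB => //.
  by apply: measurable_fun_rVZ => //; exact: measurable_snd.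
have mf : measurable_fun setT f.
  apply/measurable_EFinP; apply: measurable_funM => //.
  by apply: (measurableT_comp mB).
have d_cvg : d k @[k --> \oo] --> (0 : R)%R by exact: cvg_harmonic.
have f_f p : f_ ^~ p @ \oo --> f p.
  apply: cvg_near_cst.
  suff H : \forall k \near \oo, forall i : 'I_n,
      `]a ord0 i, b ord0 i]%classic
        ((p.1 - const_mx (d k) + d k ^+ 2 *: p.2)%R ord0 i) =
      `]a ord0 i, b ord0 i]%classic (p.1 ord0 i).
    apply: filterS H => k H; rewrite /f_ /f; congr (_ * _)%:E%R.
    rewrite !indicE; congr (nat_of_bool _)%:R; apply/idP/idP; rewrite !inE => h i.
      by rewrite -(H i); exact: h.
    by have := h i; rewrite -(H i).
  apply: filter_forall => i.
  set x := p.1 ord0 i; set u := p.2 ord0 i.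
  have E k : (p.1 - const_mx (d k) + d k ^+ 2 *: p.2)%R ord0 i =
      (x - d k * (1 - d k * u))%R by rewrite !mxE -/x -/u; ring.
  have du : (d k * u @[k --> \oo] --> (0 : R))%R.
    by rewrite -(mul0r u); apply: cvgMl.
  have small : \forall k \near \oo, (0 < d k * (1 - d k * u))%R.
    have du1 := cvgr_lt _ du _ ltr01.
    near=> k; rewrite mulr_gt0 ?invr_gt0 ?ltr0n// subr_gt0.
    by near: k; exact: du1.
  have y_cvg : (x - d k * (1 - d k * u) @[k --> \oo] --> x)%R.
    rewrite -[X in _ --> X]subr0; apply: cvgB; first exact: cvg_cst.
    rewrite -[X in _ --> X](mul0r (1 - 0)%R); apply: cvgM => //.
    by apply: cvgB => //; exact: cvg_cst.
  have yx : \forall k \near \oo, (x - d k * (1 - d k * u) < x)%R.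
    by apply: filterS small => k; rewrite gtrBl.
  have [ax|xa] := ltP (a ord0 i) x; last first.
    near=> k; rewrite E /= !in_itv/= -/x (le_gtF xa) le_gtF//.
    by rewrite (le_trans _ xa)// ltW//; near: k; exact: yx.
  have ay := cvgr_gt _ y_cvg _ ax.
  have [xb|bx] := leP x (b ord0 i).
    near=> k; rewrite E /= !in_itv/= -/x ax xb (_ : (a ord0 i < _)%R); last by near: k; exact: ay.
    by rewrite (le_trans _ xb)// ltW//; near: k; exact: yx.
  have by_ := cvgr_gt _ y_cvg _ bx.
  near=> k; rewrite E /= !in_itv/= -/x (lt_geF bx) andbF lt_geF ?andbF//.
  by near: k; exact: by_.
have bd : {ae m \x leb, forall p k, setT p -> `|f_ k p| <= (EFin \o (fun p => gauss_rV p.2)) p}.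
  apply: aeW => p k _; rewrite /= lee_fin normrM ger0_norm ?gauss_rV_ge0//.
  by rewrite ler_piMr ?gauss_rV_ge0// indicE; case: (_ \in _); rewrite ?normr0 ?normr1.
have [_ _] := @dominated_convergence _ _ R (m \x leb) setT measurableT f_ f
  (EFin \o (fun p => gauss_rV p.2)) mf_ mf (aeW _ (fun p _ => f_f p))
  integrable_prod_gauss_rV bd.
have -> : \int[m \x leb]_p f p = (Num.sqrt pi ^+ n)%:E * m (hbox a b).
  rewrite fubini_tonelli1//; last by move=> p; rewrite lee_fin mulr_ge0 ?gauss_rV_ge0.
  transitivity (\int[m]_x ((Num.sqrt pi ^+ n)%:E * (\1_(hbox a b) x)%:E)).
    apply: eq_integral => x _; rewrite /fubini_F /f /=.
    under eq_integral do rewrite EFinM muleC.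
    rewrite ge0_integralZl//; last 2 first.
    - by apply/measurable_EFinP; exact: measurable_gauss_rV.
    - by move=> u _; rewrite lee_fin gauss_rV_ge0.
    by rewrite integral_gauss_rV muleC.
  rewrite ge0_integralZl//; last by apply/measurable_EFinP.
  by rewrite integral_indic ?setIT//; exact: measurable_hbox.
suff -> : (fun k => smooth_box a b (k.+1%:R^-1)) =
    (fun k => \int[m \x leb]_p f_ k p) by [].
apply/funext => k; rewrite fubini_tonelli1//.
by move=> p; rewrite lee_fin mulr_ge0 ?gauss_rV_ge0.
Unshelve. all: by end_near. Qed.

End smoothing.

(** By smooth_transform and smooth_boxE the smoothed masses of a box agree for
    the two measures; let the smoothing tend to 0. Allowing all phases t puts the
    real and imaginary parts of the transform in one hypothesis. *)
Theorem fourier_unique (m1 m2 : {finite_measure set 'rV[R]_n -> \bar R}) :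
  (forall t xi, \int[m1]_x (cos (t + dotp xi x))%:E =
                \int[m2]_x (cos (t + dotp xi x))%:E) ->
  forall A, measurable A -> m1 A = m2 A.
Proof.
move=> H; apply: hbox_measure_unique => [a b|a b]; last first.
  by rewrite ltey_eq fin_num_measure//; exact: measurable_hbox.
have sq0 : ((Num.sqrt pi : R) ^+ n != 0)%R.
  by rewrite expf_neq0// gt_eqF// sqrtr_gt0 pi_gt0.
have smooth12 (e : R) (c : 'rV[R]_n) :
    \int[m1]_x (gauss_rV (e *: (c - x))%R)%:E = \int[m2]_x (gauss_rV (e *: (c - x))%R)%:E.
  suff : (Num.sqrt pi ^+ n)%:E * \int[m1]_x (gauss_rV (e *: (c - x))%R)%:E =
         (Num.sqrt pi ^+ n)%:E * \int[m2]_x (gauss_rV (e *: (c - x))%R)%:E.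
    by move=> /(muleI_EFin sq0).
  by rewrite !smooth_transform; apply: eq_integral => h _; rewrite H.
have box12 d : (0 < d)%R -> smooth_box m1 a b d = smooth_box m2 a b d.
  move=> d0.
  suff : ((d ^+ 2) ^+ n)%:E * smooth_box m1 a b d =
         ((d ^+ 2) ^+ n)%:E * smooth_box m2 a b d.
    by apply: muleI_EFin; rewrite expf_neq0// expf_neq0// gt_eqF.
  by rewrite !smooth_boxE//; apply: eq_integral => c _; rewrite smooth12.
have c1 := @smooth_box_cvg m1 a b; have c2 := @smooth_box_cvg m2 a b.
have E : (fun k => smooth_box m1 a b (k.+1%:R^-1)) =
    (fun k => smooth_box m2 a b (k.+1%:R^-1)).
  by apply/funext => k; rewrite box12 ?invr_gt0 ?ltr0n.
rewrite E in c1.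
exact: (muleI_EFin sq0 (cvg_unique _ c1 c2)).
Qed.

End uniqueness.

(** * The Gamma function in exponential form *)

Section gamma_exp.
Context (R : realType).
Implicit Types c q y : R.

(** This is Gamma(c), after the substitution s = e^y in the integral of
    e^(-s) s^(c-1). *)
Definition gamma_exp c : \bar R :=
  (\int[lebesgue_measure]_y (expR (c * y - expR y))%:E)%E.

Lemma measurable_gamma_exp c q :
  measurable_fun setT (fun y : R => expR (c * y - q * expR y)).
Proof.
apply: (measurableT_comp (f := @expR R)) => //.
apply: measurable_funB; first exact: measurable_funM.
by apply: measurable_funM.
Qed.

Lemma measurable_gamma_exp1 c :
  measurable_fun setT (fun y : R => expR (c * y - expR y)).
Proof.
apply: (measurableT_comp (f := @expR R)) => //.
by apply: measurable_funB => //; exact: measurable_funM.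
Qed.

(** For y >= 0, use e^y >= (1 + y/2)^2 and 2 c y <= 4 c^2 + y^2 / 4. *)
Lemma gamma_exp_le c y :
  expR (c * y - expR y) <= expR (4 * c ^+ 2) * expR (- (c * `|y|)).
Proof.
rewrite -expRD ler_expR.
have [y0|y0] := leP 0 y.
  have : (1 + y / 2) ^+ 2 <= expR y.
    rewrite [in leRHS](_ : y = y / 2 + y / 2); last by field.
    rewrite expRD -expr2 ler_sqr ?nnegrE ?expR_ge0//; last by rewrite addr_ge0// divr_ge0.
    exact: expR_ge1Dx.
  have : 0 <= (2 * c - y / 2) ^+ 2 by exact: sqr_ge0.
  rewrite (ger0_norm y0); nra.
have := expR_ge0 y; have : 0 <= c ^+ 2 by exact: sqr_ge0.
rewrite (ltr0_norm y0); nra.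
Qed.

Lemma gamma_exp_lty c : 0 < c -> (gamma_exp c < +oo)%E.
Proof.
move=> c0; apply: (@le_lt_trans _ _ (\int[lebesgue_measure]_y
    ((expR (4 * c ^+ 2))%:E * (expR (- (c * `|y|)))%:E))%E).
  apply: ge0_le_integral => //.
  - by apply/measurable_EFinP; exact: measurable_gamma_exp1.
  - under eq_fun do rewrite -EFinM.
    apply/measurable_EFinP; apply: measurable_funM => //.
    by have /measurable_int/measurable_EFinP := integrable_expRN_abs c0.
  - by move=> y _; rewrite -EFinM lee_fin gamma_exp_le.
rewrite ge0_integralZl//.
- by rewrite lte_mul_pinfty ?lee_fin ?expR_ge0//; exact: integral_expRN_abs_lty.
- by have /measurable_int := integrable_expRN_abs c0.
Qed.

Lemma gamma_exp_gt0 c : 0 < c -> (0 < gamma_exp c)%E.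
Proof.
move=> c0.
apply: (@lt_le_trans _ _ (\int[lebesgue_measure]_(y in `[0%R, 1%R]) (expR (- expR 1))%:E)%E).
  rewrite integral_cst//= lebesgue_measure_itv/= lte_fin ltr01 -EFinB subr0 mule1.
  by rewrite lte_fin expR_gt0.
apply: (@le_trans _ _ (\int[lebesgue_measure]_(y in `[0%R, 1%R]) (expR (c * y - expR y))%:E)%E).
  apply: ge0_le_integral => //.
  - by apply/measurable_funTS; apply/measurable_EFinP; exact: measurable_gamma_exp1.
  - move=> y /=; rewrite in_itv/= => /andP[y0 y1]; rewrite lee_fin ler_expR.
    have : expR y <= expR 1 by rewrite ler_expR.
    have : 0 <= c * y by rewrite mulr_ge0// ltW.
    lra.
apply: ge0_subset_integral => //.
- by apply/measurable_EFinP; exact: measurable_gamma_exp1.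
Qed.

(** Translate y by ln(1 + q). *)
Lemma gamma_exp_scale c q : 0 <= q ->
  (\int[lebesgue_measure]_y (expR (c * y - (1 + q) * expR y))%:E =
   ((1 + q) `^ (- c))%:E * gamma_exp c)%E.
Proof.
move=> q0; have q1 : 0 < 1 + q by rewrite ltr_pwDl.
rewrite (ge0_integral_shift (- ln (1 + q))); last 2 first.
- by apply/measurable_EFinP; exact: measurable_gamma_exp.
- by move=> y; rewrite lee_fin expR_ge0.
rewrite -ge0_integralZl//; last 2 first.
- by apply/measurable_EFinP; exact: measurable_gamma_exp1.
- by rewrite lee_fin powR_ge0.
apply: eq_integral => y _; rewrite -EFinM; congr EFin.
rewrite /powR gt_eqF// -expRD; congr expR.
rewrite expRD expRN lnK ?posrE//.
by rewrite mulrDr mulrCA mulfV ?gt_eqF//; ring.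
Qed.

End gamma_exp.

(** * The L^1 modulus of continuity of the Gaussian *)

Section gauss_rV_shift.
Context (R : realType) (n : nat).
Implicit Types (h u : 'rV[R]_n).
Local Notation leb := (lebesgue_rV R n).

(** The product of the square roots of two translated Gaussians is a Gaussian
    about the midpoint, by the parallelogram law. *)
Lemma gauss_rV_mid u h :
  expR (- dotp u u / 2) * expR (- dotp (u + h) (u + h) / 2) =
  expR (- (enorm h ^+ 2 / 4)) * gauss_rV (u + 2^-1 *: h).
Proof.
rewrite /gauss_rV -!expRD; congr expR; rewrite enorm_sqr.
rewrite !dotpDl !dotpDr !dotpZl !dotpZr (dotpC h u).
by field.
Qed.

(** If p and q are the square roots of the two Gaussians, then
    |p^2 - q^2| = |p - q|(p + q) <= (r^-1 (p - q)^2 + r (p + q)^2) / 2. The cross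
    term of (p - q)^2 is kept on the left, as its integral is explicit, and
    (p + q)^2 <= 2 (p^2 + q^2). *)
Lemma gauss_rV_dist_le u h (r : R) : 0 < r ->
  `|gauss_rV u - gauss_rV (u + h)| + r^-1 * (expR (- (enorm h ^+ 2 / 4)) * gauss_rV (u + 2^-1 *: h))
  <= (r^-1 / 2 + r) * (gauss_rV u + gauss_rV (u + h)).
Proof.
move=> r0; rewrite -gauss_rV_mid.
have sq v : gauss_rV v = expR (- dotp v v / 2) ^+ 2.
  by rewrite expr2 -expRD; congr expR; by field.
rewrite !sq; set p := expR _; set q := expR _.
have p0 : 0 <= p by exact: expR_ge0.
have q0 : 0 <= q by exact: expR_ge0.
rewrite subr_sqr normrM [`|p + q|]ger0_norm ?addr_ge0//.
have h1 : `|p - q| * (p + q) <= (r^-1 * `|p - q| ^+ 2 + r * (p + q) ^+ 2) / 2.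
  have : 0 <= r * (r^-1 * `|p - q| - (p + q)) ^+ 2 by rewrite mulr_ge0 ?sqr_ge0// ltW.
  rewrite (_ : _ * _ ^+ 2 =
    r^-1 * `|p - q| ^+ 2 + r * (p + q) ^+ 2 - 2 * (`|p - q| * (p + q))); first by lra.
  by field; rewrite gt_eqF.
rewrite real_normK ?num_real// in h1.
have h2 : 0 <= r * (p - q) ^+ 2 by rewrite mulr_ge0 ?sqr_ge0// ltW.
move: h1 h2; set s := r^-1; nra.
Qed.

Local Open Scope ereal_scope.

Definition gauss_rV_mod h : \bar R := \int[leb]_u (`|gauss_rV u - gauss_rV (u + h)%R|)%:E.

Lemma measurable_gauss_rV_shift h : measurable_fun setT (fun u => gauss_rV (u + h)%R).
Proof. by apply: measurable_fun_gauss_rV; apply: measurable_fun_rVD. Qed.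

Lemma measurable_gauss_rV_mod h :
  measurable_fun setT (fun u => `|gauss_rV u - gauss_rV (u + h)%R|)%R.
Proof.
apply: measurableT_comp => //; apply: measurable_funB; first exact: measurable_gauss_rV.
exact: measurable_gauss_rV_shift.
Qed.

Lemma integral_gauss_rV_shift h :
  \int[leb]_u (gauss_rV (u + h)%R)%:E = (Num.sqrt pi ^+ n)%:E.
Proof.
rewrite -integral_gauss_rV [RHS](integral_rV_shift h)//.
- by apply/measurable_EFinP; exact: measurable_gauss_rV.
- by move=> x; rewrite lee_fin gauss_rV_ge0.
Qed.

Lemma integral_gauss_rVD h k : (0 <= k)%R ->
  \int[leb]_u (k * (gauss_rV u + gauss_rV (u + h)%R))%:E = (k * (2 * Num.sqrt pi ^+ n))%:E.
Proof.
move=> k0.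
under eq_integral do rewrite EFinM EFinD.
rewrite ge0_integralZl//; last 2 first.
- apply: emeasurable_funD; apply/measurable_EFinP; first exact: measurable_gauss_rV.
  exact: measurable_gauss_rV_shift.
- by move=> u _; rewrite adde_ge0 ?lee_fin ?gauss_rV_ge0.
rewrite ge0_integralD//; last 4 first.
- by move=> u _; rewrite lee_fin gauss_rV_ge0.
- by apply/measurable_EFinP; exact: measurable_gauss_rV.
- by move=> u _; rewrite lee_fin gauss_rV_ge0.
- by apply/measurable_EFinP; exact: measurable_gauss_rV_shift.
by rewrite integral_gauss_rV integral_gauss_rV_shift -EFinD -EFinM; congr EFin; ring.
Qed.

Lemma gauss_rV_mod_le2 h : gauss_rV_mod h <= (2 * Num.sqrt pi ^+ n)%:E.
Proof.
rewrite -[X in _ <= X%:E]mul1r -(integral_gauss_rVD h ler01).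
apply: ge0_le_integral => //.
- by apply/measurable_EFinP; exact: measurable_gauss_rV_mod.
- apply/measurable_EFinP; apply: measurable_funM => //; apply: measurable_funD.
    exact: measurable_gauss_rV.
  exact: measurable_gauss_rV_shift.
- move=> u _; rewrite lee_fin mul1r (le_trans (ler_normB _ _))//.
  by rewrite !ger0_norm ?gauss_rV_ge0.
Qed.

(** Integrate gauss_rV_dist_le with r = |h|, and use
    1 - exp(-|h|^2/4) <= |h|^2/4. *)
Lemma gauss_rV_mod_le_enorm h : (0 < enorm h)%R ->
  gauss_rV_mod h <= (3 * Num.sqrt pi ^+ n * enorm h)%:E.
Proof.
set r := enorm h => r0.
set Z := (Num.sqrt pi ^+ n : R)%R.
have Z0 : (0 <= Z)%R by rewrite exprn_ge0// sqrtr_ge0.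
set ex := expR (- (r ^+ 2 / 4)).
have k0 : (0 <= r^-1 / 2 + r)%R by rewrite addr_ge0 ?divr_ge0 ?invr_ge0// ltW.
have re0 : (0 <= r^-1 * ex)%R by rewrite mulr_ge0 ?expR_ge0// invr_ge0 ltW.
have H : gauss_rV_mod h + (r^-1 * ex * Z)%:E <= ((r^-1 / 2 + r) * (2 * Z))%:E.
  rewrite -(integral_gauss_rVD h k0) EFinM -(integral_gauss_rV_shift (2^-1 *: h)%R).
  rewrite -ge0_integralZl//; last 2 first.
  - by apply/measurable_EFinP; exact: measurable_gauss_rV_shift.
  - by move=> u _; rewrite lee_fin gauss_rV_ge0.
  rewrite /gauss_rV_mod -ge0_integralD//; last 3 first.
  - by apply/measurable_EFinP; exact: measurable_gauss_rV_mod.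
  - by move=> u _; rewrite mule_ge0 ?lee_fin ?gauss_rV_ge0.
  - by apply: measurable_funeM; apply/measurable_EFinP; exact: measurable_gauss_rV_shift.
  apply: ge0_le_integral => //.
  - by move=> u _; rewrite adde_ge0// mule_ge0 ?lee_fin ?gauss_rV_ge0.
  - apply: emeasurable_funD; first by apply/measurable_EFinP; exact: measurable_gauss_rV_mod.
    by apply: measurable_funeM; apply/measurable_EFinP; exact: measurable_gauss_rV_shift.
  - apply/measurable_EFinP; apply: measurable_funM => //; apply: measurable_funD.
      exact: measurable_gauss_rV.
    exact: measurable_gauss_rV_shift.
  - by move=> u _; rewrite -EFinM -EFinD lee_fin -mulrA; exact: gauss_rV_dist_le.
have : gauss_rV_mod h <= ((r^-1 / 2 + r) * (2 * Z) - r^-1 * ex * Z)%:E.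
  by rewrite EFinB leeBrDr.
move=> /le_trans; apply; rewrite lee_fin.
have : (1 - r ^+ 2 / 4 <= ex)%R by rewrite (le_trans _ (expR_ge1Dx _)).
move=> hex.
have : (r^-1 * (1 - ex) <= r / 4)%R.
  by rewrite ler_pdivrMl//; move: hex; lra.
move=> h3; have : (Z * (r^-1 * (1 - ex)) <= Z * (r / 4))%R by rewrite ler_wpM2l.
have : (0 <= Z * r)%R by rewrite mulr_ge0// ltW.
set s := (r^-1)%R; nra.
Qed.

(** Interpolation between the trivial bound and the linear one, according to
    whether |h| is larger or smaller than 1. *)
Lemma gauss_rV_mod_le_powR h (b : R) : (0 < enorm h)%R -> (0 <= b <= 1)%R ->
  gauss_rV_mod h <= (3 * Num.sqrt pi ^+ n * enorm h `^ b)%:E.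
Proof.
move=> h0 /andP[b0 b1].
have Z0 : (0 <= (Num.sqrt pi ^+ n : R))%R by rewrite exprn_ge0// sqrtr_ge0.
have [h1|h1] := leP (enorm h) 1%R.
  rewrite (le_trans (gauss_rV_mod_le_enorm h0))// lee_fin ler_wpM2l ?mulr_ge0//.
  by rewrite ger1_powR ?h0.
rewrite (le_trans (gauss_rV_mod_le2 h))// lee_fin.
have : (1 <= enorm h `^ b)%R by rewrite -(powRr0 (enorm h)) ler_powR// ltW.
set e := (_ `^ _)%R; nra.
Qed.

End gauss_rV_shift.

(** * Measures with a density *)

Section density_measure.
Local Open Scope ereal_scope.
Context (d : measure_display) (T : measurableType d) (R : realType).
Variables (mu : {measure set T -> \bar R}) (f : T -> R).

(** The two hypotheses are arguments so that the measure structure can be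
    attached to the set function. *)
Definition density_measure of (forall x, (0 <= f x)%R) & measurable_fun setT f :=
  fun A : set T => \int[mu]_(x in A) (f x)%:E.

Hypotheses (f0 : forall x, (0 <= f x)%R) (mf : measurable_fun setT f).

Let density0 : density_measure f0 mf set0 = 0.
Proof. by rewrite /density_measure integral_set0. Qed.

Let density_ge0 A : 0 <= density_measure f0 mf A.
Proof. by apply: integral_ge0 => x _; rewrite lee_fin. Qed.

Let density_sigma_additive : semi_sigma_additive (density_measure f0 mf).
Proof.
move=> F mF tF mUF.
rewrite [X in _ --> X](_ : _ = \sum_(k <oo) density_measure f0 mf (F k)).
  by apply: is_cvg_nneseries => k _ _; exact: density_ge0.
apply: ge0_integral_bigcup => //.
  by apply/measurable_funTS; exact/measurable_EFinP.
by move=> x _; rewrite lee_fin.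
Qed.

HB.instance Definition _ := isMeasure.Build _ _ _
  (density_measure f0 mf) density0 density_ge0 density_sigma_additive.

Import HBNNSimple.

(** True for indicators by definition, hence for simple functions, hence for
    nonnegative functions by monotone convergence. *)
Lemma ge0_integral_density (g : T -> \bar R) : (forall x, 0 <= g x) ->
  measurable_fun setT g ->
  \int[density_measure f0 mf]_x g x = \int[mu]_x (g x * (f x)%:E).
Proof.
move=> g0 mg; pose h := nnsfun_approx measurableT mg.
have -> : \int[density_measure f0 mf]_x g x =
    lim (\int[density_measure f0 mf]_x (EFin \o h n) x @[n --> \oo]).
  have gE x : g x = lim ((EFin \o h n) x @[n --> \oo]).
    by apply/esym/cvg_lim => //; exact: cvg_nnsfun_approx.
  under eq_integral do rewrite gE.
  apply: monotone_convergence => //.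
  - by move=> n; apply/measurable_EFinP; exact/measurable_funP.
  - by move=> n x _ //=; rewrite lee_fin.
  - by move=> x _ a b ab; rewrite lee_fin; exact/lefP/nd_nnsfun_approx.
have -> : \int[mu]_x (g x * (f x)%:E) =
    lim (\int[mu]_x ((EFin \o h n) x * (f x)%:E) @[n --> \oo]).
  have gE x : g x * (f x)%:E = lim (((EFin \o h n) x * (f x)%:E) @[n --> \oo]).
    apply/esym/cvg_lim => //; apply: cvgeZr => //.
    exact: cvg_nnsfun_approx.
  under eq_integral do rewrite gE.
  apply: monotone_convergence => //.
  - move=> n; apply/emeasurable_funM; apply/measurable_EFinP => //.
  - by move=> n x _ /=; rewrite mule_ge0 ?lee_fin.
  - move=> x _ a b ab/=; rewrite lee_wpmul2r ?lee_fin//.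
    exact/lefP/nd_nnsfun_approx.
suff suf n : \int[mu]_x ((EFin \o h n) x * (f x)%:E) =
    \int[density_measure f0 mf]_x (EFin \o h n) x.
  by under [in RHS]eq_fun do rewrite suf.
transitivity (\int[density_measure f0 mf]_x
   (\sum_(y \in range (h n)) (y * \1_(h n @^-1` [set y]) x)%:E)); last first.
  by apply: eq_integral => t tE; rewrite /= fimfunE -fsumEFin.
have indich r : measurable_fun setT (fun x => (r * \1_(h n @^-1` [set r]) x)%:E).
  by apply/measurable_EFinP; exact: measurable_funM.
rewrite ge0_integral_fsum//; last by move=> m y Ey; exact: nnfun_muleindic_ge0.
transitivity (\int[mu]_x (\sum_(y \in range (h n))
    (y * \1_(h n @^-1` [set y]) x)%:E * (f x)%:E)).
  under [RHS]eq_integral => x xE.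
    rewrite -ge0_mule_fsuml => [|y]; last exact: nnfun_muleindic_ge0.
    rewrite fsumEFin // -(fimfunE _ x); over.
  by [].
rewrite ge0_integral_fsum//; last 2 first.
  - by move=> y; apply: emeasurable_funM => //; exact/measurable_EFinP.
  - move=> m y Ey; apply: mule_ge0; last by rewrite lee_fin.
    exact: nnfun_muleindic_ge0.
apply: eq_fsbigr => r rhn.
under [RHS]eq_integral do rewrite EFinM.
rewrite integralZl_indic_nnsfun//.
have mA : measurable (h n @^-1` [set r]) by exact: measurable_sfunP.
rewrite integral_indic// setIT.
have r0 : (0 <= r)%R by move: rhn; rewrite inE => -[x _ <-].
under eq_integral do rewrite EFinM -muleA.
rewrite ge0_integralZl//.
- congr (_ * _); rewrite /= /density_measure [RHS]integral_mkcond; apply: eq_integral => x _.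
  by rewrite patchE indicE; case: ifP => _; rewrite ?mul1e ?mul0e.
- apply: emeasurable_funM; first exact/measurable_EFinP.
  exact/measurable_EFinP.
- by move=> x _; rewrite mule_ge0 ?lee_fin.
Qed.

End density_measure.

(** * Uniqueness tested on nonnegative functions *)

Section as_finite_measure.
Context (d : measure_display) (T : measurableType d) (R : realType).
Variable m : {measure set T -> \bar R}.

(** An alias of m that carries its finiteness as a structure. *)
Definition as_finite of (m setT < +oo)%E : set T -> \bar R := m.

Hypothesis fin : (m setT < +oo)%E.

HB.instance Definition _ := isMeasure.Build _ _ _ (as_finite fin)
  (measure0 m) (measure_ge0 m) (@measure_semi_sigma_additive _ _ _ m).

HB.instance Definition _ := Measure_isFinite.Build _ _ _ (as_finite fin)
  (lty_fin_num_fun fin).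

End as_finite_measure.

Section uniqueness_nonneg.
Local Open Scope ereal_scope.
Context (R : realType) (n : nat).

(** Since 1 + cos is nonnegative, the transforms can be computed with Tonelli's
    theorem only. The total mass is recovered from xi = 0 and t = 0. *)
Corollary fourier_unique_ge0 (m1 m2 : {measure set 'rV[R]_n -> \bar R}) :
  m1 setT < +oo -> m2 setT < +oo ->
  (forall t xi, \int[m1]_x (1 + cos (t + dotp xi x))%:E =
                \int[m2]_x (1 + cos (t + dotp xi x))%:E) ->
  forall A, measurable A -> m1 A = m2 A.
Proof.
move=> fin1 fin2 H.
have icos (m : {measure set 'rV[R]_n -> \bar R}) t xi : m setT < +oo ->
    m.-integrable setT (EFin \o (fun x => cos (t + dotp xi x))%R).
  move=> mfin; apply: measurable_bounded_integrable => //.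
  - apply: (measurableT_comp (f := @cos R)).
      exact: continuous_measurable_fun (@continuous_cos R).
    by apply: measurable_funD => //; exact: measurable_dotp.
  - exists 1%R; split => // M M1' x _ /=.
    by rewrite (le_trans (normr_cos_le1 _))// ltW.
have dec (m : {measure set 'rV[R]_n -> \bar R}) t xi : m setT < +oo ->
    \int[m]_x (1 + cos (t + dotp xi x))%:E =
    m setT + \int[m]_x (cos (t + dotp xi x))%:E.
  move=> mfin; under eq_integral do rewrite EFinD.
  rewrite integralD//; last 2 first.
  - by apply: measurable_bounded_integrable => //; exact: bounded_cst.
  - exact: icos.
  by rewrite integral_cst// mul1e.
have mass : m1 setT = m2 setT.
  have := H 0%R 0%R.
  have E x : (1 + cos (0 + dotp 0 x) = 2 :> R)%R.
    by rewrite /dotp big1 ?addr0 ?cos0// => i _; rewrite mxE mul0r.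
  under eq_integral do rewrite E; under [in RHS]eq_integral do rewrite E.
  by rewrite !integral_cst//; apply: muleI_EFin.
apply: (@fourier_unique R n (as_finite fin1) (as_finite fin2)) => t xi.
have := H t xi; rewrite !dec// mass => /(congr1 (fun z => z - m2 setT)).
by rewrite ![m2 setT + _]addeC !addeK// ge0_fin_numE.
Qed.

End uniqueness_nonneg.

(** * Subordinated Gaussian measures *)

Section subordination.
Local Open Scope ereal_scope.
Context (R : realType) (n : nat) (a : R).
Local Notation leb := (lebesgue_rV R n).
Local Notation T := (measurableTypeR R * 'rV[R]_n)%type.

(** In the variable s = e^y, the weight is e^(-s) s^a ds/s. *)
Definition subord_pdf (p : T) : R := (expR (a * p.1 - expR p.1) * gauss_rV p.2)%R.

Definition subord_map (p : T) : 'rV[R]_n := (2 * expR (p.1 / 2)) *: p.2.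

Lemma subord_pdf_ge0 p : (0 <= subord_pdf p)%R.
Proof. by apply: mulr_ge0; [exact: expR_ge0|exact: gauss_rV_ge0]. Qed.

Lemma measurable_subord_pdf : measurable_fun setT subord_pdf.
Proof.
apply: measurable_funM.
  exact: (measurableT_comp (measurable_gamma_exp1 a) measurable_fst).
by apply: measurable_fun_gauss_rV; exact: measurable_snd.
Qed.

Lemma measurable_subord_map : measurable_fun setT subord_map.
Proof.
apply: measurable_fun_rVZ; last exact: measurable_snd.
apply: measurable_funM => //; apply: (measurableT_comp (f := @expR R)) => //.
by apply: measurable_funM => //; exact: measurable_fst.
Qed.

Let base : {measure set T -> \bar R} :=
  density_measure (lebesgue_measure \x leb) subord_pdf_ge0 measurable_subord_pdf.

(** The mixture over s of the images of exp(-|u|^2) du under u |-> 2 sqrt(s) u,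
    that is, of multiples of the heat kernels at time s. *)
Definition subord : set 'rV[R]_n -> \bar R := pushforward base subord_map.

Let subord0 : subord set0 = 0.
Proof. by rewrite /subord /pushforward preimage_set0; exact: (measure0 base). Qed.

Let subord_ge0 A : 0 <= subord A.
Proof. exact: (measure_ge0 base). Qed.

Let subord_sigma_additive : semi_sigma_additive subord.
Proof.
move=> F mF tF mUF; rewrite /subord /pushforward preimage_bigcup.
apply: (measure_semi_sigma_additive (s := base)).
- by move=> k; rewrite -[X in measurable X]setTI; exact: measurable_subord_map.
- apply/trivIsetP => /= i j _ _ ij; rewrite -preimage_setI.
  by move/trivIsetP : tF => /(_ _ _ _ _ ij) ->//; rewrite preimage_set0.
- by rewrite -preimage_bigcup -[X in measurable X]setTI; exact: measurable_subord_map.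
Qed.

HB.instance Definition _ := isMeasure.Build _ _ _
  subord subord0 subord_ge0 subord_sigma_additive.

Lemma ge0_integral_subord (g : 'rV[R]_n -> \bar R) :
  (forall x, 0 <= g x) -> measurable_fun setT g ->
  \int[subord]_x g x =
  \int[lebesgue_measure]_y ((expR (a * y - expR y))%:E *
     \int[leb]_u ((gauss_rV u)%:E * g ((2 * expR (y / 2)) *: u)%R)).
Proof.
move=> g0 mg.
have mgm : measurable_fun setT (g \o subord_map) by exact: measurableT_comp measurable_subord_map.
transitivity (\int[base]_p (g \o subord_map) p).
  rewrite -[LHS]/(\int[pushforward base subord_map]_x g x).
  by rewrite (ge0_integral_pushforward measurable_subord_map)// preimage_setT.
rewrite ge0_integral_density//; last by move=> p; exact: g0.
rewrite fubini_tonelli1//; last 2 first.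
- by apply: emeasurable_funM => //; apply/measurable_EFinP; exact: measurable_subord_pdf.
- by move=> p; rewrite mule_ge0 ?lee_fin ?subord_pdf_ge0//; exact: g0.
apply: eq_integral => y _; rewrite /fubini_F -ge0_integralZl//; last 2 first.
- apply: emeasurable_funM; first by apply/measurable_EFinP; exact: measurable_gauss_rV.
  apply: measurableT_comp => //; exact: measurable_fun_rVZ.
- by move=> u _; rewrite mule_ge0 ?lee_fin ?gauss_rV_ge0.
apply: eq_integral => u _; rewrite /subord_pdf /subord_map /= EFinM muleC muleA.
by rewrite -!muleA.
Qed.

End subordination.

Section subord_transform.
Local Open Scope ereal_scope.
Context (R : realType) (n : nat) (a : R).
Hypothesis a0 : (0 < a)%R.
Local Notation leb := (lebesgue_rV R n).
Local Notation Z := (Num.sqrt pi ^+ n : R)%R.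
Local Notation Ga := (gamma_exp a).

Lemma integrable_gamma_exp q : (0 <= q)%R -> lebesgue_measure.-integrable setT
  (EFin \o (fun y : R => expR (a * y - (1 + q) * expR y))).
Proof.
move=> q0; apply/integrableP; split.
  by apply/measurable_EFinP; exact: measurable_gamma_exp.
under eq_integral do rewrite /= ger0_norm ?expR_ge0//.
rewrite gamma_exp_scale// lte_mul_pinfty ?lee_fin ?powR_ge0//.
exact: gamma_exp_lty.
Qed.

Lemma integral_1Dcos_gauss_rV t (y : 'rV[R]_n) :
  \int[leb]_u ((gauss_rV u)%:E * (1 + cos (t + 2 * dotp y u))%:E) =
  (Z + cos t * Z * gauss_rV y)%:E.
Proof.
transitivity (\int[leb]_u ((gauss_rV u)%:E + (cos (t + 2 * dotp y u) * gauss_rV u)%:E)).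
  by apply: eq_integral => u _; rewrite -EFinM -EFinD; congr EFin; ring.
rewrite integralD//; last 2 first.
- exact: integrable_gauss_rV.
- exact: integrable_cos_gauss_rV.
by rewrite integral_gauss_rV integral_cos_gauss_rV.
Qed.

(** Given s = e^y, the Gaussian contributes exp(-s|xi|^2); the integral over y
    is then gamma_exp_scale with q = |xi|^2. *)
Lemma integral_1Dcos_subord t (xi : 'rV[R]_n) :
  \int[@subord R n a]_x (1 + cos (t + dotp xi x))%:E =
  (Z * (1 + cos t * (1 + enorm xi ^+ 2) `^ (- a)))%:E * Ga.
Proof.
have mc : measurable_fun setT (fun x : 'rV[R]_n => (1 + cos (t + dotp xi x))%:E).
  apply/measurable_EFinP; apply: measurable_funD => //.
  apply: (measurableT_comp (f := @cos R)).
    exact: continuous_measurable_fun (@continuous_cos R).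
  by apply: measurable_funD => //; exact: measurable_dotp.
have c0 x : 0 <= (1 + cos (t + dotp xi x))%:E.
  by rewrite lee_fin -lerBlDl sub0r cos_geN1.
rewrite (ge0_integral_subord a c0 mc).
have q0 : (0 <= enorm xi ^+ 2)%R by rewrite sqr_ge0.
transitivity (\int[lebesgue_measure]_y
   ((Z * expR (a * y - expR y))%:E +
    ((cos t * Z) * expR (a * y - (1 + enorm xi ^+ 2) * expR y))%:E)).
  apply: eq_integral => y _.
  under eq_integral => u _.
    rewrite dotpZr (_ : (2 * expR (y / 2) * dotp xi u)%R =
      (2 * dotp (expR (y / 2) *: xi) u)%R); last by rewrite dotpZl mulrA.
    over.
  rewrite integral_1Dcos_gauss_rV -EFinM -EFinD; congr EFin.
  rewrite mulrDr mulrC; congr (_ + _)%R.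
  rewrite mulrCA; congr (_ * _)%R; rewrite /gauss_rV -expRD; congr expR.
  rewrite dotpZl dotpZr -enorm_sqr mulrA -expRD.
  by rewrite (_ : y / 2 + y / 2 = y)%R; [ring|field].
rewrite integralD//; last 2 first.
- apply: integrable_scale.
  have := integrable_gamma_exp (lexx 0%R).
  by under eq_fun do rewrite addr0 mul1r.
- by apply: integrable_scale; exact: integrable_gamma_exp.
have Gfin : Ga \is a fin_num.
  by rewrite ge0_fin_numE ?gamma_exp_lty// ltW// gamma_exp_gt0.
under eq_integral do rewrite EFinM.
rewrite ge0_integralZl//; last first.
- by apply/measurable_EFinP; exact: measurable_gamma_exp1.
under [X in _ + X]eq_integral do rewrite EFinM.
rewrite integralZl//; last exact: integrable_gamma_exp.
rewrite (gamma_exp_scale a q0) -/Ga.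
move: Gfin; case: Ga => // r _.
rewrite -!EFinM -EFinD; congr EFin; ring.
Qed.

End subord_transform.

(** * The Bessel kernel as a subordinated Gaussian *)

Section bessel_subord.
Context (R : realType) (n : nat) (alpha : R) (G : 'rV[R]_n -> R).
Hypotheses (alpha0 : 0 < alpha) (GB : bessel_kernel alpha G).
Local Notation leb := (lebesgue_rV R n).
Local Notation a := (alpha / 2).

Let iG : leb.-integrable setT (EFin \o G). Proof. by have [] := GB. Qed.

Let mG : measurable_fun setT G.
Proof. by apply/measurable_EFinP; exact: measurable_int iG. Qed.

(** The total mass of the subordinated measure, that is, the factor between it
    and G dx. *)
Definition bessel_mass : R := Num.sqrt pi ^+ n * fine (gamma_exp a).

Let a0 : 0 < a. Proof. by rewrite divr_gt0. Qed.

Lemma gamma_exp_fin : gamma_exp a \is a fin_num.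
Proof. by rewrite ge0_fin_numE ?gamma_exp_lty// ltW// gamma_exp_gt0. Qed.

Lemma bessel_mass_gt0 : 0 < bessel_mass.
Proof.
rewrite mulr_gt0 ?exprn_gt0 ?sqrtr_gt0 ?pi_gt0// fine_gt0// gamma_exp_gt0//=.
exact: gamma_exp_lty.
Qed.

Definition bessel_pos x : R := bessel_mass * Num.max (G x) 0.
Definition bessel_neg x : R := bessel_mass * Num.max (- G x) 0.

Lemma bessel_pos_ge0 x : 0 <= bessel_pos x.
Proof. by rewrite mulr_ge0 ?(ltW bessel_mass_gt0)// le_max lexx orbT. Qed.

Lemma bessel_neg_ge0 x : 0 <= bessel_neg x.
Proof. by rewrite mulr_ge0 ?(ltW bessel_mass_gt0)// le_max lexx orbT. Qed.

Lemma measurable_bessel_pos : measurable_fun setT bessel_pos.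
Proof. by apply: measurable_funM => //; exact: measurable_maxr. Qed.

Lemma measurable_bessel_neg : measurable_fun setT bessel_neg.
Proof.
by apply: measurable_funM => //; apply: measurable_maxr => //; exact: measurableT_comp.
Qed.

Lemma bessel_posB x : bessel_pos x - bessel_neg x = bessel_mass * G x.
Proof.
rewrite /bessel_pos /bessel_neg -mulrBr; congr (_ * _).
have [Gx|Gx] := leP (G x) 0.
  by rewrite max_l ?oppr_ge0//; ring.
by rewrite max_r ?oppr_le0 ?ltW//; ring.
Qed.

Lemma integrableM_bessel_part (c : 'rV[R]_n -> R) (M : R) :
  measurable_fun setT c -> (forall x, `|c x| <= M) ->
  leb.-integrable setT (EFin \o (fun x => c x * bessel_pos x)) /\
  leb.-integrable setT (EFin \o (fun x => c x * bessel_neg x)).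
Proof.
move=> mc cM.
have M0 : 0 <= M by rewrite (le_trans _ (cM 0)).
have igM : leb.-integrable setT (EFin \o (fun x => (M * bessel_mass) * `|G x|)).
  by apply: integrable_scale; exact: integrable_norm.
split; apply: integrable_le igM.
- by apply: measurable_funM => //; exact: measurable_bessel_pos.
- move=> x; rewrite normrM (ger0_norm (bessel_pos_ge0 _)) -mulrA ler_pM//.
    exact: bessel_pos_ge0.
  rewrite ler_wpM2l ?(ltW bessel_mass_gt0)// ge_max ler_norm/=; exact: normr_ge0.
- by apply: measurable_funM => //; exact: measurable_bessel_neg.
- move=> x; rewrite normrM (ger0_norm (bessel_neg_ge0 _)) -mulrA ler_pM//.
    exact: bessel_neg_ge0.
  by rewrite ler_wpM2l ?(ltW bessel_mass_gt0)// ge_max normr_ge0 andbT -normrN ler_norm.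
Qed.

Let integrable_bdd (c : 'rV[R]_n -> R) : measurable_fun setT c ->
  (forall x, `|c x| <= 1) -> leb.-integrable setT (EFin \o (fun x => c x * G x)).
Proof.
move=> mc c1; apply: (integrable_le _ _ (integrable_norm iG)).
  exact: measurable_funM.
by move=> x; rewrite normrM /= ler_piMl.
Qed.

Let mcos (t : R) xi : measurable_fun setT (fun x : 'rV[R]_n => cos (t + dotp x xi)).
Proof.
apply: (measurableT_comp (f := @cos R)).
  exact: continuous_measurable_fun (@continuous_cos R).
by apply: measurable_funD => //; exact: measurable_fun_dotp.
Qed.

Let msin xi : measurable_fun setT (fun x : 'rV[R]_n => sin (dotp x xi)).
Proof.
apply: (measurableT_comp (f := @sin R)).
  exact: continuous_measurable_fun (@continuous_sin R).
exact: measurable_fun_dotp.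
Qed.

(** Expand cos(t + xi.x). The integral of G is the transform at 0, which is 1,
    and the sine part vanishes since the transform is real. *)
Lemma bessel_1Dcos t xi :
  \int[leb]_x ((1 + cos (t + dotp xi x)) * G x) =
  1 + cos t * (1 + enorm xi ^+ 2) `^ (- a).
Proof.
have mc0 : measurable_fun setT (fun x : 'rV[R]_n => cos (dotp x xi)).
  by have := mcos 0 xi; congr measurable_fun; apply/funext => x; rewrite add0r.
have ic := integrable_bdd mc0 (fun x => normr_cos_le1 _).
have is_ := integrable_bdd (msin xi) (fun x => normr_sin_le1 _).
have F0 : \int[leb]_x G x = 1.
  have := GB.2 0; rewrite /fourier => -[+ _].
  rewrite (_ : enorm 0 = 0); last first.
    by rewrite /enorm /dotp big1 ?sqrtr0// => i _; rewrite mxE mul0r.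
  rewrite expr0n/= addr0 powR1 => <-; apply: eq_Rintegral => x _.
  by rewrite /dotp big1 ?cos0 ?mul1r// => i _; rewrite mxE mulr0.
have := GB.2 xi; rewrite /fourier => -[Fc Fs].
transitivity (\int[leb]_x (G x +
   (cos t * (cos (dotp x xi) * G x) + (- sin t) * (sin (dotp x xi) * G x)))).
  by apply: eq_Rintegral => x _; rewrite cosD (dotpC xi); ring.
have icc := integrable_scale (cos t) ic.
have iss := integrable_scale (- sin t) is_.
rewrite RintegralD//; last first.
  rewrite (_ : _ \o _ = (EFin \o (fun x => cos t * (cos (dotp x xi) * G x))%R) \+
     (EFin \o (fun x => - sin t * (sin (dotp x xi) * G x))%R))%E//.
  exact: integrableD.
rewrite RintegralD// F0 !RintegralZl// Fc.
by move/eqP : Fs; rewrite oppr_eq0 => /eqP ->; rewrite mulr0 addr0.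
Qed.

Local Open Scope ereal_scope.

Lemma bessel_subord_lty : @subord R n a setT < +oo.
Proof.
have aux (x : \bar R) (r : R) : 2%:E * x = r%:E -> x < +oo.
  by case: x => [s _||]; rewrite ?ltry ?ltNye ?gt0_muley ?lte_fin.
have := integral_1Dcos_subord a0 0 (0 : 'rV[R]_n).
have E (x : 'rV[R]_n) : (1 + cos (0 + dotp 0 x) = 2 :> R)%R.
  by rewrite /dotp big1 ?addr0 ?cos0// => i _; rewrite mxE mul0r.
under eq_integral do rewrite E.
by rewrite integral_cst// -(fineK gamma_exp_fin) -EFinM => /aux.
Qed.

(** The subordination formula, with the negative part of G moved to the other
    side so that only nonnegative measures occur. Both sides have the same Fourier
    transform, by bessel_1Dcos and integral_1Dcos_subord. *)
Lemma bessel_subord (g : 'rV[R]_n -> \bar R) :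
  (forall x, 0 <= g x) -> measurable_fun setT g ->
  \int[leb]_x (g x * (bessel_pos x)%:E) =
  \int[leb]_x (g x * (bessel_neg x)%:E) + \int[@subord R n a]_x g x.
Proof.
move=> g0 mg.
pose mp : {measure set 'rV[R]_n -> \bar R} :=
  density_measure leb bessel_pos_ge0 measurable_bessel_pos.
pose mn : {measure set 'rV[R]_n -> \bar R} :=
  density_measure leb bessel_neg_ge0 measurable_bessel_neg.
have fin_part (c : 'rV[R]_n -> R) (M : R) : measurable_fun setT c ->
    (forall x, 0 <= c x)%R -> (forall x, `|c x| <= M)%R ->
    [/\ \int[mp]_x (c x)%:E = (\int[leb]_x (c x * bessel_pos x))%R%:E,
        \int[mn]_x (c x)%:E = (\int[leb]_x (c x * bessel_neg x))%R%:E &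
        (\int[leb]_x (c x * bessel_pos x) - \int[leb]_x (c x * bessel_neg x) =
         bessel_mass * \int[leb]_x (c x * G x))%R].
  move=> mc c0 cM; have [ip in_] := integrableM_bessel_part mc cM.
  have mcE : measurable_fun setT (fun x => (c x)%:E) by exact/measurable_EFinP.
  have c0E x : 0 <= (c x)%:E by rewrite lee_fin.
  rewrite /mp /mn !ge0_integral_density//; split.
  - by rewrite /Rintegral fineK//; apply: integrable_fin_num.
  - by rewrite /Rintegral fineK//; apply: integrable_fin_num.
  - rewrite -RintegralB// -RintegralZl//.
      by apply: eq_Rintegral => x _; rewrite -mulrBr bessel_posB mulrCA.
    apply: (integrable_le _ _ (integrable_scale M (integrable_norm iG))).
      exact: measurable_funM.
    by move=> x; rewrite normrM /= ler_wpM2r.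
have mpfin : mp setT < +oo.
  rewrite [X in X < _](_ : _ = \int[leb]_x (1 * bessel_pos x)%R%:E).
    apply: integrable_lty => //.
    by have [] := @integrableM_bessel_part (fun=> 1%R) 1%R (measurable_cst _)
      (fun=> ltac:(by rewrite normr1)).
  by apply: eq_integral => x _; rewrite mul1r.
have mnfin : mn setT < +oo.
  rewrite [X in X < _](_ : _ = \int[leb]_x (1 * bessel_neg x)%R%:E).
    apply: integrable_lty => //.
    by have [] := @integrableM_bessel_part (fun=> 1%R) 1%R (measurable_cst _)
      (fun=> ltac:(by rewrite normr1)).
  by apply: eq_integral => x _; rewrite mul1r.
have meq := @fourier_unique_ge0 R n mp (measure_add mn (@subord R n a)) mpfin.
rewrite -(ge0_integral_density leb bessel_pos_ge0 measurable_bessel_pos)//.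
rewrite -(ge0_integral_density leb bessel_neg_ge0 measurable_bessel_neg)//.
rewrite -[RHS](ge0_integral_measure_add mn (@subord R n a))//.
apply: eq_measure_integral => A mA _; apply: meq => //.
  by have := lte_add_pinfty mnfin bessel_subord_lty; rewrite -measure_addE.
move=> t xi.
have c0 (x : 'rV[R]_n) : (0 <= 1 + cos (t + dotp xi x))%R.
  by rewrite -lerBlDl sub0r cos_geN1.
have mc : measurable_fun setT (fun x : 'rV[R]_n => 1 + cos (t + dotp xi x))%R.
  apply: measurable_funD => //; apply: eq_measurable_fun (mcos t xi) => x _.
  by rewrite dotpC.
have cM (x : 'rV[R]_n) : (`|1 + cos (t + dotp xi x)| <= 2)%R.
  by rewrite ger0_norm// -[2%R]/(1 + 1)%R lerD2l cos_le1.
have [-> En D] := fin_part _ _ mc c0 cM.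
rewrite ge0_integral_measure_add//; last exact/measurable_EFinP.
rewrite En (integral_1Dcos_subord a0) -(fineK gamma_exp_fin) -EFinM -EFinD.
congr EFin; move: D; rewrite bessel_1Dcos /bessel_mass => /eqP.
by rewrite subr_eq => /eqP ->; ring.
Qed.

End bessel_subord.

(** * The L^1 modulus of continuity of the Bessel kernel *)

Section half_shift.
Local Open Scope ereal_scope.
Context (R : realType) (n : nat).
Local Notation leb := (lebesgue_rV R n).
Implicit Types (A : set 'rV[R]_n) (t : 'rV[R]_n).

(** Let A be the set where G(x) >= G(x + t). The sign of G - G(. + t) tested
    against that difference is half_shift A t - half_shift (~` A) t tested against
    G: the translation has been moved onto the test function. *)
Definition half_shift A t (x : 'rV[R]_n) : R := (\1_A x + \1_(~` A) (x - t))%R.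

Lemma half_shift_ge0 A t x : (0 <= half_shift A t x)%R.
Proof. by rewrite /half_shift addr_ge0. Qed.

Lemma half_shift_le2 A t x : (half_shift A t x <= 2)%R.
Proof. by rewrite -[2%R]/(1 + 1)%R lerD// indicE lern1 leq_b1. Qed.

Lemma measurable_half_shift A t : measurable A -> measurable_fun setT (half_shift A t).
Proof.
move=> mA; apply: measurable_funD; first exact: measurable_indic.
have mC : measurable_fun setT (\1_(~` A) : 'rV[R]_n -> R).
  by apply: measurable_indic; exact: measurableC.
by apply: (measurableT_comp mC); exact: measurable_fun_rVB.
Qed.

(** Translating only the second term by t / c gives both terms the same
    argument, and moves the translation onto f. *)
Lemma integral_half_shift A t (c : R) (f : 'rV[R]_n -> R) : measurable A ->
  (0 < c)%R -> measurable_fun setT f -> (forall x, 0 <= f x)%R ->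
  \int[leb]_u ((f u)%:E * (half_shift A t (c *: u))%:E) =
  \int[leb]_u (f u * \1_A (c *: u) + f (u + c^-1 *: t) * \1_(~` A) (c *: u))%:E.
Proof.
move=> mA c0 mf f0.
have mi B : measurable B -> measurable_fun setT (fun u : 'rV[R]_n => \1_B (c *: u) : R).
  move=> mB; have mB' : measurable_fun setT (\1_B : 'rV[R]_n -> R) by exact: measurable_indic.
  by apply: (measurableT_comp mB'); exact: measurable_fun_rVZ.
have mi' : measurable_fun setT (fun u : 'rV[R]_n => \1_(~` A) (c *: u - t)%R : R).
  have mB' : measurable_fun setT (\1_(~` A) : 'rV[R]_n -> R).
    by apply: measurable_indic; exact: measurableC.
  by apply: (measurableT_comp mB'); apply: measurable_fun_rVB => //; exact: measurable_fun_rVZ.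
have mfs : measurable_fun setT (fun u : 'rV[R]_n => f (u + c^-1 *: t)%R).
  by apply: (measurableT_comp mf); exact: measurable_fun_rVD.
transitivity (\int[leb]_u (f u * \1_A (c *: u))%:E +
              \int[leb]_u (f u * \1_(~` A) (c *: u - t)%R)%:E).
  rewrite -ge0_integralD//.
  - by apply: eq_integral => u _; rewrite -EFinM -EFinD -mulrDr.
  - by move=> u _; rewrite lee_fin mulr_ge0.
  - by apply/measurable_EFinP; apply: measurable_funM => //; exact: mi.
  - by move=> u _; rewrite lee_fin mulr_ge0.
  - by apply/measurable_EFinP; apply: measurable_funM.
rewrite [X in _ + X](integral_rV_shift (c^-1 *: t)); last 2 first.
- by apply/measurable_EFinP; apply: measurable_funM.
- by move=> u; rewrite lee_fin mulr_ge0.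
rewrite -ge0_integralD//.
- apply: eq_integral => u _; rewrite -EFinD; congr (_ + _ * \1__ _)%:E%R.
  by rewrite scalerDr scalerA mulfV ?gt_eqF// scale1r addrK.
- by move=> u _; rewrite lee_fin mulr_ge0.
- by apply/measurable_EFinP; apply: measurable_funM => //; exact: mi.
- by move=> u _; rewrite lee_fin mulr_ge0.
- apply/measurable_EFinP; apply: measurable_funM => //.
  by apply: (measurableT_comp mi'); exact: measurable_fun_rVD.
Qed.

Lemma enormZ (k : R) (t : 'rV[R]_n) : enorm (k *: t) = (`|k| * enorm t)%R.
Proof.
by rewrite /enorm dotpZl dotpZr mulrA -expr2 sqrtrM ?sqr_ge0// sqrtr_sqr.
Qed.

(** After integral_half_shift the two integrands are the two ways of pairing
    f and f(. + h) with A and its complement, so they differ by at most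
    |f - f(. + h)|. *)
Lemma gauss_rV_half_shift A t (c b : R) : measurable A -> (0 < c)%R ->
  (0 < enorm t)%R -> (0 <= b <= 1)%R ->
  \int[leb]_u ((gauss_rV u)%:E * (half_shift A t (c *: u))%:E) <=
  \int[leb]_u ((gauss_rV u)%:E * (half_shift (~` A) t (c *: u))%:E) +
  (3 * Num.sqrt pi ^+ n * (c^-1 * enorm t) `^ b)%:E.
Proof.
move=> mA c0 t0 b01; have mA' := measurableC mA.
rewrite !integral_half_shift//; try exact: measurable_gauss_rV; try exact: gauss_rV_ge0.
set h := c^-1 *: t.
have hE : enorm h = (c^-1 * enorm t)%R by rewrite enormZ gtr0_norm// invr_gt0.
have h0 : (0 < enorm h)%R by rewrite hE mulr_gt0// invr_gt0.
have := gauss_rV_mod_le_powR h0 b01; rewrite hE => hmod.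
apply: (@le_trans _ _ (\int[leb]_u (gauss_rV u * \1_(~` A) (c *: u) +
    gauss_rV (u + h) * \1_(~` ~` A) (c *: u))%:E + gauss_rV_mod h)); last exact: leeD2l.
have mi B : measurable B -> measurable_fun setT (fun u : 'rV[R]_n => \1_B (c *: u) : R).
  move=> mB; have mB' : measurable_fun setT (\1_B : 'rV[R]_n -> R) by exact: measurable_indic.
  by apply: (measurableT_comp mB'); exact: measurable_fun_rVZ.
have mk B : measurable B -> measurable_fun setT (fun u : 'rV[R]_n =>
    gauss_rV u * \1_B (c *: u) + gauss_rV (u + h) * \1_(~` B) (c *: u))%R.
  move=> mB; apply: measurable_funD; apply: measurable_funM.
  - exact: measurable_gauss_rV.
  - exact: mi.
  - exact: measurable_gauss_rV_shift.
  - by apply: mi; exact: measurableC.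
have k0 B u : (0 <= gauss_rV u * \1_B (c *: u) + gauss_rV (u + h) * \1_(~` B) (c *: u))%R.
  by rewrite addr_ge0// mulr_ge0// gauss_rV_ge0.
rewrite -ge0_integralD//; last 3 first.
- by move=> u _; rewrite lee_fin.
- by apply/measurable_EFinP; exact: mk.
- by apply/measurable_EFinP; exact: measurable_gauss_rV_mod.
apply: ge0_le_integral => //.
- by move=> u _; rewrite lee_fin.
- by apply/measurable_EFinP; exact: mk.
- apply: emeasurable_funD; apply/measurable_EFinP; first exact: mk.
  exact: measurable_gauss_rV_mod.
- move=> u _; rewrite -EFinD lee_fin setCK.
  rewrite !indicE in_setC; case: (_ \in A) => /=.
    by rewrite !mulr1 !mulr0 addr0 add0r -lerBlDl ler_norm.
  by rewrite !mulr1 !mulr0 addr0 add0r -lerBlDl -normrN opprB ler_norm.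
Qed.

(** The parameter y turns the translation t into h = t / (2 e^(y/2)), and
    |h|^b = (|t|/2)^b e^(-b y/2) shifts the exponent of the Gamma integral. *)
Lemma subord_half_shift A t (a b : R) : measurable A ->
  (0 < enorm t)%R -> (0 <= b <= 1)%R -> (0 < a - b / 2)%R ->
  \int[@subord R n a]_x (half_shift A t x)%:E <=
  \int[@subord R n a]_x (half_shift (~` A) t x)%:E +
  (3 * Num.sqrt pi ^+ n * (enorm t / 2) `^ b)%:E * gamma_exp (a - b / 2).
Proof.
move=> mA t0 b01 ab0; have mA' := measurableC mA.
pose K : R := (3 * Num.sqrt pi ^+ n * (enorm t / 2) `^ b)%R.
have K0 : (0 <= K)%R by rewrite !mulr_ge0 ?powR_ge0// exprn_ge0// sqrtr_ge0.
pose I B y := \int[leb]_u ((gauss_rV u)%:E * (half_shift B t ((2 * expR (y / 2)) *: u))%:E).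
have I0 B y : 0 <= I B y.
  by apply: integral_ge0 => u _; rewrite mule_ge0 ?lee_fin ?gauss_rV_ge0 ?half_shift_ge0.
have mI B : measurable B -> measurable_fun setT (I B : measurableTypeR R -> \bar R).
  move=> mB; apply: (measurable_fun_fubini_tonelli_F (m2 := leb)
    (fun p : measurableTypeR R * 'rV[R]_n =>
      (gauss_rV p.2)%:E * (half_shift B t ((2 * expR (p.1 / 2)) *: p.2))%:E)).
    apply: emeasurable_funM; apply/measurable_EFinP.
      by apply: measurable_fun_gauss_rV; exact: measurable_snd.
    apply: (measurableT_comp (measurable_half_shift t mB)).
    exact: measurable_subord_map.
  by move=> p; rewrite mule_ge0 ?lee_fin ?gauss_rV_ge0 ?half_shift_ge0.
rewrite !ge0_integral_subord; last 4 first.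
- by move=> x; rewrite lee_fin half_shift_ge0.
- by apply/measurable_EFinP; exact: measurable_half_shift.
- by move=> x; rewrite lee_fin half_shift_ge0.
- by apply/measurable_EFinP; exact: measurable_half_shift.
rewrite -ge0_integralZl//; last first.
- by apply/measurable_EFinP; exact: measurable_gamma_exp1.
rewrite -ge0_integralD//; last 4 first.
- by move=> y _; rewrite mule_ge0// I0.
- apply: emeasurable_funM; last exact: mI.
  by apply/measurable_EFinP; exact: measurable_gamma_exp1.
- by move=> y _; rewrite mule_ge0.
- by apply: measurable_funeM; apply/measurable_EFinP; exact: measurable_gamma_exp1.
apply: ge0_le_integral => //.
- by move=> y _; rewrite mule_ge0// I0.
- apply: emeasurable_funM; last exact: mI.
  by apply/measurable_EFinP; exact: measurable_gamma_exp1.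
- apply: emeasurable_funD.
    apply: emeasurable_funM; last exact: mI.
    by apply/measurable_EFinP; exact: measurable_gamma_exp1.
  by apply: measurable_funeM; apply/measurable_EFinP; exact: measurable_gamma_exp1.
move=> y _.
have c0 : (0 < 2 * expR (y / 2) :> R)%R by rewrite mulr_gt0// expR_gt0.
have := gauss_rV_half_shift mA c0 t0 b01.
have e0 : 0 <= (expR (a * y - expR y))%:E by rewrite lee_fin expR_ge0.
move=> /(lee_wpmul2l e0) /le_trans; apply.
rewrite ge0_muleDr ?I0//; last first.
  by rewrite lee_fin !mulr_ge0 ?powR_ge0// exprn_ge0// sqrtr_ge0.
rewrite leeD2l// -!EFinM lee_fin.
rewrite (_ : (2 * expR (y / 2))^-1 * enorm t = (enorm t / 2) * expR (- (y / 2)))%R; last first.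
  by rewrite invfM expRN; ring.
rewrite powRM ?expR_ge0 ?divr_ge0 ?enorm_ge0// -expRM.
rewrite (_ : expR ((a - b / 2) * y - expR y) =
  expR (a * y - expR y) * expR (- (y / 2) * b))%R; last first.
  by rewrite -expRD; congr expR; field.
by rewrite le_eqVlt; apply/orP; left; apply/eqP; rewrite /K; ring.
Qed.

End half_shift.

Section bessel_modulus.
Local Open Scope ereal_scope.
Context (R : realType) (n : nat) (alpha : R) (G : 'rV[R]_n -> R).
Hypotheses (alpha0 : (0 < alpha)%R) (GB : bessel_kernel alpha G).
Local Notation leb := (lebesgue_rV R n).

(** With A the set where G(x) >= G(x + t), p and q the scaled parts of G, and
    X f B the integral of f against half_shift B t, a pointwise identity gives
    D + X q A + X p (~A) = X p A + X q (~A) for the scaled modulus D. The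
    subordination formula X p B = X q B + S B cancels the parts of G, leaving
    D + S (~A) = S A, and subord_half_shift bounds S A - S (~A). *)
Lemma bessel_kernel_modulus (b : R) : (0 <= b <= 1)%R -> (b < alpha)%R ->
  exists2 C : R, (0 <= C)%R & forall t, (0 < enorm t)%R ->
    \int[leb]_x (`|G x - G (x + t)%R|)%:E <= (C * enorm t `^ b)%:E.
Proof.
move=> b01 balpha.
have ab0 : (0 < alpha / 2 - b / 2)%R by rewrite -mulrBl divr_gt0// subr_gt0.
have Gfin : gamma_exp (alpha / 2 - b / 2) \is a fin_num.
  by rewrite ge0_fin_numE ?gamma_exp_lty// ltW// gamma_exp_gt0.
have kap0 := bessel_mass_gt0 n alpha0; set kap := bessel_mass n alpha in kap0.
pose C := (kap^-1 * (3 * Num.sqrt pi ^+ n * 2^-1 `^ b *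
  fine (gamma_exp (alpha / 2 - b / 2))))%R.
exists C => [|t t0].
  rewrite !mulr_ge0 ?invr_ge0 ?(ltW kap0) ?exprn_ge0 ?sqrtr_ge0 ?powR_ge0//.
  by rewrite fine_ge0// ltW// gamma_exp_gt0.
have mG : measurable_fun setT G by apply/measurable_EFinP; have [/measurable_int] := GB.
have mGt : measurable_fun setT (fun x : 'rV[R]_n => G (x + t)%R).
  by apply: (measurableT_comp mG); exact: measurable_fun_rVD.
pose p := bessel_pos alpha G; pose q := bessel_neg alpha G.
have mp : measurable_fun setT p by exact: measurable_bessel_pos.
have mq : measurable_fun setT q by exact: measurable_bessel_neg.
have p0 x : (0 <= p x)%R by exact: bessel_pos_ge0.
have q0 x : (0 <= q x)%R by exact: bessel_neg_ge0.
pose A := [set x | (G (x + t)%R <= G x)%R].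
have mA : measurable A.
  have := measurable_fun_ler mGt mG; move=> /(_ measurableT [set true] I).
  by rewrite setTI.
have mA' := measurableC mA.
pose X (f : 'rV[R]_n -> R) (B : set 'rV[R]_n) :=
  \int[leb]_x ((half_shift B t x)%:E * (f x)%:E).
pose S (B : set 'rV[R]_n) := \int[@subord R n (alpha / 2)]_x (half_shift B t x)%:E.
pose D := \int[leb]_x (kap * `|G x - G (x + t)%R|)%:E.
have D0 : 0 <= D by apply: integral_ge0 => x _; rewrite lee_fin mulr_ge0// ltW.
have mhs B : measurable B -> measurable_fun setT (half_shift B t).
  exact: measurable_half_shift.
have S0 B : 0 <= S B by apply: integral_ge0 => x _; rewrite lee_fin half_shift_ge0.
have Xfin f : f = p \/ f = q -> forall B, measurable B -> X f B \is a fin_num.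
  move=> fpq B mB.
  have hs2 x : (`|half_shift B t x| <= 2)%R.
    by rewrite ger0_norm ?half_shift_ge0// half_shift_le2.
  have [ip iq] := integrableM_bessel_part alpha0 GB (mhs B mB) hs2.
  rewrite /X; under eq_integral do rewrite -EFinM.
  by apply: integrable_fin_num => //; case: fpq => ->.
have XS B : measurable B -> X p B = X q B + S B.
  move=> mB; apply: (bessel_subord alpha0 GB).
    by move=> x; rewrite lee_fin half_shift_ge0.
  by apply/measurable_EFinP; exact: mhs.
have Sfin B : measurable B -> S B \is a fin_num.
  move=> mB; have := Xfin p (or_introl erefl) B mB.
  by rewrite (XS _ mB) fin_numD => /andP[].
have XE (f : 'rV[R]_n -> R) B : measurable B -> measurable_fun setT f -> (forall x, 0 <= f x)%R ->
    X f B = \int[leb]_x (f x * \1_B x + f (x + t)%R * \1_(~` B) x)%:E.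
  move=> mB mf f0; rewrite /X.
  have := integral_half_shift t mB ltr01 mf f0.
  under eq_integral do rewrite scale1r muleC.
  move=> ->; apply: eq_integral => x _; by rewrite scale1r invr1 scale1r.
have msum (f : 'rV[R]_n -> R) B : measurable B -> measurable_fun setT f -> measurable_fun setT
    (fun x => (f x * \1_B x + f (x + t)%R * \1_(~` B) x)%:E).
  move=> mB mf; apply/measurable_EFinP; apply: measurable_funD; apply: measurable_funM => //.
  - by apply: (measurableT_comp mf); exact: measurable_fun_rVD.
  - by apply: measurable_indic; exact: measurableC.
have sum0 (f : 'rV[R]_n -> R) B x : (forall x, 0 <= f x)%R ->
    0 <= (f x * \1_B x + f (x + t)%R * \1_(~` B) x)%:E.
  by move=> f0; rewrite lee_fin addr_ge0// mulr_ge0.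
have mDD : measurable_fun setT (fun x => (kap * `|G x - G (x + t)%R|)%:E).
  apply/measurable_EFinP; apply: measurable_funM => //.
  by apply: measurableT_comp => //; exact: measurable_funB.
have DD0 x : 0 <= (kap * `|G x - G (x + t)%R|)%:E.
  by rewrite lee_fin mulr_ge0// ltW.
have key : D + X q A + X p (~` A) = X p A + X q (~` A).
  rewrite !XE// /D.
  rewrite -ge0_integralD//; try (by move=> x _; exact: sum0); try exact: msum.
  rewrite -ge0_integralD//; try (by move=> x _; exact: sum0); try exact: msum; last 2 first.
  - by move=> x _; rewrite adde_ge0// sum0.
  - by apply: emeasurable_funD => //; exact: msum.
  rewrite -ge0_integralD//; try (by move=> x _; exact: sum0); try exact: msum.
  apply: eq_integral => x _; rewrite -!EFinD; congr EFin.
  have pqE y : (p y - q y = kap * G y)%R by exact: bessel_posB.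
  rewrite setCK !indicE in_setC; have [xA|xA] := boolP (x \in A) => /=.
    move: xA; rewrite inE /A /= => xA; rewrite ger0_norm ?subr_ge0// mulrBr.
    by rewrite -!pqE; ring.
  move: xA; rewrite notin_setE /A /= => /negP; rewrite -ltNge => xA.
  rewrite ltr0_norm ?subr_lt0// mulrN mulrBr -!pqE; ring.
have DS : D + S (~` A) = S A.
  move: key; rewrite !XS//.
  have := Xfin q (or_intror erefl) A mA; have := Xfin q (or_intror erefl) _ mA'.
  have := Sfin A mA; have := Sfin _ mA'.
  case: (X q A) => // x1; case: (X q (~` A)) => // x2.
  case: (S A) => // s1; case: (S (~` A)) => // s2 _ _ _ _.
  by case: D D0 => // d _ [] H; congr EFin; lra.
have := subord_half_shift mA t0 b01 ab0; rewrite -/(S A) -/(S (~` A)) -DS.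
have := Sfin _ mA'; case: (S (~` A)) => // s _.
rewrite [in X in _ <= X -> _]addeC leeD2rE// -(fineK Gfin) -EFinM => DB.
rewrite -(@lee_pmul2l _ kap%:E)// ?lte_fin//.
rewrite -ge0_integralZl//; last 2 first.
- by apply/measurable_EFinP; apply: measurableT_comp => //; exact: measurable_funB.
- by rewrite lee_fin ltW.
apply: le_trans DB _; rewrite -EFinM lee_fin /C.
rewrite powRM ?enorm_ge0// le_eqVlt; apply/orP; left; apply/eqP.
by field; rewrite gt_eqF.
Qed.

End bessel_modulus.

(** * Young functions and Luxemburg norms *)

Section young.
Context (R : realType) (A : R -> R).
Hypothesis YA : young_function A.

(** Convexity between t and 0, where A vanishes. *)
Lemma young_scale (l t : R) : 1 <= l -> 0 <= t -> A (t / l) <= A t / l.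
Proof.
move=> l1 t0; have l0 : 0 < l by exact: lt_le_trans ltr01 l1.
have il : 0 <= l^-1 <= 1 by rewrite invr_ge0 ltW//= invf_le1.
have /andP[il0 il1] := il.
have := young_convex YA (Itv01 il0 il1) (x := t) (y := 0).
rewrite !inE /= !in_itv /= lexx t0 => /(_ isT isT).
move=> H; have {H} : A (l^-1 * t + (1 - l^-1) * 0) <= l^-1 * A t + (1 - l^-1) * A 0.
  exact: H.
by rewrite (young0 YA) !mulr0 !addr0 ![l^-1 * _]mulrC.
Qed.

(** Superlinear growth makes t w - A(w) nonpositive for large w. *)
Lemma young_ubound (t : R) : 0 <= t ->
  has_ubound [set t * w - A w | w in [set w | 0 < w]].
Proof.
move=> t0; have /cvgryPge /(_ t) := young_cvgy YA.
move=> [N [_ HN]].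
pose N' := Num.max N 0 + 1.
have N'N : N < N' by rewrite ltr_pwDr// le_max lexx.
have N'0 : 0 < N' by rewrite ltr_pwDr// le_max lexx orbT.
exists (t * N') => _ [w w0 <-].
have [wN|Nw] := leP w N'.
  have := young_ge0 YA (ltW w0); have : t * w <= t * N' by rewrite ler_wpM2l.
  lra.
have := HN w (lt_trans N'N Nw); rewrite ler_pdivlMr// => H.
have : 0 <= t * N' by rewrite mulr_ge0// ltW.
lra.
Qed.

Lemma young_legendre (t w : R) : 0 <= t -> 0 < w ->
  t * w - A w <= complementary A t.
Proof. by move=> t0 w0; apply: ub_le_sup; [exact: young_ubound|exists w]. Qed.

(** A(w) <= e w for some w <= 1, so the supremum is at least -e. *)
Lemma complementary_ge0 (t : R) : 0 <= t -> 0 <= complementary A t.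
Proof.
move=> t0; apply/ler_addgt0Pr => e e0; rewrite -lerBlDr sub0r.
have /cvgrPdist_lt /(_ e e0) := young_cvg0 YA.
move=> [d /= d0 Hd].
pose w := Num.min (d / 2) 1.
have w0 : 0 < w by rewrite lt_min divr_gt0//=.
have wd : `|0 - w| < d.
  by rewrite sub0r normrN gtr0_norm// gt_min ltr_pdivrMr// mulr2n mulrDr mulr1 ltrDl d0.
have := Hd w wd w0; rewrite sub0r normrN ger0_norm; last first.
  by rewrite divr_ge0 ?(young_ge0 YA)// ltW.
rewrite ltr_pdivrMr// => Aw.
apply: le_trans (young_legendre t0 w0).
have w1 : w <= 1 by rewrite ge_min lexx orbT.
have : e * w <= e by rewrite ler_piMr// ltW.
have : 0 <= t * w by rewrite mulr_ge0// ltW.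
lra.
Qed.

Lemma complementary_le (t c : R) :
  (forall w, 0 < w -> t * w - A w <= c) -> complementary A t <= c.
Proof.
move=> H; apply: ge_sup; first by exists (t * 1 - A 1), 1 => //=.
by move=> _ [w w0 <-]; exact: H.
Qed.

Lemma complementary_nondecreasing (s t : R) : 0 <= s -> s <= t ->
  complementary A s <= complementary A t.
Proof.
move=> s0 st; apply: complementary_le => w w0.
apply: le_trans (young_legendre (le_trans s0 st) w0).
by rewrite lerD2r ler_wpM2r// ltW.
Qed.

Lemma complementary_scale (l t : R) : 1 <= l -> 0 <= t ->
  complementary A (t / l) <= complementary A t / l.
Proof.
move=> l1 t0; have l0 : 0 < l by exact: lt_le_trans ltr01 l1.
apply: complementary_le => w w0.
rewrite ler_pdivlMr//; apply: le_trans (young_legendre t0 w0).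
rewrite mulrBl (_ : t / l * w * l = t * w); last by field; rewrite gt_eqF.
by rewrite lerD2l lerN2 ler_peMr// (young_ge0 YA)// ltW.
Qed.

Lemma young_inequality (s t : R) : 0 <= s -> 0 <= t ->
  s * t <= A s + complementary A t.
Proof.
move=> s0 t0; have [->|sn0] := eqVneq s 0.
  by rewrite mul0r (young0 YA) add0r complementary_ge0.
by rewrite addrC -lerBlDr mulrC young_legendre// lt_neqAle eq_sym sn0//.
Qed.

End young.

Section luxemburg.
Local Open Scope ereal_scope.
Context (d : measure_display) (X : measurableType d) (R : realType).
Variables (nu : {measure set X -> \bar R}) (A : R -> R).
Hypothesis A_ge0 : forall t, (0 <= t -> 0 <= A t)%R.
Hypothesis A_homo : forall s t, (0 <= s -> s <= t -> A s <= A t)%R.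
Hypothesis A_scale : forall l t, (1 <= l -> 0 <= t -> A (t / l) <= A t / l)%R.

Lemma measurable_orlicz (v : X -> R) (l : R) : (0 < l)%R ->
  measurable_fun setT v -> measurable_fun setT (fun x => A (`|v x| / l)%R).
Proof.
move=> l0 mv.
have mA : measurable_fun setT (fun t : R => A (Num.max t 0)%R).
  apply: nondecreasing_measurable => // s t st; apply: A_homo.
    by rewrite le_max lexx orbT.
  by rewrite ge_max !le_max st lexx !orbT.
have mvl : measurable_fun setT (fun x => `|v x| / l)%R.
  by apply: measurable_funM => //; exact: measurableT_comp.
apply: (eq_measurable_fun ((fun t : R => A (Num.max t 0)%R) \o (fun x => `|v x| / l)%R)).
  by move=> x _ /=; rewrite max_l// divr_ge0// ltW.
exact: (measurableT_comp mA mvl).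
Qed.

Definition luxemburg_level (v : X -> R) (l : R) : Prop :=
  (0 < l)%R /\ \int[nu]_x (A (`|v x| / l)%R)%:E <= 1.

(** Dividing by l >= 1 divides the integral at least by l, so l = 1 + I works,
    where I is the integral of A(|v|). *)
Lemma luxemburg_level_ex (v : X -> R) : orlicz nu A v ->
  exists l, luxemburg_level v l.
Proof.
move=> [mv Ioo]; set I := \int[nu]_x _ in Ioo.
have I0 : 0 <= I by apply: integral_ge0 => x _; rewrite lee_fin A_ge0.
have Ifin : I \is a fin_num by rewrite ge0_fin_numE.
pose l := (1 + fine I)%R.
have l1 : (1 <= l)%R by rewrite lerDl fine_ge0.
have l0 : (0 < l)%R by exact: lt_le_trans ltr01 l1.
have mAv : measurable_fun setT (fun x => A (`|v x|)%R).
  have := measurable_orlicz ltr01 mv.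
  by apply: eq_measurable_fun => x _; rewrite divr1.
exists l; split=> //.
apply: (@le_trans _ _ (\int[nu]_x ((l^-1)%:E * (A (`|v x|)%R)%:E))).
  apply: ge0_le_integral => //.
  - by move=> x _; rewrite lee_fin A_ge0// divr_ge0// ltW.
  - by apply/measurable_EFinP; exact: measurable_orlicz.
  - by apply: measurable_funeM; exact/measurable_EFinP.
  - by move=> x _; rewrite -EFinM lee_fin [leRHS]mulrC A_scale.
rewrite ge0_integralZl//; last 3 first.
- exact/measurable_EFinP.
- by move=> x _; rewrite lee_fin A_ge0.
- by rewrite lee_fin invr_ge0 ltW.
rewrite -/I -(fineK Ifin) -EFinM lee_fin mulrC ler_pdivrMr// mul1r.
by rewrite lerDr.
Qed.

Lemma luxemburg_fin (v : X -> R) : orlicz nu A v ->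
  exists2 r : R, (0 <= r)%R & luxemburg nu A v = r%:E.
Proof.
move=> Ov; have [l lv] := luxemburg_level_ex Ov.
have ge : 0 <= luxemburg nu A v.
  by apply: le_ereal_inf_tmp => _ [k [k0 _] <-]; rewrite lee_fin ltW.
have le : luxemburg nu A v <= l%:E by apply: ereal_inf_lbound; exists l.
exists (fine (luxemburg nu A v)); first exact: fine_ge0.
by rewrite fineK// ge0_fin_numE// (le_lt_trans le)// ltry.
Qed.

Lemma luxemburg_ge (v : X -> R) (c : \bar R) :
  (forall l, luxemburg_level v l -> c <= l%:E) -> c <= luxemburg nu A v.
Proof. by move=> H; apply: le_ereal_inf_tmp => _ [k lk <-]; exact: H. Qed.

End luxemburg.

(** * A radial integral *)

Section radial.
Local Open Scope ereal_scope.
Context (R : realType) (n : nat).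
Local Notation leb := (lebesgue_rV R n).

Lemma coord_le_enorm (t : 'rV[R]_n) i : (`|t ord0 i| <= enorm t)%R.
Proof.
rewrite -sqrtr_sqr ler_wsqrtr// /dotp (bigD1 i)//= expr2 lerDl.
by apply: sumr_ge0 => j _; rewrite -expr2 sqr_ge0.
Qed.

Lemma lebesgue_enorm_ball (r : R) : (0 < r)%R ->
  leb [set t | (enorm t <= r)%R] <= ((4 * r) ^+ n)%:E.
Proof.
move=> r0.
have mball : measurable [set t : 'rV[R]_n | (enorm t <= r)%R].
  have := measurable_fun_ler (@measurable_enorm R n) (measurable_cst r).
  by move=> /(_ measurableT [set true] I); rewrite setTI.
apply: (@le_trans _ _ (leb (hbox (const_mx (- (2 * r))%R) (const_mx (2 * r)%R)))).
  (* The factor 2 leaves room for the open side of the box. *)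
  apply: le_measure; rewrite ?inE//; first exact: measurable_hbox.
  move=> t /= tr i; rewrite /= in_itv/= !mxE.
  have := le_trans (coord_le_enorm t i) tr; rewrite ler_norml => /andP[h1 h2].
  apply/andP; split; first by apply: lt_le_trans h1; rewrite ltrN2 ltr_pMl// ltr1n.
  by rewrite (le_trans h2)// ler_peMl ?(ltW r0)// ler1n.
rewrite lebesgue_rV_hbox lee_fin (_ : (4 * r) ^+ n = \prod_(i < n) (4 * r))%R; last first.
  by rewrite prodr_const card_ord.
rewrite le_eqVlt; apply/orP; left; apply/eqP; apply: eq_bigr => i _.
rewrite !mxE opprK max_r; first ring.
by rewrite addr_ge0 ?mulr_ge0 ?ltW.
Qed.

(** The function r^(-n) e^(-c |ln r|) is dominated by a mixture of indicators of
    balls of radius e^y: on the interval [ln r, ln r + 1] the weight stays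
    comparable to its value at ln r. *)
Lemma radial_le (c r : R) : (0 < c)%R -> (0 < r)%R ->
  (expR (- (c * `|ln r|)) / r ^+ n)%:E <=
  (expR (n%:R + c))%:E * \int[lebesgue_measure]_(y in [set y | (r <= expR y)%R])
     (expR (- (n%:R * y) - c * `|y|))%:E.
Proof.
move=> c0 r0; set y0 := ln r.
have mf : measurable_fun setT (fun y : R => (expR (- (n%:R * y) - c * `|y|))%:E).
  apply/measurable_EFinP; apply: (measurableT_comp (f := @expR R)) => //.
  apply: measurable_funB.
    by apply: measurable_funN; exact: measurable_funM.
  by apply: measurable_funM => //; exact: normr_measurable.
apply: (@le_trans _ _ ((expR (n%:R + c))%:E *
   \int[lebesgue_measure]_(y in `[y0, (y0 + 1)%R])
      (expR (- (n%:R * y0) - c * `|y0| - (n%:R + c)))%:E)).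
  rewrite integral_cst//= lebesgue_measure_itv/= lte_fin ltrDl ltr01.
  rewrite -EFinB (_ : y0 + 1 - y0 = 1)%R; last by ring.
  rewrite mule1 -EFinM lee_fin -expRD.
  rewrite -[r]lnK ?posrE// -expRM_natl -expRN -expRD ler_expR -/y0.
  by rewrite le_eqVlt; apply/orP; left; apply/eqP; ring.
apply: lee_wpmul2l; first by rewrite lee_fin expR_ge0.
apply: (@le_trans _ _ (\int[lebesgue_measure]_(y in `[y0, (y0 + 1)%R])
      (expR (- (n%:R * y) - c * `|y|))%:E)).
  apply: ge0_le_integral => //.
  - exact: measurable_funTS.
  - move=> y /=; rewrite in_itv/= => /andP[h1 h2]; rewrite lee_fin ler_expR.
    have n0 : (0 <= n%:R :> R)%R by exact: ler0n.
    have : (n%:R * y <= n%:R * (y0 + 1))%R by rewrite ler_wpM2l.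
    have : (c * `|y| <= c * (`|y0| + 1))%R.
      rewrite ler_wpM2l ?(ltW c0)//.
      rewrite (_ : y = y0 + (y - y0))%R; last by ring.
      rewrite (le_trans (ler_normD _ _))// lerD2l ger0_norm ?subr_ge0//.
      by rewrite lerBlDl.
    lra.
apply: ge0_subset_integral => //.
- have mc : measurable_fun setT (fun _ : R => r) by [].
  have := measurable_fun_ler mc (@measurable_expR R).
  by move=> /(_ measurableT [set true] I); rewrite setTI.
- exact: measurable_funTS.
- move=> y /=; rewrite in_itv/= => /andP[h1 _].
  by rewrite -[r]lnK// ler_expR.
Qed.

Lemma measurable_enormV :
  measurable_fun setT (fun t : 'rV[R]_n => (enorm t ^+ n)^-1)%R.
Proof.
apply: (eq_measurable_fun (fun t : 'rV[R]_n => (enorm t ^+ n) `^ (-1))%R).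
  by move=> t _; rewrite powR_inv1// exprn_ge0// enorm_ge0.
apply: (measurableT_comp (measurable_powR _)); apply: measurable_funX.
exact: measurable_enorm.
Qed.

(** Integrate radial_le in t first: the ball of radius e^y has measure at most
    (4 e^y)^n, which cancels the factor e^(-n y) of the weight. *)
Lemma radial_integral_lty (c : R) : (0 < n)%N -> (0 < c)%R ->
  \int[leb]_t (expR (- (c * `|ln (enorm t)|)) / enorm t ^+ n)%:E < +oo.
Proof.
move=> n0 c0.
pose K := expR (n%:R + c).
pose h (y : R) := expR (- (n%:R * y) - c * `|y|).
have h0 y : (0 <= h y)%R by exact: expR_ge0.
have mh : measurable_fun setT h.
  apply: (measurableT_comp (f := @expR R)) => //.
  apply: measurable_funB.
    by apply: measurable_funN; exact: measurable_funM.
  by apply: measurable_funM => //; exact: normr_measurable.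
pose F (p : 'rV[R]_n * measurableTypeR R) : R :=
  (h p.2 * (enorm p.1 <= expR p.2)%R%:R)%R.
have mF : measurable_fun setT F.
  apply: measurable_funM; first exact: (measurableT_comp mh measurable_snd).
  have mb : measurable_fun setT (fun p : 'rV[R]_n * measurableTypeR R =>
      enorm p.1 <= expR p.2)%R.
    apply: measurable_fun_ler.
      exact: (measurableT_comp (@measurable_enorm R n) measurable_fst).
    exact: (measurableT_comp (@measurable_expR R) measurable_snd).
  apply: (eq_measurable_fun (\1_[set p : 'rV[R]_n * measurableTypeR R |
      (enorm p.1 <= expR p.2)%R] : _ -> R)).
    by move=> p _; rewrite indicE; congr (nat_of_bool _)%:R; apply/idP/idP; rewrite inE.
  apply: measurable_indic.
  by have := mb measurableT [set true] I; rewrite setTI.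
have F0 p : (0 <= F p)%R by rewrite mulr_ge0.
have step1 t : (expR (- (c * `|ln (enorm t)|)) / enorm t ^+ n)%:E <=
    K%:E * \int[lebesgue_measure]_y (F (t, y))%:E.
  have [t0|] := ltP 0%R (enorm t); last first.
    rewrite le_eqVlt ltNge enorm_ge0 orbF => /eqP ->.
    rewrite expr0n gtn_eqF// invr0 mulr0 mule_ge0 ?lee_fin ?expR_ge0//.
    by apply: integral_ge0 => y _; rewrite lee_fin.
  rewrite (le_trans (radial_le c0 t0))// integral_mkcond.
  rewrite le_eqVlt; apply/orP; left; apply/eqP; congr (_ * _).
  apply: eq_integral => y _; rewrite patchE /F /=.
  case: (boolP (enorm t <= expR y)%R) => H.
    by rewrite mem_set//= mulr1.
  by rewrite memNset ?mulr0//=; exact/negP.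
have E0 : forall t, 0 <= \int[lebesgue_measure]_y (F (t, y))%:E.
  by move=> t; apply: integral_ge0 => y _; rewrite lee_fin.
have mI : measurable_fun setT (fun t => \int[lebesgue_measure]_y (F (t, y))%:E).
  apply: (measurable_fun_fubini_tonelli_F (m2 := lebesgue_measure) (EFin \o F)).
    exact/measurable_EFinP.
  by move=> p; rewrite lee_fin.
apply: (@le_lt_trans _ _ (\int[leb]_t (K%:E * \int[lebesgue_measure]_y (F (t, y))%:E))).
  apply: ge0_le_integral => //.
  - by move=> t _; rewrite lee_fin mulr_ge0 ?expR_ge0// invr_ge0 exprn_ge0// enorm_ge0.
  - apply/measurable_EFinP; apply: measurable_funM; last exact: measurable_enormV.
    apply: (measurableT_comp (f := @expR R)) => //; apply: measurable_funN.
    apply: measurable_funM => //; apply: (measurableT_comp (@normr_measurable R setT)).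
    apply: (measurableT_comp (@measurable_ln R)); exact: measurable_enorm.
  - exact: measurable_funeM.
rewrite ge0_integralZl//; last by rewrite lee_fin expR_ge0.
rewrite lte_mul_pinfty ?lee_fin ?expR_ge0//.
rewrite (fubini_tonelli (EFin \o F)); last 2 first.
- exact/measurable_EFinP.
- by move=> p; rewrite lee_fin.
apply: (@le_lt_trans _ _ (\int[lebesgue_measure]_y
    ((4 ^+ n)%:E * (expR (- (c * `|y|)))%:E))).
  apply: ge0_le_integral => //.
  - by move=> y _; apply: integral_ge0 => t _; rewrite lee_fin.
  - apply: (measurable_fun_fubini_tonelli_G (m1 := leb) (EFin \o F)).
      exact/measurable_EFinP.
    by move=> p; rewrite lee_fin.
  - apply: measurable_funeM.
    by have /measurable_int := integrable_expRN_abs c0.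
  - move=> y _.
    have h0' : 0 <= (h y)%:E by rewrite lee_fin.
    have -> : \int[leb]_t (EFin \o F) (t, y) =
        (h y)%:E * leb [set t | (enorm t <= expR y)%R].
      have mb : measurable [set t : 'rV[R]_n | (enorm t <= expR y)%R].
        have := measurable_fun_ler (@measurable_enorm R n) (measurable_cst (expR y)).
        by move=> /(_ measurableT [set true] I); rewrite setTI.
      rewrite -[in RHS](setIT [set t | _]) -integral_indic//.
      rewrite -ge0_integralZl//; last by apply/measurable_EFinP; exact: measurable_indic.
      by apply: eq_integral => t _; rewrite /F /= EFinM indicE;
        congr (_ * (nat_of_bool _)%:R%:E); apply/idP/idP; rewrite inE.
    rewrite (le_trans (lee_wpmul2l h0' (lebesgue_enorm_ball (expR_gt0 y))))//.
    rewrite -!EFinM lee_fin exprMn mulrCA ler_wpM2l ?exprn_ge0//.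
    rewrite /h -expRM_natl -expRD ler_expR.
    by rewrite le_eqVlt; apply/orP; left; apply/eqP; ring.
rewrite ge0_integralZl//.
- by rewrite lte_mul_pinfty ?lee_fin ?exprn_ge0//; exact: integral_expRN_abs_lty.
- by have /measurable_int := integrable_expRN_abs c0.
Qed.

End radial.

(** * Marginal bounds of the difference kernel *)

Section kernel_bounds.
Local Open Scope ereal_scope.
Context (R : realType) (n : nat) (alpha gamma : R) (G : 'rV[R]_n -> R).
Hypotheses (n0 : (0 < n)%N) (gamma0 : (0 < gamma)%R) (gammaalpha : (gamma < alpha)%R)
  (gamma1 : (gamma < 1)%R) (GB : bessel_kernel alpha G).
Local Notation leb := (lebesgue_rV R n).

Let iG : leb.-integrable setT (EFin \o G). Proof. by have [] := GB. Qed.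

Let mG : measurable_fun setT G.
Proof. by apply/measurable_EFinP; exact: measurable_int iG. Qed.

Let mGs t : measurable_fun setT (fun x : 'rV[R]_n => G (x + t)%R).
Proof. by apply: (measurableT_comp mG); exact: measurable_fun_rVD. Qed.

Let mGm t : measurable_fun setT (fun x : 'rV[R]_n => `|G x - G (x + t)%R|)%R.
Proof. by apply: measurableT_comp => //; apply: measurable_funB. Qed.

(** Both marginal bounds follow from this majorant: it is at most 1, and it is
    integrable against |t|^(-n) dt. *)
Lemma min_powR_div_le (b r : R) : (0 < r)%R -> (gamma < b)%R ->
  (Num.min 1 (r `^ b) / r `^ gamma <=
   expR (- (Num.min gamma (b - gamma) * `|ln r|)))%R.
Proof.
move=> r0 gb; rewrite /powR gt_eqF// -expRN.
have mg : (Num.min gamma (b - gamma) <= gamma)%R by rewrite ge_min lexx.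
have mb : (Num.min gamma (b - gamma) <= b - gamma)%R by rewrite ge_min lexx orbT.
set c := Num.min gamma _ in mg mb *.
have [l0|l0] := leP 0%R (ln r).
  apply: (@le_trans _ _ (1 * expR (- (gamma * ln r)))%R).
    by rewrite ler_wpM2r ?expR_ge0// ge_min lexx.
  by rewrite mul1r ler_expR lerN2 ger0_norm// ler_wpM2r.
apply: (@le_trans _ _ (expR (b * ln r) * expR (- (gamma * ln r)))%R).
  by rewrite ler_wpM2r ?expR_ge0// ge_min lexx orbT.
rewrite -expRD ler_expR ltr0_norm// mulrN opprK -mulrBl.
by rewrite ler_wnM2r// ltW.
Qed.

(** Choose b between gamma and min(1, alpha), and use the bound 2 ||G||_1 where
    |t| is large. *)
Lemma bessel_modulus_min : exists b C1 : R, [/\ (gamma < b)%R, (0 <= C1)%R &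
  forall t, (0 < enorm t)%R ->
    \int[leb]_x (`|G x - G (x + t)%R|)%:E <= (C1 * Num.min 1 (enorm t `^ b))%:E].
Proof.
have alpha0 : (0 < alpha)%R by exact: lt_trans gammaalpha.
pose b := ((gamma + Num.min 1 alpha) / 2)%R.
have gm : (gamma < Num.min 1 alpha)%R by rewrite lt_min gamma1.
have gb : (gamma < b)%R by rewrite /b ltr_pdivlMr// mulr2n mulrDr mulr1 ltrD2l.
have bm : (b < Num.min 1 alpha)%R by rewrite /b ltr_pdivrMr// mulr2n mulrDr mulr1 ltrD2r.
have [b1 ba] : (b < 1)%R /\ (b < alpha)%R by move: bm; rewrite lt_min => /andP[].
have b01 : (0 <= b <= 1)%R by rewrite (ltW (lt_trans gamma0 gb)) ltW.
have [C0 C00 HC0] := bessel_kernel_modulus alpha0 GB b01 ba.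
have mnG : measurable_fun setT (fun x : 'rV[R]_n => (`|G x|)%:E).
  by apply/measurable_EFinP; exact: measurableT_comp.
set N1 := \int[leb]_x (`|G x|)%:E.
have N1oo : N1 < +oo by have /integrableP[] := iG.
have N10 : 0 <= N1 by exact: integral_ge0.
have N1fin : N1 \is a fin_num by rewrite ge0_fin_numE.
exists b, (C0 + 2 * fine N1)%R; split => //.
  by rewrite addr_ge0// mulr_ge0// fine_ge0.
move=> t t0; rewrite mulrDl.
have mass : \int[leb]_x (`|G x - G (x + t)%R|)%:E <= (2 * fine N1)%:E.
  apply: (@le_trans _ _ (\int[leb]_x ((`|G x|)%:E + (`|G (x + t)%R|)%:E))).
    apply: ge0_le_integral => //.
    - exact/measurable_EFinP.
    - apply: emeasurable_funD => //; apply/measurable_EFinP.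
      exact: measurableT_comp.
    - by move=> x _; rewrite -EFinD lee_fin ler_normB.
  rewrite ge0_integralD//; last by apply/measurable_EFinP; exact: measurableT_comp.
  by rewrite -(integral_rV_shift t mnG)// -/N1 -{1 2}(fineK N1fin) -EFinD -mulr2n mulr_natl.
rewrite EFinD.
have p0 : (0 <= C0 * Num.min 1 (enorm t `^ b))%R.
  by rewrite mulr_ge0// le_min ler01 powR_ge0.
have q0 : (0 <= 2 * fine N1 * Num.min 1 (enorm t `^ b))%R.
  by rewrite mulr_ge0// ?mulr_ge0 ?fine_ge0// le_min ler01 powR_ge0.
have [h|h] := leP 1%R (enorm t `^ b)%R.
  rewrite (le_trans mass)// mulr1 -[X in X <= _]add0e leeD// lee_fin.
  by rewrite mulr1.
apply: (le_trans (HC0 t t0)); rewrite -[X in X <= _]adde0 leeD// lee_fin.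
by rewrite mulr_ge0 ?mulr_ge0 ?fine_ge0 ?powR_ge0.
Qed.

Lemma measurable_diff_kernel : measurable_fun setT
  (fun q : 'rV[R]_n * ('rV[R]_n * 'rV[R]_n) => diff_kernel gamma G q.1 q.2.1 q.2.2).
Proof.
have mx : measurable_fun setT (fun q : 'rV[R]_n * ('rV[R]_n * 'rV[R]_n) => q.2.1).
  exact: (measurableT_comp measurable_fst measurable_snd).
have mt : measurable_fun setT (fun q : 'rV[R]_n * ('rV[R]_n * 'rV[R]_n) => q.2.2).
  exact: (measurableT_comp measurable_snd measurable_snd).
have mzx : measurable_fun setT (fun q : 'rV[R]_n * ('rV[R]_n * 'rV[R]_n) => (q.1 - q.2.1)%R).
  by apply: measurable_fun_rVB => //; exact: measurable_fst.
apply: measurable_funM.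
  apply: measurable_funB; first exact: (measurableT_comp mG mzx).
  by apply: (measurableT_comp mG); exact: measurable_fun_rVD.
apply: (eq_measurable_fun (fun q : 'rV[R]_n * ('rV[R]_n * 'rV[R]_n) =>
    enorm q.2.2 `^ (- gamma))%R).
  by move=> q _; rewrite powRN.
apply: (measurableT_comp (measurable_powR _)).
exact: (measurableT_comp (@measurable_enorm R n) mt).
Qed.

Lemma diff_kernel0 z x t : enorm t = 0%R -> diff_kernel gamma G z x t = 0%R.
Proof. by move=> t0; rewrite /diff_kernel t0 powR0 ?gt_eqF// invr0 mulr0. Qed.

Lemma normr_diff_kernel z x t :
  (`|diff_kernel gamma G z x t| =
   (enorm t `^ gamma)^-1 * `|G (z - x) - G (z - x + t)%R|)%R.
Proof.
rewrite /diff_kernel normrM mulrC; congr (_ * _)%R.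
by rewrite ger0_norm// invr_ge0 powR_ge0.
Qed.

(** Both integrals reduce to the modulus of continuity of G by a translation,
    preceded in the second one by the reflection x |-> - x. *)
Lemma kernel_bounds : exists C1 C2 : R, [/\ (0 <= C1)%R, (0 <= C2)%R,
  forall x t, \int[leb]_z (`|diff_kernel gamma G z x t|)%:E <= C1%:E &
  forall z, \int[leb \x leb]_p
    (`|diff_kernel gamma G z p.1 p.2| * (enorm p.2 ^+ n)^-1)%:E <= C2%:E].
Proof.
have [b [C1 [gb C10 HC1]]] := bessel_modulus_min.
pose c := Num.min gamma (b - gamma)%R.
have c0 : (0 < c)%R by rewrite lt_min gamma0 subr_gt0.
pose e (t : 'rV[R]_n) := expR (- (c * `|ln (enorm t)|)).
have slice t : (0 < enorm t)%R ->
    ((enorm t `^ gamma)^-1)%:E * \int[leb]_x (`|G x - G (x + t)%R|)%:E <= (C1 * e t)%:E.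
  move=> t0.
  have i0 : 0 <= ((enorm t `^ gamma)^-1)%:E by rewrite lee_fin invr_ge0 powR_ge0.
  rewrite (le_trans (lee_wpmul2l i0 (HC1 t t0)))// -EFinM lee_fin.
  by rewrite mulrCA ler_wpM2l// mulrC min_powR_div_le.
set I := \int[leb]_t (e t / enorm t ^+ n)%:E.
have Ioo : I < +oo by exact: radial_integral_lty.
have I0 : 0 <= I.
  apply: integral_ge0 => t _; rewrite lee_fin mulr_ge0 ?expR_ge0//.
  by rewrite invr_ge0 exprn_ge0// enorm_ge0.
have Ifin : I \is a fin_num by rewrite ge0_fin_numE.
exists C1, (C1 * fine I)%R; split => //.
- by rewrite mulr_ge0// fine_ge0.
- move=> x t; have [t0|] := ltP 0%R (enorm t); last first.
    rewrite le_eqVlt ltNge enorm_ge0 orbF => /eqP t0.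
    by under eq_integral do rewrite diff_kernel0// normr0; rewrite integral0 lee_fin.
  under eq_integral do rewrite normr_diff_kernel EFinM.
  rewrite ge0_integralZl//; last 2 first.
  - apply/measurable_EFinP.
    by apply: (measurableT_comp (mGm t)); exact: measurable_fun_rVB.
  - by rewrite lee_fin invr_ge0 powR_ge0.
  rewrite [X in _ * X](_ : _ = \int[leb]_x (`|G x - G (x + t)%R|)%:E); last first.
    by rewrite [RHS](integral_rV_shift (- x)%R)//; exact/measurable_EFinP.
  rewrite (le_trans (slice t t0))// lee_fin ler_piMr// -expR0 ler_expR.
  by rewrite oppr_le0 mulr_ge0// ltW.
- move=> z.
  have mK : measurable_fun setT (fun p : 'rV[R]_n * 'rV[R]_n =>
      (`|diff_kernel gamma G z p.1 p.2| * (enorm p.2 ^+ n)^-1)%R).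
    apply: measurable_funM.
      apply: measurableT_comp => //.
      exact: (measurableT_comp measurable_diff_kernel (measurable_pair1 z)).
    exact: (measurableT_comp (@measurable_enormV R n) measurable_snd).
  have K0 p : (0 <= `|diff_kernel gamma G z p.1 p.2| * (enorm p.2 ^+ n)^-1)%R.
    by rewrite mulr_ge0// invr_ge0 exprn_ge0// enorm_ge0.
  rewrite (fubini_tonelli2 (fun p => (`|diff_kernel gamma G z p.1 p.2| *
     (enorm p.2 ^+ n)^-1)%:E)); last 2 first.
  - exact/measurable_EFinP.
  - by move=> p; rewrite lee_fin.
  apply: (@le_trans _ _ (\int[leb]_t (C1%:E * (e t / enorm t ^+ n)%:E))).
    apply: ge0_le_integral => //.
    + by move=> t _; apply: integral_ge0 => x _; rewrite lee_fin K0.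
    + apply: (measurable_fun_fubini_tonelli_G (m1 := leb) (fun p =>
        (`|diff_kernel gamma G z p.1 p.2| * (enorm p.2 ^+ n)^-1)%:E)).
        exact/measurable_EFinP.
      by move=> p; rewrite lee_fin.
    + apply: measurable_funeM; apply/measurable_EFinP.
      apply: measurable_funM; last exact: measurable_enormV.
      apply: (measurableT_comp (f := @expR R)) => //; apply: measurable_funN.
      apply: measurable_funM => //; apply: (measurableT_comp (@normr_measurable R setT)).
      apply: (measurableT_comp (@measurable_ln R)); exact: measurable_enorm.
    move=> t _; rewrite /fubini_G /=.
    have en0 : (0 <= (enorm t ^+ n)^-1)%R by rewrite invr_ge0 exprn_ge0// enorm_ge0.
    have [t0|] := ltP 0%R (enorm t); last first.
      rewrite le_eqVlt ltNge enorm_ge0 orbF => /eqP t0.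
      under eq_integral do rewrite diff_kernel0// normr0 mul0r.
      by rewrite integral0 -EFinM lee_fin !mulr_ge0 ?expR_ge0.
    under eq_integral do rewrite normr_diff_kernel mulrAC EFinM.
    rewrite ge0_integralZl//; last 2 first.
    + apply/measurable_EFinP; apply: (measurableT_comp (mGm t)).
      exact: measurable_fun_rVB.
    + by rewrite lee_fin mulr_ge0// invr_ge0 powR_ge0.
    rewrite [X in _ * X](_ : _ = \int[leb]_x (`|G x - G (x + t)%R|)%:E); last first.
      have mGmE : measurable_fun setT (fun x : 'rV[R]_n => (`|G x - G (x + t)%R|)%:E).
        exact/measurable_EFinP.
      rewrite [RHS](integral_rV_shift z)//.
      rewrite [RHS]integral_rVN//; last first.
        by apply: (measurableT_comp mGmE); exact: measurable_fun_rVD.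
      by apply: eq_integral => x _; rewrite /= [(- x + z)%R]addrC.
    rewrite mulrC EFinM -muleA.
    have en0' : 0 <= ((enorm t ^+ n)^-1)%:E by rewrite lee_fin.
    rewrite (le_trans (lee_wpmul2l en0' (slice t t0)))// -!EFinM lee_fin.
    by rewrite le_eqVlt; apply/orP; left; apply/eqP; ring.
  rewrite ge0_integralZl//.
  + by rewrite -/I EFinM fineK.
  + apply/measurable_EFinP.
    apply: measurable_funM; last exact: measurable_enormV.
    apply: (measurableT_comp (f := @expR R)) => //; apply: measurable_funN.
    apply: measurable_funM => //; apply: (measurableT_comp (@normr_measurable R setT)).
    apply: (measurableT_comp (@measurable_ln R)); exact: measurable_enorm.
  + by move=> t _; rewrite lee_fin mulr_ge0 ?expR_ge0// invr_ge0 exprn_ge0// enorm_ge0.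
Qed.

End kernel_bounds.

(** * The bilinear estimate *)

Section frac_integral.
Local Open Scope ereal_scope.
Context (R : realType) (n : nat).
Local Notation leb := (lebesgue_rV R n).
Local Notation rV2 := ('rV[R]_n * 'rV[R]_n)%type.

Definition frac_density (p : rV2) : R := ((enorm p.2 ^+ n)^-1)%R.

Lemma frac_density_ge0 p : (0 <= frac_density p)%R.
Proof. by rewrite invr_ge0 exprn_ge0// enorm_ge0. Qed.

Lemma measurable_frac_density : measurable_fun setT frac_density.
Proof. exact: (measurableT_comp (@measurable_enormV R n) measurable_snd). Qed.

Lemma ge0_integral_frac_measure (g : rV2 -> \bar R) :
  (forall p, 0 <= g p) -> measurable_fun setT g ->
  \int[@frac_measure R n]_p g p =
  \int[(leb \x leb)%E]_p (g p * (frac_density p)%:E).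
Proof.
exact: (@ge0_integral_density _ _ R (leb \x leb)%E _ frac_density_ge0 measurable_frac_density).
Qed.

End frac_integral.

(** A bound by C l k for all admissible l and k passes to the infima r and s,
    one variable at a time. If r = 0 some admissible k is needed: there is one,
    as an empty set of levels would have infimum +oo. *)
Lemma le_mul_of_levels (R : realType) (C r s : R) (x : \bar R) (P Q : R -> Prop) :
  (0 < C)%R ->
  (forall l, P l -> 0 < l)%R -> (forall k, Q k -> 0 < k)%R -> (0 <= r)%R -> (0 <= s)%R ->
  (forall c : \bar R, (forall l, P l -> c <= l%:E)%E -> (c <= r%:E)%E) ->
  (forall c : \bar R, (forall k, Q k -> c <= k%:E)%E -> (c <= s%:E)%E) ->
  (0 <= x)%E ->
  (forall l k, P l -> Q k -> x <= (C * l * k)%:E)%E ->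
  (x <= (C * r * s)%:E)%E.
Proof.
move=> C0 P0 Q0 r0 s0 Pr Qs x0 H.
have H1 k : Q k -> (x <= (C * k * r)%:E)%E.
  move=> Qk; have Ck : 0 < C * k by rewrite mulr_gt0// Q0.
  rewrite EFinM -lee_pdivrMl//; apply: Pr => l Pl.
  by rewrite lee_pdivrMl// -EFinM mulrAC H.
have [rle0|r_gt0] := leP r 0.
  have r_eq0 : r = 0 by apply/eqP; rewrite eq_le rle0.
  have [k Qk] : exists k, Q k.
    apply: contrapT => nQ.
    by have := Qs +oo%E; rewrite leye_eq => /(_ (fun k Qk => False_ind _ (nQ (ex_intro _ k Qk)))).
  by have := H1 k Qk; rewrite r_eq0 !(mulr0, mul0r).
have Cr : 0 < C * r by rewrite mulr_gt0.
rewrite EFinM -lee_pdivrMl//; apply: Qs => k Qk.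
by rewrite lee_pdivrMl// -EFinM mulrAC H1.
Qed.

(** A Schur test: in the term with a integrate the kernel in z first, in the
    term with c integrate it in p first. *)
Lemma schur_test (R : realType) (d1 d2 : measure_display)
    (X1 : measurableType d1) (X2 : measurableType d2)
    (m1 : {sigma_finite_measure set X1 -> \bar R})
    (m2 : {sigma_finite_measure set X2 -> \bar R})
    (delta : X2 -> R) (K : X1 -> X2 -> R) (a : X2 -> R) (c : X1 -> R) (C1 C2 : R) :
  (forall p, 0 <= delta p) -> measurable_fun setT delta ->
  (forall z p, 0 <= K z p) -> measurable_fun setT (fun q => K q.1 q.2) ->
  (forall p, 0 <= a p) -> measurable_fun setT a ->
  (forall z, 0 <= c z) -> measurable_fun setT c ->
  0 <= C1 -> 0 <= C2 ->
  (forall p, \int[m1]_z (K z p)%:E <= C1%:E)%E ->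
  (forall z, \int[m2]_p (K z p * delta p)%:E <= C2%:E)%E ->
  (\int[m2]_p (a p * delta p)%:E <= 1)%E ->
  (\int[m1]_z (c z)%:E <= 1)%E ->
  (\int[m1]_z \int[m2]_p (K z p * (a p + c z) * delta p)%:E <= (C1 + C2)%:E)%E.
Proof.
move=> d0 md K0 mK a0 ma c0 mc C10 C20 HK1 HK2 Ha Hc.
have mKz z : measurable_fun setT (K z).
  exact: (measurableT_comp mK (measurable_pair1 z)).
have mKp p : measurable_fun setT (K^~ p).
  exact: (measurableT_comp mK (measurable_pair2 p)).
pose F (q : X1 * X2) : R := K q.1 q.2 * a q.2 * delta q.2.
pose F' (q : X1 * X2) : R := K q.1 q.2 * delta q.2.
have mF : measurable_fun setT F.
  apply: measurable_funM; last exact: (measurableT_comp md measurable_snd).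
  by apply: measurable_funM => //; exact: (measurableT_comp ma measurable_snd).
have mF' : measurable_fun setT F'.
  by apply: measurable_funM => //; exact: (measurableT_comp md measurable_snd).
have F0 q : 0 <= F q by rewrite !mulr_ge0.
have F'0 q : 0 <= F' q by rewrite !mulr_ge0.
have mFI : measurable_fun setT (fun z => \int[m2]_p (F (z, p))%:E)%E.
  apply: (measurable_fun_fubini_tonelli_F (m2 := m2) (EFin \o F)).
    exact/measurable_EFinP.
  by move=> q; rewrite lee_fin.
have mFI' : measurable_fun setT (fun z => \int[m2]_p (F' (z, p))%:E)%E.
  apply: (measurable_fun_fubini_tonelli_F (m2 := m2) (EFin \o F')).
    exact/measurable_EFinP.
  by move=> q; rewrite lee_fin.
rewrite (_ : (\int[m1]_z _ = \int[m1]_z (\int[m2]_p (F (z, p))%:E +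
    (c z)%:E * \int[m2]_p (F' (z, p))%:E))%E); last first.
  apply: eq_integral => z _; rewrite -ge0_integralZl//; last 3 first.
  - apply/measurable_EFinP; exact: (measurableT_comp mF' (measurable_pair1 z)).
  - by move=> p _; rewrite lee_fin F'0.
  - by rewrite lee_fin.
  rewrite -ge0_integralD//.
  - by apply: eq_integral => p _; rewrite -EFinM -EFinD /F /F' /=; congr EFin; ring.
  - by move=> p _; rewrite lee_fin F0.
  - apply/measurable_EFinP; exact: (measurableT_comp mF (measurable_pair1 z)).
  - by move=> p _; rewrite mule_ge0 ?lee_fin ?F'0.
  - apply: measurable_funeM; apply/measurable_EFinP.
    exact: (measurableT_comp mF' (measurable_pair1 z)).
rewrite ge0_integralD//; last 3 first.
- by move=> z _; apply: integral_ge0 => p _; rewrite lee_fin.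
- by move=> z _; rewrite mule_ge0 ?lee_fin//; apply: integral_ge0 => p _; rewrite lee_fin.
- by apply: emeasurable_funM => //; exact/measurable_EFinP.
rewrite EFinD leeD//.
  rewrite (fubini_tonelli (EFin \o F)); last 2 first.
  - exact/measurable_EFinP.
  - by move=> q; rewrite lee_fin.
  apply: (@le_trans _ _ (\int[m2]_p (C1%:E * (a p * delta p)%:E))%E).
    apply: ge0_le_integral => //.
    - by move=> p _; apply: integral_ge0 => z _; rewrite lee_fin.
    - apply: (measurable_fun_fubini_tonelli_G (m1 := m1) (EFin \o F)).
        exact/measurable_EFinP.
      by move=> q; rewrite lee_fin.
    - by apply: measurable_funeM; apply/measurable_EFinP; exact: measurable_funM.
    - move=> p _.
      have -> : (\int[m1]_z (EFin \o F) (z, p) = (a p * delta p)%:E * \int[m1]_z (K z p)%:E)%E.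
        rewrite -ge0_integralZl//; last 3 first.
        + exact/measurable_EFinP.
        + by move=> z _; rewrite lee_fin.
        + by rewrite lee_fin mulr_ge0.
        by apply: eq_integral => z _; rewrite -EFinM /F /=; congr EFin; ring.
      by rewrite muleC lee_wpmul2r// lee_fin mulr_ge0.
  rewrite ge0_integralZl//; last 2 first.
  - by apply/measurable_EFinP; exact: measurable_funM.
  - by move=> p _; rewrite lee_fin mulr_ge0.
  by rewrite -[leRHS]mule1 lee_wpmul2l// lee_fin.
apply: (@le_trans _ _ (\int[m1]_z (C2%:E * (c z)%:E))%E).
  apply: ge0_le_integral => //.
  - by move=> z _; rewrite mule_ge0 ?lee_fin//; apply: integral_ge0 => p _; rewrite lee_fin.
  - by apply: emeasurable_funM => //; exact/measurable_EFinP.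
  - by apply: measurable_funeM; apply/measurable_EFinP.
  - by move=> z _; rewrite [leRHS]muleC lee_wpmul2l ?lee_fin//; exact: HK2.
rewrite ge0_integralZl//; last 2 first.
- exact/measurable_EFinP.
- by move=> z _; rewrite lee_fin.
by rewrite -[leRHS]mule1 lee_wpmul2l// lee_fin.
Qed.

Section lebesgue_rV2.
Context (R : realType) (n : nat).
Local Notation leb := (lebesgue_rV R n).

(** An alias of the product measure that carries its sigma-finiteness. *)
Definition lebesgue_rV2 : set ('rV[R]_n * 'rV[R]_n) -> \bar R := (leb \x leb)%E.

HB.instance Definition _ := Measure.copy lebesgue_rV2 (leb \x leb)%E.

Let sigma_finite_lebesgue_rV2 : sigma_finite setT lebesgue_rV2.
Proof.
pose B (k : nat) : set 'rV[R]_n := hbox (const_mx (- k%:R)) (const_mx k%:R).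
have mB k : measurable (B k) by exact: measurable_hbox.
have subB i j : (i <= j)%N -> B i `<=` B j.
  move=> ij x Bx l; have := Bx l; rewrite /= !in_itv/= !mxE => /andP[h1 h2].
  have ijR : i%:R <= j%:R :> R by rewrite ler_nat.
  by rewrite (le_lt_trans _ h1) ?(le_trans h2)// lerN2.
exists (fun k => B k `*` B k).
  apply/esym; rewrite -subTset => -[x y] _.
  have [i _ Bi] : (\bigcup_k B k) x by rewrite bigcup_hbox.
  have [j _ Bj] : (\bigcup_k B k) y by rewrite bigcup_hbox.
  by exists (maxn i j) => //; split; [apply: subB Bi|apply: subB Bj];
    rewrite ?leq_maxl ?leq_maxr.
move=> k; split; first exact: measurableX.
rewrite /lebesgue_rV2 product_measure1E// lte_mul_pinfty//.
  by rewrite ge0_fin_numE// lebesgue_rV_hbox_lty.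
exact: lebesgue_rV_hbox_lty.
Qed.

HB.instance Definition _ := Measure_isSigmaFinite.Build _ _ _
  lebesgue_rV2 sigma_finite_lebesgue_rV2.

End lebesgue_rV2.

Theorem proposition3p8 (R : realType) (n : nat) (A : R -> R) (alpha gamma : R)
    (G : 'rV[R]_n -> R) :
  (0 < n)%N -> young_function A ->
  0 < gamma -> gamma < alpha -> gamma < 1 ->
  bessel_kernel alpha G ->
  exists2 C : R, 0 < C &
    forall (v : 'rV[R]_n * 'rV[R]_n -> R) (w : 'rV[R]_n -> R),
      orlicz (@frac_measure R n) A v ->
      orlicz (lebesgue_rV R n) (complementary A) w ->
      (\int[lebesgue_rV R n]_z \int[@frac_measure R n]_p
          (`|diff_kernel gamma G z p.1 p.2 * v p * w z|)%:E <=
       C%:E * luxemburg (@frac_measure R n) A v *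
         luxemburg (lebesgue_rV R n) (complementary A) w)%E.
Proof.
move=> n0 YA gamma0 gammaalpha gamma1 GB.
have [C1 [C2 [C10 C20 HK1 HK2]]] := kernel_bounds n0 gamma0 gammaalpha gamma1 GB.
have A0 := young_ge0 YA.
have Amono s t : 0 <= s -> s <= t -> A s <= A t.
  move=> s0 st; apply: (young_nondecreasing YA) => //; rewrite in_itv/= ?s0//.
  by rewrite (le_trans s0 st).
have Ascale := young_scale YA.
have B0 := complementary_ge0 YA.
have Bmono := complementary_nondecreasing YA.
have Bscale := complementary_scale YA.
exists (C1 + C2 + 1) => [|v w Ov Ow].
  by rewrite ltr_pwDr// addr_ge0.
have [r r0 rE] := luxemburg_fin A0 Amono Ascale Ov.
have [s s0 sE] := luxemburg_fin B0 Bmono Bscale Ow.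
rewrite rE sE -!EFinM.
have [mv _] := Ov; have [mw _] := Ow.
have mK := measurable_diff_kernel gamma GB.
pose mu := @frac_measure R n.
apply: (@le_mul_of_levels _ _ _ _ _ (luxemburg_level mu A v)
   (luxemburg_level (lebesgue_rV R n) (complementary A) w)) => //.
- by rewrite ltr_pwDr// addr_ge0.
- by move=> l [].
- by move=> k [].
- by move=> c Hc; rewrite -rE; apply: luxemburg_ge.
- by move=> c Hc; rewrite -sE; apply: luxemburg_ge.
- by apply: integral_ge0 => z _; apply: integral_ge0 => p _; rewrite lee_fin.
move=> l k [l0 Hl] [k0 Hk].
pose a p := A (`|v p| / l); pose c z := complementary A (`|w z| / k).
(* The constant l k of Young's inequality is put into the kernel. *)
have lk0 : 0 <= l * k by rewrite mulr_ge0// ltW.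
pose K z p := l * k * `|diff_kernel gamma G z p.1 p.2|.
have K0 z p : 0 <= K z p by rewrite mulr_ge0.
have mKn : measurable_fun setT (fun q : 'rV[R]_n * ('rV[R]_n * 'rV[R]_n) => K q.1 q.2).
  by apply: measurable_funM => //; exact: measurableT_comp.
have ma : measurable_fun setT a by exact: measurable_orlicz.
have mc : measurable_fun setT c by exact: (measurable_orlicz (A := complementary A)).
have a0 p : 0 <= a p by rewrite A0// divr_ge0// ltW.
have c0 z : 0 <= c z by rewrite B0// divr_ge0// ltW.
have aint : (\int[(lebesgue_rV R n \x lebesgue_rV R n)%E]_p (a p * frac_density p)%:E <= 1)%E.
  have aE0 p : (0 <= (a p)%:E)%E by rewrite lee_fin.
  have maE : measurable_fun setT (fun p => (a p)%:E) by exact/measurable_EFinP.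
  by have := ge0_integral_frac_measure aE0 maE; rewrite -/mu => <-.
have HK1' p : (\int[lebesgue_rV R n]_z (K z p)%:E <= (l * k * C1)%:E)%E.
  rewrite /K EFinM; under eq_integral do rewrite EFinM.
  rewrite ge0_integralZl//; last first.
    apply/measurable_EFinP; apply: measurableT_comp => //.
    exact: (measurableT_comp mK (measurable_pair2 p)).
  by rewrite lee_wpmul2l// lee_fin.
have HK2' z : (\int[(lebesgue_rV R n \x lebesgue_rV R n)%E]_p
    (K z p * frac_density p)%:E <= (l * k * C2)%:E)%E.
  rewrite /K EFinM; under eq_integral do rewrite -mulrA EFinM.
  rewrite ge0_integralZl//; last 2 first.
  - apply/measurable_EFinP; apply: measurable_funM; last exact: measurable_frac_density.
    apply: measurableT_comp => //.
    exact: (measurableT_comp mK (measurable_pair1 z)).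
  - by move=> p _; rewrite lee_fin mulr_ge0// frac_density_ge0.
  by rewrite lee_wpmul2l// ?lee_fin//; exact: HK2.
have lkC1 : 0 <= l * k * C1 by rewrite mulr_ge0.
have lkC2 : 0 <= l * k * C2 by rewrite mulr_ge0.
have Hk' : (\int[lebesgue_rV R n]_z (c z)%:E <= 1)%E by exact: Hk.
have main := @schur_test R _ _ 'rV[R]_n ('rV[R]_n * 'rV[R]_n)%type (lebesgue_rV R n)
  (@lebesgue_rV2 R n) (@frac_density R n) K a c
  (l * k * C1) (l * k * C2) (@frac_density_ge0 R n) (@measurable_frac_density R n)
  K0 mKn a0 ma c0 mc lkC1 lkC2 HK1' HK2' aint Hk'.
pose F1 (q : 'rV[R]_n * ('rV[R]_n * 'rV[R]_n)) : R :=
  `|diff_kernel gamma G q.1 q.2.1 q.2.2 * v q.2 * w q.1| * frac_density q.2.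
pose F2 (q : 'rV[R]_n * ('rV[R]_n * 'rV[R]_n)) : R :=
  K q.1 q.2 * (a q.2 + c q.1) * frac_density q.2.
have mKvw : measurable_fun setT (fun q : 'rV[R]_n * ('rV[R]_n * 'rV[R]_n) =>
    `|diff_kernel gamma G q.1 q.2.1 q.2.2 * v q.2 * w q.1|).
  apply: measurableT_comp => //; apply: measurable_funM.
    by apply: measurable_funM => //; exact: (measurableT_comp mv measurable_snd).
  exact: (measurableT_comp mw measurable_fst).
have md : measurable_fun setT (fun q : 'rV[R]_n * ('rV[R]_n * 'rV[R]_n) => frac_density q.2).
  exact: (measurableT_comp (@measurable_frac_density R n) measurable_snd).
have mF1 : measurable_fun setT F1 by exact: measurable_funM.
have mF2 : measurable_fun setT F2.
  apply: measurable_funM => //; apply: measurable_funM => //; apply: measurable_funD.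
    exact: (measurableT_comp ma measurable_snd).
  exact: (measurableT_comp mc measurable_fst).
have F10 q : 0 <= F1 q by rewrite mulr_ge0// frac_density_ge0.
have F12 q : F1 q <= F2 q.
  have Y : `|v q.2| / l * (`|w q.1| / k) <= a q.2 + c q.1.
    by rewrite young_inequality// divr_ge0// ltW.
  rewrite /F1 /F2 ler_wpM2r ?frac_density_ge0// /K.
  move: (diff_kernel gamma G q.1 q.2.1 q.2.2) => D; rewrite !normrM.
  rewrite (_ : `|D| * _ * _ = l * k * `|D| * (`|v q.2| / l * (`|w q.1| / k))); last first.
    by field; rewrite !gt_eqF.
  by rewrite ler_wpM2l// mulr_ge0.
have F20 q : 0 <= F2 q by exact: le_trans (F12 q).
apply: (@le_trans _ _ (l * k * C1 + l * k * C2)%:E); last first.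
  rewrite lee_fin; have := lk0; nra.
apply: le_trans main.
have eF1 z : (\int[mu]_p (`|diff_kernel gamma G z p.1 p.2 * v p * w z|)%:E =
    \int[(lebesgue_rV R n \x lebesgue_rV R n)%E]_p (F1 (z, p))%:E)%E.
  rewrite ge0_integral_frac_measure//.
  by apply/measurable_EFinP; exact: (measurableT_comp mKvw (measurable_pair1 z)).
under eq_integral do rewrite eF1.
apply: ge0_le_integral => //.
- by move=> z _; apply: integral_ge0 => p _; rewrite lee_fin.
- apply: (measurable_fun_fubini_tonelli_F (m2 := @lebesgue_rV2 R n) (EFin \o F1)).
    exact/measurable_EFinP.
  by move=> q; rewrite lee_fin.
- apply: (measurable_fun_fubini_tonelli_F (m2 := @lebesgue_rV2 R n) (EFin \o F2)).
    exact/measurable_EFinP.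
  by move=> q; rewrite lee_fin.
move=> z _; apply: ge0_le_integral => //.
- by move=> p _; rewrite lee_fin.
- apply/measurable_EFinP; exact: (measurableT_comp mF1 (measurable_pair1 z)).
- apply/measurable_EFinP; exact: (measurableT_comp mF2 (measurable_pair1 z)).
- by move=> p _; rewrite lee_fin; exact: (F12 (z, p)).
Qed.
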